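(* Let $V\subset\mathbb{D}^2$ be a distinguished variety, defined as the zero set (in $\mathbb{D}^2$) of a polynomial $p\in\mathbb{C}[z,w]$ of minimal degree $(n,m)$. Then there exist an $(m+n)\times(m+n)$ unitary matrix \[ U=\begin{pmatrix}A&B\\ C&D\end{pmatrix}:\mathbb{C}^m\oplus\mathbb{C}^n\to\mathbb{C}^m\oplus\mathbb{C}^n \] and a $\mathbb{C}^m$-valued polynomial $\vec{Q}(z,w)$ of degree at most $(n,m-1)$ such that: (i) $D$ has no unimodular eigenvalues; (ii) $p(z,w)$ is a constant multiple of $\det\begin{pmatrix}A-wI_m&zB\\ C&zD-I_n\end{pmatrix}$; (iii) with $\Phi$ the rational matrix-valued inner function $\Phi(z)=A+zB(I_n-zD)^{-1}C$, one has $V=\{(z,w)\in\mathbb{D}^2:\det(wI_m-\Phi(z))=0\}$; (iv) $\vec{Q}$ has at most finitely many zeros on $V$, and $\Phi(z)\vec{Q}(z,w)=w\vec{Q}(z,w)$ for all $(z,w)\in V$. In addition, if $V$ has no singularities on $\mathbb{T}^2$, then $U$ (hence $\Phi$) and $\vec{Q}$ satisfying (i)-(iv) may be chosen so that when we write \[ \vec{Q}(z,w)=Q(z)\begin{pmatrix}1\\ w\\ \vdots\\ w^{m-1}\end{pmatrix}, \] where $Q(z)$ is an $m\times m$ matrix polynomial of degree at most $n$ in each entry, the matrix $Q(z)$ is invertible for all $z\in\overline{\mathbb{D}}$. In particular, $\vec{Q}(z,w)$ then has no zeros in $\overline{\mathbb{D}^2}$.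
   Context: $\mathbb{D}$ is the open unit disk, $\mathbb{T}$ the unit circle. A non-empty set $V\subset\mathbb{C}^2$ is a distinguished variety if there is $p\in\mathbb{C}[z,w]$ with $V=\{(z,w)\in\mathbb{D}^2:p(z,w)=0\}$ and $\overline{V}\cap\partial(\mathbb{D}^2)=\overline{V}\cap\mathbb{T}^2$ (closure in $\overline{\mathbb{D}^2}$). Degree $(n,m)$ means degree $n$ in $z$ and $m$ in $w$; degree at most $(n,m)$ means at most $n$ in $z$ and at most $m$ in $w$ (componentwise for vector polynomials). That $p$ has minimal degree means that no polynomial whose zero set in $\mathbb{D}^2$ is $V$ has smaller degree in $z$ or smaller degree in $w$ than $p$ (such $p$ is a product of distinct irreducible factors). A rational matrix-valued function on $\mathbb{D}$ is inner if it is unitary-valued on the unit circle. $V$ has no singularities on $\mathbb{T}^2$ means: there is no point of $\mathbb{T}^2$ at which $p$ and both partial derivatives $p_z,p_w$ vanish. *)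

(* Defs.v *)
From mathcomp Require Export all_boot all_order all_algebra.
From mathcomp Require Export complex.
From mathcomp Require Export classical_sets cardinality reals topology normedtype.

Set Implicit Arguments.
Unset Strict Implicit.
Unset Printing Implicit Defensive.

Import Order.TTheory GRing.Theory Num.Theory.
Import numFieldNormedType.Exports.
Local Open Scope classical_set_scope.
Local Open Scope ring_scope.

(* A bivariate polynomial p(z, w) is an element of {poly {poly R[i]}} whose
   outer variable is z and whose inner variable is w: p.[z, w] is its value,
   size p is 1 + its degree in z, and sizeY p is 1 + its degree in w. *)

Definition has_degree (K : nzRingType) (n m : nat) (p : {poly {poly K}}) : Prop :=
  size p = n.+1 /\ sizeY p = m.+1.

Definition degree_at_most (K : nzRingType) (n m : nat) (p : {poly {poly K}}) : Prop :=
  (size p <= n.+1)%N /\ (sizeY p <= m.+1)%N.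

Definition topological_boundary (T : topologicalType) (S : set T) : set T :=
  closure S `\` interior S.

Section DistinguishedVarieties.
Variable R : realType.
Local Notation C2 := (R[i] * R[i])%type.

(* R[i]^o carries the topology given by the modulus; C2top has the product
   topology. *)
Local Notation C2top := (R[i]^o * R[i]^o)%type.

Definition bidisk : set C2 := [set x | `|x.1| < 1 /\ `|x.2| < 1].

Definition torus : set C2 := [set x | `|x.1| = 1 /\ `|x.2| = 1].

Definition zero_set (p : {poly {poly R[i]}}) : set C2 :=
  [set x | bidisk x /\ p.[x.1, x.2] = 0].

(* The closed bidisk is closed in C2top, so the closure of a subset of the
   bidisk may be taken in C2top. *)
Definition distinguished_variety (V : set C2) : Prop :=
  [/\ V !=set0,
      exists p : {poly {poly R[i]}}, V = zero_set p
    & closure (V : set C2top) `&` topological_boundary (bidisk : set C2top)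
      = closure (V : set C2top) `&` (torus : set C2top)].

Definition minimal_degree (V : set C2) (n m : nat) (p : {poly {poly R[i]}}) : Prop :=
  has_degree n m p /\
  (forall q : {poly {poly R[i]}}, zero_set q = V ->
     (size p <= size q)%N /\ (sizeY p <= sizeY q)%N).

Definition singular_point (p : {poly {poly R[i]}}) (x : C2) : Prop :=
  [/\ p.[x.1, x.2] = 0,
      (p^`()).[x.1, x.2] = 0
    & (map_poly (@deriv R[i]) p).[x.1, x.2] = 0].

Definition no_singularities_on_torus (p : {poly {poly R[i]}}) : Prop :=
  ~ exists2 x : C2, torus x & singular_point p x.

Definition mxeval (m k : nat) (P : 'M[{poly R[i]}]_(m, k)) (z : R[i]) :
  'M[R[i]]_(m, k) := map_mx (fun q => q.[z]) P.

Definition mxeval2 (m k : nat) (P : 'M[{poly {poly R[i]}}]_(m, k)) (z w : R[i]) :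
  'M[R[i]]_(m, k) := map_mx (fun q => q.[z, w]) P.

(* The poles are required to lie off the closed disk: the function has to be
   defined on the disk, and on the circle for the inner condition. *)
Definition rational_inner (m : nat) (F : R[i] -> 'M[R[i]]_m) : Prop :=
  (exists (q : {poly R[i]}) (P : 'M[{poly R[i]}]_m),
     forall z : R[i], `|z| <= 1 ->
       q.[z] != 0 /\ F z = (q.[z])^-1 *: mxeval P z) /\
  (forall z : R[i], `|z| = 1 -> F z \is unitarymx).

Definition transfer (m n : nat) (A : 'M[R[i]]_m) (B : 'M[R[i]]_(m, n))
    (C : 'M[R[i]]_(n, m)) (D : 'M[R[i]]_n) (z : R[i]) : 'M[R[i]]_m :=
  A + z *: (B *m invmx (1%:M - z *: D) *m C).

Definition pencil (m n : nat) (A : 'M[R[i]]_m) (B : 'M[R[i]]_(m, n))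
    (C : 'M[R[i]]_(n, m)) (D : 'M[R[i]]_n) (z w : R[i]) : 'M[R[i]]_(m + n) :=
  block_mx (A - w%:M) (z *: B) C (z *: D - 1%:M).

Definition monomials (m : nat) (w : R[i]) : 'cV[R[i]]_m := \col_(j < m) w ^+ j.

Definition determinantal_representation (V : set C2) (n m : nat)
    (p : {poly {poly R[i]}}) (A : 'M[R[i]]_m) (B : 'M[R[i]]_(m, n))
    (C : 'M[R[i]]_(n, m)) (D : 'M[R[i]]_n) (Q : 'cV[{poly {poly R[i]}}]_m) : Prop :=
  let Phi := transfer A B C D in
  [/\ block_mx A B C D \is unitarymx
    & forall i, degree_at_most n m.-1 (Q i 0)] /\
  [/\ forall l : R[i], eigenvalue D l -> `|l| <> 1,
      exists c : R[i], forall z w : R[i],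
        p.[z, w] = c * \det (pencil A B C D z w),
      (* invmx M is M when M is singular, hence the first conjunct *)
      [/\ forall z : R[i], `|z| <= 1 -> 1%:M - z *: D \in unitmx,
          rational_inner Phi
        & V = [set x | bidisk x /\ \det ((x.2)%:M - Phi x.1) = 0]]
    & finite_set [set x | V x /\ mxeval2 Q x.1 x.2 = 0] /\
      (forall x : C2, V x ->
         Phi x.1 *m mxeval2 Q x.1 x.2 = x.2 *: mxeval2 Q x.1 x.2)].

End DistinguishedVarieties.

(* Main.v *)
(* Write p as a polynomial P(z, .) of degree m in w. The closure condition gives
   p <> 0 on T x D and D x T. The power sums of the roots of P(z, .) in the disk
   are locally uniform limits of polynomials in z; since those roots tend to the
   circle as z does, reflection in the circle turns them, after multiplication by
   a power of the reversed constant coefficient, into polynomials (a Liouville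
   argument). Hankel elimination then yields a polynomial vanishing exactly at
   the roots in the disk, so by minimality all m roots lie in the disk for z in D;
   hence they lie on the circle for z in T, the leading coefficient has no zeros
   in the closed disk, and it is a multiple of the reversed constant coefficient.

   For z in T the quotients P(z, .) / (w - x), x running through the roots, have a
   positive semidefinite Gram matrix z^-n G(z) for which the companion matrix of
   P(z, .) is an isometry. A matrix Fejer-Riesz factorization G = Q^* Q conjugates
   the companion matrix into a rational inner function Phi = Q Comp Q^-1, which is
   realized by a unitary colligation by splitting off Blaschke-Potapov factors,
   one for each of the n zeros of its determinant. The eigenvector of Comp for a
   root w is (1, w, ..., w^(m-1)).

   If Q(z) is singular at some z in T then P(z, .) has a double root w there; the
   unitary matrix Phi(z) then has w as an eigenvalue of multiplicity at least two,
   so det (w - Phi) vanishes to second order in z and (z, w) is a singular point. *)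

From mathcomp Require Import cyclic separable cyclotomic.
From mathcomp Require Import zify ring.
From mathcomp Require boolp.
Require Import Defs.
Import Order.TTheory GRing.Theory Num.Theory.

Set Implicit Arguments.
Unset Strict Implicit.
Unset Printing Implicit Defensive.

Local Open Scope ring_scope.
Local Open Scope sesquilinear_scope.

(** * Polynomials on the unit circle *)

Section DiskPolynomials.
Variable C : numClosedFieldType.
Implicit Types (q g h e : {poly C}) (z w a t : C).

(** Up to the topology of the bidisk the argument runs over an arbitrary [numClosedFieldType], with
    only the Archimedean hypothesis [arch] where limits are taken; it uses neither completeness nor
    compactness. Lower bounds are read off factorizations into linear factors, contour integrals
    become averages over roots of unity, and a limit of polynomials of bounded degree is recovered
    from its values at interpolation nodes. Matrix factorizations are first produced with
    denominators, since Schur complements and inverses are rational. The denominators are removed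
    afterwards by reflection: an identity on the circle becomes one between polynomials through
    [revp], and at the mirror image in the disk of a root of the denominator the invertibility of
    one factor forces the other to vanish. Elimination controls zeros only off finitely many [z],
    whereas minimality concerns the whole zero set. The bridge is that, for a polynomial without
    vertical lines, zeros move continuously with [z]. *)

Lemma conj_circle z : `|z| = 1 -> z^* = z^-1.
Proof. by move=> hz; rewrite invC_norm hz expr1n invr1 mul1r. Qed.

Lemma circle_neq0 z : `|z| = 1 -> z != 0.
Proof. by move=> hz; rewrite -normr_gt0 hz ltr01. Qed.

Lemma conjK_circle z : `|z| = 1 -> z^* * z = 1.
Proof. by move=> hz; rewrite conj_circle // mulVf // circle_neq0. Qed.

(** It carries the reals injectively into the circle, so the images of the naturals provide as many
    points of the circle as a polynomial has coefficients. *)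
Definition cayley (t : C) : C := (1 + 'i * t) / (1 - 'i * t).

Lemma cayley_den_neq0 t : t \is Num.real -> 1 - 'i * t != 0.
Proof.
move=> tR; apply/eqP => /(congr1 (fun x : C => 'Re x)) /= /eqP.
by rewrite -mulrN Re_rect ?raddf0 ?rpredN ?rpred1 // oner_eq0.
Qed.

Lemma cayley_norm t : t \is Num.real -> `|cayley t| = 1.
Proof.
move=> tR; have d0 := cayley_den_neq0 tR; rewrite /cayley.
have -> : 1 + 'i * t = (1 - 'i * t)^*.
  by rewrite rmorphB rmorph1 rmorphM /= conjCi (CrealP tR) mulNr opprK.
by rewrite normf_div norm_conjC divff // normr_eq0.
Qed.

Lemma cayley_inj t (s : C) : t \is Num.real -> s \is Num.real ->
  cayley t = cayley s -> t = s.
Proof.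
move=> tR sR /eqP; rewrite /cayley eqr_div ?cayley_den_neq0 //.
rewrite -subr_eq0.
have -> : (1 + 'i * t) * (1 - 'i * s) - (1 + 'i * s) * (1 - 'i * t) =
  'i * 2 * (t - s) by ring.
by rewrite !mulf_eq0 (negPf (neq0Ci C)) pnatr_eq0 /= subr_eq0 => /eqP.
Qed.

Lemma eq0_on_circle q : (forall z, `|z| = 1 -> q.[z] = 0) -> q = 0.
Proof.
move=> h; apply/eqP/negP => /negP q0.
pose s := [seq cayley k%:R | k <- iota 0 (size q)].
have us : uniq s.
  rewrite map_inj_in_uniq ?iota_uniq // => i j _ _ /cayley_inj E.
  by apply/eqP; rewrite -(eqr_nat C) E ?realn.
have : (size s < size q)%N.
  apply: max_poly_roots => //; apply/allP => x /mapP[k _ ->].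
  by apply/rootP/h/cayley_norm/realn.
by rewrite size_map size_iota ltnn.
Qed.

Lemma eq_on_circle_except e q h : e != 0 ->
  (forall z, `|z| = 1 -> e.[z] != 0 -> q.[z] = h.[z]) -> q = h.
Proof.
move=> e0 H; apply/eqP; rewrite -subr_eq0; apply/eqP.
have : e * (q - h) = 0.
  apply: eq0_on_circle => z hz; rewrite hornerM hornerD hornerN.
  by have [->|ez] := eqVneq e.[z] 0; rewrite ?mul0r // H // subrr mulr0.
by move/eqP; rewrite mulf_eq0 (negPf e0) => /eqP.
Qed.

Lemma eq_on_circle q h : (forall z, `|z| = 1 -> q.[z] = h.[z]) -> q = h.
Proof. by move=> H; apply: (@eq_on_circle_except 1) => [|z hz _]; rewrite ?oner_eq0 ?H. Qed.

Lemma circle_nonroot q : q != 0 -> exists2 z, `|z| = 1 & q.[z] != 0.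
Proof.
move=> q0; pose s := [seq cayley k%:R | k <- iota 0 (size q)].
have us : uniq s.
  rewrite map_inj_in_uniq ?iota_uniq // => i j _ _ /cayley_inj E.
  by apply/eqP; rewrite -(eqr_nat C) E ?realn.
have /allPn[x /mapP[k _ ->] nr] : ~~ all (root q) s.
  apply/negP => h; have := max_poly_roots q0 h us.
  by rewrite size_map size_iota ltnn.
by exists (cayley k%:R); rewrite ?cayley_norm ?realn.
Qed.

(* Reversal at formal degree [n]: the values on the circle are
   [z ^+ n * (q.[z])^*], see [revp_circle]. *)
Definition revp n q := \poly_(i < n.+1) (q`_(n - i))^*.

Lemma size_revp n q : (size (revp n q) <= n.+1)%N.
Proof. exact: size_poly. Qed.

Lemma coef_revp n q i : (revp n q)`_i = if (i <= n)%N then (q`_(n - i))^* else 0.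
Proof. by rewrite coef_poly ltnS. Qed.

Lemma revp_horner n q z : (size q <= n.+1)%N -> z != 0 ->
  (revp n q).[z] = z ^+ n * (q.[(z^*)^-1])^*.
Proof.
move=> sq z0; rewrite (horner_coef_wide _ (size_revp n q)).
rewrite (horner_coef_wide _ sq) rmorph_sum mulr_sumr.
rewrite (reindex_inj rev_ord_inj) /=; apply: eq_bigr => i _.
have li : (i <= n)%N by rewrite -ltnS.
rewrite coef_revp subSS leq_subr subKn //.
have -> : (q`_i * z^*^-1 ^+ i)^* = (q`_i)^* * z^-1 ^+ i.
  by rewrite !(rmorphM, rmorphXn, fmorphV) /= conjCK.
have -> : z ^+ n = z ^+ (n - i) * z ^+ i by rewrite -exprD subnK.
rewrite mulrCA.
by congr (_ * _); rewrite exprVn -mulrA divff ?mulr1 // expf_neq0.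
Qed.

Lemma revp_circle n q z : (size q <= n.+1)%N -> `|z| = 1 ->
  (revp n q).[z] = z ^+ n * (q.[z])^*.
Proof.
by move=> sq hz; rewrite revp_horner ?circle_neq0 // (conj_circle hz) invrK.
Qed.

Lemma revpK n q : (size q <= n.+1)%N -> revp n (revp n q) = q.
Proof.
move=> sq; apply/polyP => i; rewrite !coef_revp.
case: leqP => [li|lt]; last by rewrite nth_default // (leq_trans sq).
by rewrite leq_subr subKn // conjCK.
Qed.

Lemma revp_eq0 n q : (size q <= n.+1)%N -> (revp n q == 0) = (q == 0).
Proof.
move=> sq; apply/eqP/eqP => [h|->]; last first.
  by apply/polyP => i; rewrite coef_revp !coef0 rmorph0 if_same.
by rewrite -(revpK sq) h; apply/polyP => i; rewrite coef_revp !coef0 rmorph0 if_same.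
Qed.

(** One constant controls both the variation and the size: the product rule in the induction needs
    the two together. *)
Lemma lipschitz_ball q (b : C) : 0 <= b -> exists2 k : C, 0 <= k &
  forall x y : C, `|x| <= b -> `|y| <= b ->
    `|q.[x] - q.[y]| <= k * `|x - y| /\ `|q.[x]| <= k.
Proof.
move=> b0; elim/poly_ind: q => [|q c [k k0 IH]].
  by exists 0 => // x y _ _; rewrite !horner0 subrr normr0 mul0r.
have c0 : 0 <= `|c| by [].
exists (k * b + k + `|c|) => [|x y hx hy]; first by rewrite !addr_ge0 // mulr_ge0.
have [IH1 IHx] := IH x y hx hy; have [_ IHy] := IH y x hy hx.
rewrite !hornerE; split.
  have -> : q.[x] * x + c - (q.[y] * y + c) =
      (q.[x] - q.[y]) * x + q.[y] * (x - y) by ring.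
  apply: le_trans (ler_normD _ _) _; rewrite !normrM !mulrDl.
  rewrite -[leLHS]addr0 lerD ?mulr_ge0 // lerD //.
    by rewrite mulrAC ler_pM.
  by rewrite ler_wpM2r.
apply: le_trans (ler_normD _ _) _; rewrite normrM lerD //.
by rewrite -[leLHS]addr0 lerD // ler_pM.
Qed.

Lemma small_multiplier (k c : C) : 0 <= k -> 0 < c -> exists d : C, [/\ 0 < d, d < 1 & k * d < c].
Proof.
move=> k0 c0; have s0 : 0 < k + c + 1 by rewrite ltr_wpDl ?ltr01 // addr_ge0 // ltW.
exists (c / (k + c + 1)); split; first by rewrite divr_gt0.
  by rewrite ltr_pdivrMr // mul1r -subr_gt0 (_ : _ - _ = k + 1) ?ltr_wpDl ?ltr01 //; ring.
rewrite mulrA ltr_pdivrMr // mulrC ltr_pM2l // -subr_gt0.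
by rewrite (_ : _ - _ = c + 1) ?ltr_wpDl ?ltr01 ?(ltW c0) //; ring.
Qed.

Lemma poly_prod_XsubC q : q != 0 ->
  exists2 s : seq C, q = lead_coef q *: \prod_(a <- s) ('X - a%:P) &
    size q = (size s).+1.
Proof.
move=> q0; have [s e] := closed_field_poly_normal q; exists s => //.
by rewrite {1}e size_scale ?lead_coef_eq0 // size_prod_XsubC.
Qed.

Lemma size_XsubC_mul a q : q != 0 -> size (('X - a%:P) * q) = (size q).+1.
Proof. by move=> q0; rewrite size_mul ?polyXsubC_eq0 // size_XsubC. Qed.

Lemma split_disk_roots q : q != 0 -> exists (s : seq C) r,
  [/\ q = \prod_(a <- s) ('X - a%:P) * r,
      forall a, a \in s -> `|a| < 1 &
      forall z, `|z| < 1 -> r.[z] != 0].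
Proof.
move=> q0; have [s e _] := poly_prod_XsubC q0.
exists [seq a <- s | `|a| < 1].
exists (lead_coef q *: \prod_(a <- [seq a <- s | ~~ (`|a| < 1)]) ('X - a%:P)).
split.
- by rewrite -scalerAr !big_filter {1}e (bigID (fun a => `|a| < 1)).
- by move=> a; rewrite mem_filter => /andP[].
- move=> z hz; rewrite hornerZ mulf_neq0 ?lead_coef_eq0 //.
  apply/negP => /eqP /rootP; rewrite root_prod_XsubC mem_filter hz //.
Qed.

End DiskPolynomials.

(** * Unitary colligations *)

Notation "A .@[ z ]" := (map_mx (horner_eval z) A)
  (at level 2, format "A .@[ z ]") : ring_scope.

Section Colligations.
Variable K : numClosedFieldType.
Implicit Types (z a : K).

Lemma adjmxM m n p (A : 'M[K]_(m, n)) (B : 'M[K]_(n, p)) :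
  (A *m B)^t* = B^t* *m A^t*.
Proof. by rewrite trmx_mul map_mxM. Qed.

Lemma adjmxD m n (A B : 'M[K]_(m, n)) : (A + B)^t* = A^t* + B^t*.
Proof. by rewrite linearD map_mxD. Qed.

Lemma adjmxZ m n a (A : 'M[K]_(m, n)) : (a *: A)^t* = a^* *: A^t*.
Proof. by rewrite linearZ map_mxZ. Qed.

Lemma adjmxB m n (A B : 'M[K]_(m, n)) : (A - B)^t* = A^t* - B^t*.
Proof. by rewrite linearB map_mxB. Qed.

Lemma adjmx_scalar n a : (a%:M : 'M[K]_n)^t* = a^*%:M.
Proof. by rewrite tr_scalar_mx map_scalar_mx. Qed.

Lemma adjmx0 m n : (0 : 'M[K]_(m, n))^t* = 0.
Proof. by rewrite trmx0 map_mx0. Qed.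

Lemma adjmx1 n : (1%:M : 'M[K]_n)^t* = 1%:M.
Proof. by rewrite adjmx_scalar rmorph1. Qed.

Lemma block_unitaryP m n (A : 'M[K]_m) (B : 'M_(m, n)) (C : 'M_(n, m)) (D : 'M_n) :
  block_mx A B C D \is unitarymx <->
  [/\ A *m A^t* + B *m B^t* = 1%:M, A *m C^t* + B *m D^t* = 0 &
      C *m C^t* + D *m D^t* = 1%:M].
Proof.
split.
  move/unitarymxP; rewrite tr_block_mx map_block_mx mulmx_block (scalar_mx_block m n 1).
  by move/eq_block_mx => [].
case=> h1 h2 h3; apply/unitarymxP.
rewrite tr_block_mx map_block_mx mulmx_block h1 h2 h3 (scalar_mx_block m n 1).
have -> : C *m A^t* + D *m B^t* = (A *m C^t* + B *m D^t*)^t*.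
  by rewrite adjmxD !adjmxM !trmxCK.
by rewrite h2 adjmx0.
Qed.

(** [transfer] over an arbitrary closed field; for [R[i]] the two agree by conversion. *)
Definition transfer_fun m n (A : 'M[K]_m) (B : 'M[K]_(m, n))
    (C : 'M[K]_(n, m)) (D : 'M[K]_n) z : 'M[K]_m :=
  A + z *: (B *m invmx (1%:M - z *: D) *m C).

Lemma transfer_funE m n (A : 'M[K]_m) (B : 'M[K]_(m, n))
    (C : 'M[K]_(n, m)) (D : 'M[K]_n) z (H : 'M[K]_(n, m)) :
  1%:M - z *: D \in unitmx -> (1%:M - z *: D) *m H = C ->
  transfer_fun A B C D z = A + z *: (B *m H).
Proof. by move=> u <-; rewrite /transfer_fun -(mulmxA B) mulKmx. Qed.

(** Energy balance: with [H = (1 - z D)^-1 C] the colligation maps the column [(1, z H)] to [(F, H)]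
    isometrically, and for [|z| = 1] the two state terms cancel. *)
Lemma transfer_fun_unitary m n (A : 'M[K]_m) (B : 'M[K]_(m, n))
    (C : 'M[K]_(n, m)) (D : 'M[K]_n) z :
  block_mx A B C D \is unitarymx -> 1%:M - z *: D \in unitmx -> `|z| = 1 ->
  transfer_fun A B C D z \is unitarymx.
Proof.
move=> hU hu hz; pose H := invmx (1%:M - z *: D) *m C.
have eH : (1%:M - z *: D) *m H = C by rewrite mulKVmx.
set F := transfer_fun _ _ _ _ _; have eF : F = A + z *: (B *m H).
  exact: transfer_funE.
have eC : H = C + D *m (z *: H).
  by rewrite -{1}eH mulmxBl mul1mx -scalemxAl -scalemxAr subrK.
have eU : block_mx A B C D *m col_mx 1%:M (z *: H) = col_mx F H.
  by rewrite mul_block_col !mulmx1 -eC -scalemxAr -eF.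
have : (col_mx F H)^t* *m col_mx F H =
       (col_mx 1%:M (z *: H))^t* *m col_mx 1%:M (z *: H).
  rewrite -eU adjmxM mulmxA -(mulmxA _ _ (block_mx _ _ _ _)).
  have /unitarymxP := hU; move/mulmx1C => ->; by rewrite mulmx1.
rewrite !tr_col_mx !map_row_mx !mul_row_col adjmx1 mulmx1 adjmxZ -scalemxAl -scalemxAr scalerA.
rewrite conjK_circle // scale1r => /addIr /mulmx1C h; exact/unitarymxP.
Qed.

(** Series connection: the matrix is the product of the two unitaries, each extended by the identity
    on the state space of the other. Orthonormality of the rows is checked block by block. *)
Lemma cascade_unitary m k l (A1 : 'M[K]_m) (B1 : 'M_(m, k)) (C1 : 'M_(k, m))
    (D1 : 'M_k) (A2 : 'M[K]_m) (B2 : 'M_(m, l)) (C2 : 'M_(l, m)) (D2 : 'M_l) :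
  block_mx A1 B1 C1 D1 \is unitarymx -> block_mx A2 B2 C2 D2 \is unitarymx ->
  block_mx (A1 *m A2) (row_mx B1 (A1 *m B2)) (col_mx (C1 *m A2) C2)
    (block_mx D1 (C1 *m B2) 0 D2) \is unitarymx.
Proof.
move=> /block_unitaryP[a1 b1 c1] /block_unitaryP[a2 b2 c2]; apply/block_unitaryP.
have sandwich p q (X : 'M_(p, m)) (Y : 'M_(q, m)) :
    X *m A2 *m (Y *m A2)^t* + X *m B2 *m (Y *m B2)^t* = X *m Y^t*.
  by rewrite !adjmxM -!mulmxA -mulmxDr 2!mulmxA -mulmxDl a2 mul1mx.
have cross p (X : 'M_(p, m)) : X *m A2 *m C2^t* + X *m B2 *m D2^t* = 0.
  by rewrite -!mulmxA -mulmxDr b2 mulmx0.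
rewrite !(tr_row_mx, tr_col_mx, tr_block_mx, map_col_mx, map_row_mx, map_block_mx).
rewrite mul_row_col mul_mx_row mul_row_block mul_col_row mulmx_block add_row_mx.
rewrite add_block_mx trmx0 map_mx0 !mulmx0 !mul0mx !add0r; split.
- by rewrite addrCA sandwich addrC.
- by rewrite addrCA sandwich addrC b1 cross row_mx0.
- rewrite addrCA sandwich addrC c1 cross c2 (scalar_mx_block k l 1); congr block_mx.
  have -> : C2 *m (C1 *m A2)^t* + D2 *m (C1 *m B2)^t* =
     (C1 *m A2 *m C2^t* + C1 *m B2 *m D2^t*)^t*.
    by rewrite adjmxD !adjmxM !trmxCK.
  by rewrite cross adjmx0.
Qed.

Lemma cascade_transfer m k l (A1 : 'M[K]_m) (B1 : 'M_(m, k)) (C1 : 'M_(k, m))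
    (D1 : 'M_k) (A2 : 'M[K]_m) (B2 : 'M_(m, l)) (C2 : 'M_(l, m)) (D2 : 'M_l) z :
  1%:M - z *: D1 \in unitmx -> 1%:M - z *: D2 \in unitmx ->
  transfer_fun (A1 *m A2) (row_mx B1 (A1 *m B2)) (col_mx (C1 *m A2) C2)
    (block_mx D1 (C1 *m B2) 0 D2) z =
  transfer_fun A1 B1 C1 D1 z *m transfer_fun A2 B2 C2 D2 z.
Proof.
move=> u1 u2; pose H2 := invmx (1%:M - z *: D2) *m C2.
have eH2 : (1%:M - z *: D2) *m H2 = C2 by rewrite mulKVmx.
rewrite (transfer_funE _ _ u2 eH2); set F2 := A2 + _.
pose H1 := invmx (1%:M - z *: D1) *m C1.
have eH1 : (1%:M - z *: D1) *m H1 = C1 by rewrite mulKVmx.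
rewrite (transfer_funE _ _ u1 eH1).
have eD : 1%:M - z *: block_mx D1 (C1 *m B2) 0 D2 =
    block_mx (1%:M - z *: D1) (- (z *: (C1 *m B2))) 0 (1%:M - z *: D2).
  rewrite scale_block_mx (scalar_mx_block k l 1) opp_block_mx add_block_mx.
  by rewrite add0r scaler0 oppr0 addr0.
rewrite (@transfer_funE _ _ _ _ _ _ _ (col_mx (H1 *m F2) H2)).
- clearbody H1 H2; rewrite mul_row_col scalerDr mulmxDl.
  have -> : A1 *m F2 = A1 *m A2 + z *: (A1 *m B2 *m H2).
    by rewrite mulmxDr -scalemxAr mulmxA.
  by rewrite -scalemxAl -(mulmxA B1) -addrA [X in _ + X]addrC.
- by rewrite eD unitmxE det_ublock unitrM -!unitmxE u1.
rewrite eD mul_block_col mul0mx add0r eH2 mulmxA eH1 /F2 mulmxDr mulNmx.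
by rewrite -scalemxAr -scalemxAl mulmxA addrK.
Qed.

Lemma det_1_rank1 (R : comPzRingType) m (u : 'cV[R]_m) (v : 'rV[R]_m) :
  \det (1%:M + u *m v) = 1 + (v *m u) 0 0.
Proof.
have e1 : block_mx (1%:M : 'M_m) (- u) v (1%:M : 'M_1) =
    block_mx 1%:M 0 v 1%:M *m block_mx 1%:M (- u) 0 (1%:M + v *m u).
  by rewrite mulmx_block !mulmx0 !mulmx1 !mul0mx !mul1mx !addr0 mulmxN addrC addrK.
have e2 : block_mx (1%:M : 'M_m) (- u) v (1%:M : 'M_1) =
    block_mx (1%:M + u *m v) (- u) 0 1%:M *m block_mx 1%:M 0 v 1%:M.
  by rewrite mulmx_block !mulmx0 !mulmx1 !mul1mx !add0r mulNmx addrK.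
have := congr1 determinant (etrans (esym e1) e2).
rewrite !det_mulmx !det_lblock !det_ublock !det1 !mulr1 !mul1r => <-.
by rewrite det_mx11 !mxE eqxx.
Qed.

(** For a unit row [v] this is the scalar Blaschke factor of [a] on the line of [v] and the identity
    on the orthogonal complement. *)
Definition blaschke_factor m a (v : 'rV[K]_m) z : 'M[K]_m :=
  1%:M + ((z - a) / (1 - a^* * z) - 1) *: (v^t* *m v).

Lemma one_sub_conj_neq0 a z : `|a| < 1 -> `|z| <= 1 -> 1 - a^* * z != 0.
Proof.
move=> ha hz; rewrite subr_eq0; apply/eqP => /(congr1 (fun x => `|x|)).
rewrite normr1 normrM norm_conjC => e.
have h : `|a| * `|z| <= `|a| by rewrite ler_piMr.
by have := le_lt_trans h ha; rewrite -e ltxx.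
Qed.

(** On the line of [v] the colligation is the 2 x 2 unitary with rows [-a, s] and [s, a^*], which
    realizes the scalar Blaschke factor; on the complement it is the identity without state. *)
Lemma blaschke_realization m a (v : 'rV[K]_m) (s := sqrtC (1 - a * a^*)) :
  `|a| < 1 -> v *m v^t* = 1%:M ->
  block_mx (1%:M - (1 + a) *: (v^t* *m v)) (s *: v^t*) (s *: v) (a^*%:M : 'M_1)
    \is unitarymx /\
  (forall z, `|z| <= 1 ->
    1%:M - z *: (a^*%:M : 'M_1) \in unitmx /\
    transfer_fun (1%:M - (1 + a) *: (v^t* *m v)) (s *: v^t*) (s *: v)
      (a^*%:M : 'M_1) z = blaschke_factor a v z).
Proof.
move=> ha hv.
have s2 : s * s = 1 - a * a^* by rewrite -expr2 sqrtCK.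
have sr : s^* = s.
  apply/CrealP/ger0_real; rewrite sqrtC_ge0 subr_ge0 -normCK.
  by rewrite expr_le1 // ltW.
have PP : (v^t* *m v) *m (v^t* *m v) = v^t* *m v.
  by rewrite mulmxA -(mulmxA _ v) hv mulmx1.
have Ps : (v^t* *m v)^t* = v^t* *m v by rewrite adjmxM trmxCK.
split.
  apply/block_unitaryP; rewrite !adjmxZ !trmxCK sr adjmx_scalar conjCK; split.
  - rewrite adjmxB adjmx1 adjmxZ Ps -scalemxAl -scalemxAr scalerA s2.
    rewrite mulmxBl mul1mx mulmxBr mulmx1 -scalemxAl -!scalemxAr PP scalerA rmorphD rmorph1.
    rewrite -[RHS]addr0 -!addrA; congr (_ + _).
    rewrite -scalerBl -!scaleNr -!scalerDl -[RHS](scale0r (v^t* *m v)) /=.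
    by congr (_ *: _); ring.
  - have Pv : v^t* *m v *m v^t* = v^t* by rewrite -mulmxA hv mulmx1.
    rewrite mul_mx_scalar -scalemxAr mulmxBl mul1mx -scalemxAl Pv.
    rewrite scalerA scalerBr scalerA -!scaleNr -!scalerDl.
    by rewrite -[RHS](scale0r (v^t*)); congr (_ *: _); ring.
  - rewrite -scalemxAl -scalemxAr hv scalerA s2 -scalar_mxM.
    have -> : (a^* * a)%:M = (a * a^*) *: (1%:M : 'M[K]_1) by rewrite scalemx1 mulrC.
    by rewrite -scalerDl subrK scale1r.
move=> z hz; have h0 := one_sub_conj_neq0 ha hz.
have eD : 1%:M - z *: (a^*%:M : 'M_1) = (1 - a^* * z)%:M.
  by rewrite scale_scalar_mx raddfB /= mulrC.
have uD : 1%:M - z *: (a^*%:M : 'M_1) \in unitmx.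
  by rewrite eD unitmxE det_scalar1 unitfE.
split=> //; rewrite (@transfer_funE _ _ _ _ _ _ _ ((1 - a^* * z)^-1 *: (s *: v))) //.
  rewrite /blaschke_factor -!addrA; congr (_ + _).
  rewrite -!scalemxAl -!scalemxAr !scalerA -scaleNr -scalerDl; congr (_ *: _).
  by field: s2.
by rewrite eD mul_scalar_mx scalerA divff // scale1r.
Qed.

End Colligations.

(** * Removing the zeros of a determinant in the disk by Blaschke-Potapov factors *)

Section Potapov.
Variable K : numClosedFieldType.
Implicit Types (z a : K).

Lemma mxatM m n p (A : 'M[{poly K}]_(m, n)) (B : 'M_(n, p)) z :
  (A *m B).@[z] = A.@[z] *m B.@[z].
Proof. exact: map_mxM. Qed.

Lemma mxat_det m (A : 'M[{poly K}]_m) z : \det A.@[z] = (\det A).[z].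
Proof. by rewrite det_map_mx. Qed.

Lemma mxatZ m n (q : {poly K}) (A : 'M[{poly K}]_(m, n)) z :
  (q *: A).@[z] = q.[z] *: A.@[z].
Proof. exact: map_mxZ. Qed.

Lemma mxat_polyC m n (A : 'M[K]_(m, n)) z : (map_mx polyC A).@[z] = A.
Proof. by apply/matrixP => i j; rewrite !mxE /horner_eval hornerC. Qed.

Lemma mx_div_XsubC m n (N : 'M[{poly K}]_(m, n)) a : N.@[a] = 0 ->
  exists M, N = ('X - a%:P) *: M.
Proof.
move=> h; exists (\matrix_(i, j) (N i j %/ ('X - a%:P))).
apply/matrixP => i j; rewrite !mxE mulrC divpK // dvdp_XsubCl.
by apply/rootP; have := congr1 (fun A : 'M__ => A i j) h; rewrite !mxE.
Qed.

Lemma scalemx_inj m n (q : {poly K}) (A B : 'M[{poly K}]_(m, n)) : q != 0 ->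
  q *: A = q *: B -> A = B.
Proof.
move=> q0 h; apply/matrixP => i j; apply: (mulfI q0).
by have := congr1 (fun A : 'M__ => A i j) h; rewrite !mxE.
Qed.

Lemma blaschke_factor_det m a (v : 'rV[K]_m) z : v *m v^t* = 1%:M ->
  \det (blaschke_factor a v z) = (z - a) / (1 - a^* * z).
Proof.
move=> hv; rewrite /blaschke_factor scalemxAl det_1_rank1 -scalemxAr hv.
by rewrite !mxE eqxx mulr1 addrC subrK.
Qed.

Lemma unit_left_null m (N : 'M[{poly K}]_m) a : (\det N).[a] = 0 ->
  exists2 v : 'rV[K]_m, v *m v^t* = 1%:M & v *m N.@[a] = 0.
Proof.
rewrite -mxat_det => /eqP/det0P[v v0 hv].
pose c := (v *m v^t*) 0 0.
have ec : c = \sum_i `|v 0 i| ^+ 2.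
  by rewrite /c !mxE; apply: eq_bigr => i _; rewrite !mxE normCK.
have c_gt0 : 0 < c.
  rewrite lt_def ec sumr_ge0 ?andbT; last by move=> i _; rewrite exprn_ge0.
  apply: contra_neq v0 => /eqP.
  rewrite psumr_eq0; last by move=> i _; rewrite exprn_ge0.
  move=> /allP h; apply/rowP => i; rewrite mxE.
  by have := h i (mem_index_enum _); rewrite expf_eq0 normr_eq0 /= => /eqP.
have sc : 0 <= (sqrtC c)^-1 by rewrite invr_ge0 sqrtC_ge0 ltW.
exists ((sqrtC c)^-1 *: v); last by rewrite -scalemxAl hv scaler0.
rewrite adjmxZ -scalemxAl -scalemxAr scalerA (CrealP (ger0_real sc)).
rewrite (mx11_scalar (v *m _)) -/c scale_scalar_mx -invfM -expr2 sqrtCK.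
by rewrite mulVf // gt_eqF.
Qed.

Lemma blaschke_step m (N : 'M[{poly K}]_m) a : `|a| < 1 -> (\det N).[a] = 0 ->
  exists (v : 'rV[K]_m) N', [/\ v *m v^t* = 1%:M,
    ('X - a%:P) * \det N' = (1 - a^* *: 'X) * \det N &
    forall z, `|z| <= 1 -> N.@[z] = blaschke_factor a v z *m N'.@[z]].
Proof.
move=> ha hd; have [v hv hN] := unit_left_null hd.
pose P := v^t* *m v; pose PX := map_mx polyC P.
have PP : P *m P = P by rewrite /P mulmxA -(mulmxA _ v) hv mulmx1.
have [M eM] : exists M, PX *m N = ('X - a%:P) *: M.
  by apply: mx_div_XsubC; rewrite mxatM mxat_polyC /P -mulmxA hN mulmx0.
have PM : PX *m M = M.
  apply: (@scalemx_inj _ _ ('X - a%:P)); first by rewrite polyXsubC_eq0.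
  by rewrite scalemxAr -eM mulmxA -map_mxM PP.
(* The inverse Blaschke factor applied to [N]: on the range of [P] the factor [X - a] of [P N],
   present because [v] annihilates [N] at [a], is exchanged for [1 - a^* X]. *)
pose N' := N - ('X - a%:P) *: M + (1 - a^* *: 'X) *: M.
have eN z : `|z| <= 1 -> N.@[z] = blaschke_factor a v z *m N'.@[z].
  move=> hz; have h0 := one_sub_conj_neq0 ha hz.
  have PMz : P *m M.@[z] = M.@[z] by rewrite -{2}PM mxatM mxat_polyC.
  have PNz : P *m N.@[z] = (z - a) *: M.@[z].
    by have := congr1 (fun A => A.@[z]) eM; rewrite mxatM mxat_polyC mxatZ !hornerE.
  have -> : N'.@[z] = N.@[z] - (z - a) *: M.@[z] + (1 - a^* * z) *: M.@[z].
    by rewrite /N' !(map_mxD, map_mxN) /= !mxatZ !hornerE.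
  rewrite /blaschke_factor mulmxDl mul1mx -scalemxAl !mulmxDr mulmxN -!scalemxAr -/P.
  rewrite PMz PNz subrr add0r scalerA.
  rewrite -!addrA -[LHS]addr0; congr (_ + _).
  rewrite -scaleNr -!scalerDl -[LHS](scale0r M.@[z]); congr (_ *: _).
  by field.
exists v, N'; split=> //.
apply: eq_on_circle => z hz; rewrite !hornerM -!mxat_det eN ?hz //.
have h0 : 1 - a^* * z != 0 by rewrite one_sub_conj_neq0 ?hz.
rewrite det_mulmx blaschke_factor_det //; set d := \det N'.@[z].
by rewrite !hornerE /=; field.
Qed.

Lemma colligation_den_unit n (D : 'M[K]_n) (s : seq K) z :
  (forall a, a \in s -> `|a| < 1) ->
  \det (1%:M - z *: D) = \prod_(a <- s) (1 - a^* * z) -> `|z| <= 1 ->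
  1%:M - z *: D \in unitmx.
Proof.
move=> hs hd hz; rewrite unitmxE hd unitfE prodf_seq_neq0.
by apply/allP => a /hs ha; rewrite one_sub_conj_neq0.
Qed.

Lemma det_cascade k l (D1 : 'M[K]_k) (E : 'M_(k, l)) (D2 : 'M_l) z :
  \det (1%:M - z *: block_mx D1 E 0 D2) =
  \det (1%:M - z *: D1) * \det (1%:M - z *: D2).
Proof.
rewrite scale_block_mx (scalar_mx_block k l 1) opp_block_mx add_block_mx.
by rewrite scaler0 oppr0 addr0 det_ublock.
Qed.

(* Left null vectors of [N] at its zeros in the disk are removed one at a time
   by Blaschke--Potapov factors, each of which adds one state. *)
Lemma potapov_factorization m (s : seq K) (N : 'M[{poly K}]_m) r :
  (forall a, a \in s -> `|a| < 1) -> (forall z, `|z| < 1 -> r.[z] != 0) ->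
  \det N = \prod_(a <- s) ('X - a%:P) * r ->
  exists (A : 'M[K]_m) (B : 'M_(m, size s)) (C : 'M_(size s, m))
    (D : 'M_(size s)) (N' : 'M[{poly K}]_m),
  [/\ block_mx A B C D \is unitarymx,
      forall z, \det (1%:M - z *: D) = \prod_(a <- s) (1 - a^* * z),
      forall z, `|z| < 1 -> \det N'.@[z] != 0 &
      forall z, `|z| <= 1 -> N.@[z] = transfer_fun A B C D z *m N'.@[z]].
Proof.
elim: s N r => [|a s IH] N r hs hr eN.
  exists 1%:M, 0, 0, 1%:M, N; split.
  - by rewrite -(scalar_mx_block m 0 1); apply/unitarymxP; rewrite adjmx1 mulmx1.
  - by move=> z; rewrite big_nil det_mx00.
  - by move=> z hz; rewrite mxat_det eN big_nil mul1r hr.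
  - by move=> z _; rewrite /transfer_fun mul0mx mul0mx scaler0 addr0 mul1mx.
have ha : `|a| < 1 by rewrite hs ?mem_head.
have hs' b : b \in s -> `|b| < 1 by move=> hb; rewrite hs // inE hb orbT.
have da : (\det N).[a] = 0 by rewrite eN big_cons !hornerM !hornerE subrr !mul0r.
have [v [N1 [hv e1 eN1]]] := blaschke_step ha da.
have eD1 : \det N1 = \prod_(b <- s) ('X - b%:P) * ((1 - a^* *: 'X) * r).
  apply: (@mulfI _ ('X - a%:P)); first by rewrite polyXsubC_eq0.
  by rewrite e1 eN big_cons; ring.
have hr1 z : `|z| < 1 -> ((1 - a^* *: 'X) * r).[z] != 0.
  move=> hz; rewrite hornerM mulf_neq0 ?hr // !hornerE.
  by rewrite one_sub_conj_neq0 // ltW.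
have [A [B [C [D [N' [hU hD hN' eN']]]]]] := IH _ _ hs' hr1 eD1.
have [U1 T1] := blaschke_realization ha hv.
have := cascade_unitary U1 hU.
set A1 := _ *m A; set B1 := row_mx _ _; set C1 := col_mx _ _.
set D1 := block_mx _ _ _ D => U2.
exists A1, B1, C1, D1, N'; split=> //.
  move=> z; rewrite /D1 [LHS](@det_cascade 1 (size s)).
  rewrite hD big_cons; congr (_ * _).
  by rewrite scale_scalar_mx -raddfB /= det_scalar1 mulrC.
move=> z hz; have [u1 t1] := T1 z hz.
rewrite eN1 // eN' // mulmxA -t1 -cascade_transfer //.
exact: colligation_den_unit hs' (hD z) hz.
Qed.

Lemma transfer_mulr_unitary m n (A : 'M[K]_m) (B : 'M_(m, n)) (C : 'M_(n, m))
    (D : 'M_n) (X : 'M[K]_m) :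
  block_mx A B C D \is unitarymx -> X \is unitarymx ->
  block_mx (A *m X) B (C *m X) D \is unitarymx /\
  forall z, transfer_fun (A *m X) B (C *m X) D z = transfer_fun A B C D z *m X.
Proof.
move=> /block_unitaryP[h1 h2 h3] /unitarymxP hX; split.
  by apply/block_unitaryP; rewrite !adjmxM !mulmxA -!(mulmxA _ X) hX !mulmx1.
by move=> z; rewrite /transfer_fun mulmxDl -scalemxAl !mulmxA.
Qed.

Lemma transfer_norm_circle m n (A : 'M[K]_m) (B : 'M_(m, n)) (C : 'M_(n, m))
    (D : 'M_n) z (X Y : 'M[K]_m) :
  block_mx A B C D \is unitarymx -> 1%:M - z *: D \in unitmx -> `|z| = 1 ->
  X = transfer_fun A B C D z *m Y -> X^t* *m X = Y^t* *m Y.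
Proof.
move=> hU hu hz ->; rewrite adjmxM mulmxA -(mulmxA (Y^t*)).
have /unitarymxP/mulmx1C -> := transfer_fun_unitary hU hu hz.
by rewrite mulmx1.
Qed.

End Potapov.

(** * Fejér–Riesz factorization *)

Section ScalarFejerRiesz.
Variable K : numClosedFieldType.
Implicit Types (q g h : {poly K}) (z a c : K).

Lemma circle_near1 (e : K) : 0 < e -> exists c : K, [/\ `|c| = 1, c != 1 & `|c - 1| <= e].
Proof.
move=> e0; pose t := e / 2; have t0 : 0 < t by rewrite divr_gt0.
have tR : t \is Num.real by apply: gtr0_real.
have d0 := cayley_den_neq0 tR.
have E : cayley t - 1 = 'i * e / (1 - 'i * t).
  have -> : e = t + t by rewrite /t; field.
  by rewrite /cayley; field.
exists (cayley t); rewrite cayley_norm // E; split=> //.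
  by rewrite -subr_eq0 E mulf_neq0 ?invr_eq0 // mulf_neq0 ?neq0Ci ?gt_eqF.
rewrite !normrM normCi mul1r normfV (gtr0_norm e0) ler_pdivrMr ?normr_gt0 //.
rewrite ler_peMr ?(ltW e0) //.
rewrite -(@expr_ge1 _ 2) // -mulrN normC2_rect ?rpredN ?rpred1 //.
by rewrite sqrrN expr1n lerDl exprn_ge0 // ltW.
Qed.

Lemma circle_le_lim (x k : K) : 0 <= x -> 0 <= k ->
  (forall c, `|c| = 1 -> c != 1 -> x <= k * `|c - 1|) -> x = 0.
Proof.
move=> x0 k0 hx; apply/eqP; apply: contraT => xn0.
have h1 : 0 < x by rewrite lt_def xn0.
have k1 : 0 < k + 1 by rewrite ltr_wpDl.
have d0 : 0 < x / (k + 1) / 2 by rewrite !divr_gt0.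
have [c [hc c1 hle]] := circle_near1 d0.
have := le_trans (hx c hc c1) (ler_wpM2l k0 hle).
have -> : k * (x / (k + 1) / 2) = x * (k / ((k + 1) * 2)) by field; rewrite gt_eqF.
rewrite ler_pMr // ler_pdivlMr ?mulr_gt0 // mul1r => h.
have : 0 < (k + 1) * 2 - k.
  have -> : (k + 1) * 2 - k = k + 1 + 1 by ring.
  by apply: addr_gt0 => //; exact: ltr01.
by rewrite subr_gt0 => /(le_lt_trans h); rewrite ltxx.
Qed.

(** Compare the values at [a c] and [a c^*], on either side of [a]. Up to nearly equal phases the
    factor [X - a] changes sign between them, so the nonnegative numbers [X] and [Y] nearly cancel.
    Dividing [|X| <= |X + Y|] by [|c - 1|] bounds [|h.[a]|] by a multiple of [|c - 1|], and [c]
    tends to 1. *)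
Lemma circle_zero_even n h a : `|a| = 1 ->
  (forall z, `|z| = 1 -> 0 <= (z^*) ^+ n * (('X - a%:P) * h).[z]) -> h.[a] = 0.
Proof.
move=> ha hpos; apply/eqP; apply: contraT => h0.
have [k1 k10 L1] := lipschitz_ball h ler01.
(* The phases of the two values differ by [c^* ^+ n - c ^+ n * c^*], which is a unimodular multiple
   of [c - c ^+ (n + n)]. *)
have [k2 k20 L2] := lipschitz_ball ('X - 'X^(n + n) : {poly K}) ler01.
pose k := k1 + k1 + k1 + `|h.[a]| * k2.
have bound c : `|c| = 1 -> c != 1 -> `|h.[a]| <= k * `|c - 1|.
  move=> hc c1.
  have hc' : `|c^*| = 1 by rewrite norm_conjC.
  have cc : c^* * c = 1 by rewrite conjK_circle.
  have nac : `|a * c| = 1 by rewrite normrM ha hc mulr1.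
  have nac' : `|a * c^*| = 1 by rewrite normrM ha hc' mulr1.
  pose X := (c - 1) * ((a^*) ^+ n * a * (c^* ^+ n * h.[a * c])).
  pose Y : K := - (c - 1) * ((a^*) ^+ n * a * (c ^+ n * c^* * h.[a * c^*])).
  have X0 : 0 <= X.
    have := hpos _ nac; rewrite rmorphM exprMn hornerM !hornerE /=.
    by rewrite [X in 0 <= X](_ : _ = X) // /X; ring.
  have Y0 : 0 <= Y.
    have := hpos _ nac'; rewrite rmorphM exprMn hornerM !hornerE /= conjCK.
    rewrite [X in 0 <= X](_ : _ = Y) // /Y.
    by ring: cc.
  have XY : `|X| <= `|X + Y| by rewrite !ger0_norm ?addr_ge0 // lerDl.
  have an1 : `|(a^*) ^+ n * a| = 1 by rewrite normrM normrX norm_conjC ha expr1n mulr1.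
  have cn1 : `|c^* ^+ n| = 1 by rewrite normrX hc' expr1n.
  have c0 : 0 < `|c - 1| by rewrite normr_gt0 subr_eq0.
  have e1 : `|h.[a * c]| <= `|c^* ^+ n * h.[a * c] - c ^+ n * c^* * h.[a * c^*]|.
    move: XY; have -> : X + Y = (c - 1) * ((a^*) ^+ n * a *
      (c^* ^+ n * h.[a * c] - c ^+ n * c^* * h.[a * c^*])) by rewrite /X /Y; ring.
    have nX u : `|(c - 1) * ((a^*) ^+ n * a * u)| = `|c - 1| * `|u|.
      by rewrite normrM [`|_ * u|]normrM an1 mul1r.
    by rewrite !nX ler_pM2l // normrM cn1 mul1r.
  have hca x : `|x| = 1 -> `|h.[a * x] - h.[a]| <= k1 * `|x - 1|.
    move=> hx; have [||+ _] := L1 (a * x) a; rewrite ?normrM ?ha ?hx ?mulr1 //.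
    suff -> : `|a * x - a| = `|x - 1| by [].
    by rewrite -{2}[a]mulr1 -mulrBr normrM ha mul1r.
  have nc : `|c^* - 1| = `|c - 1| by rewrite -[in RHS]norm_conjC rmorphB rmorph1.
  have e2 : `|c^* ^+ n - c ^+ n * c^*| <= k2 * `|c - 1|.
    have [||+ _] := L2 c 1; rewrite ?hc ?normr1 // !hornerE expr1n subrr subr0.
    have -> : c - c ^+ (n + n) = c ^+ n * c * (c^* ^+ n - c ^+ n * c^*).
      rewrite mulrBr; congr (_ - _).
        by rewrite mulrAC -exprMn [c * _]mulrC cc expr1n mul1r.
      by rewrite mulrACA [c * _]mulrC cc mulr1 exprD.
    by rewrite normrM normrM normrX hc expr1n !mul1r.
  have e3 := hca _ hc; have e4 := hca _ hc'; rewrite nc in e4.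
  have -> : h.[a] = h.[a * c] - (h.[a * c] - h.[a]) by ring.
  apply: le_trans (ler_normB _ _) _.
  have -> : k * `|c - 1| = (k1 * `|c - 1| + (`|h.[a]| * k2 * `|c - 1| + k1 * `|c - 1|))
    + k1 * `|c - 1| by rewrite /k; ring.
  apply: lerD => //; apply: le_trans e1 _.
  have -> : c^* ^+ n * h.[a * c] - c ^+ n * c^* * h.[a * c^*] =
    c^* ^+ n * (h.[a * c] - h.[a]) + (h.[a] * (c^* ^+ n - c ^+ n * c^*) -
    c ^+ n * c^* * (h.[a * c^*] - h.[a])) by ring.
  apply: le_trans (ler_normD _ _) _; rewrite normrM cn1 mul1r lerD //.
  apply: le_trans (ler_normB _ _) _; rewrite lerD //.
    by rewrite normrM -mulrA ler_wpM2l.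
  by rewrite normrM normrM normrX hc hc' expr1n !mul1r.
have k_ge0 : 0 <= k by rewrite !addr_ge0 // mulr_ge0.
by move: h0; rewrite -normr_eq0 (circle_le_lim _ k_ge0 bound) ?eqxx.
Qed.

Lemma circle_ge0_closure n g a : `|a| = 1 ->
  (forall z, `|z| = 1 -> z != a -> 0 <= (z^*) ^+ n * g.[z]) ->
  0 <= (a^*) ^+ n * g.[a].
Proof.
move=> ha hpos; have [k1 k10 L1] := lipschitz_ball g ler01.
have [k2 k20 L2] := lipschitz_ball ('X^n : {poly K}) ler01.
set x := _ * _; suff : `|x| - x = 0 by move/eqP; rewrite subr_eq0 => /eqP <-.
apply/eqP; rewrite -normr_eq0; apply/eqP.
apply: (@circle_le_lim _ (2 * (k1 + `|g.[a]| * k2))) => //.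
  by rewrite mulr_ge0 // addr_ge0 // mulr_ge0.
move=> c hc c1; have nac : `|a * c| = 1 by rewrite normrM ha hc mulr1.
have aca : a * c != a.
  by apply: contra_neq c1 => h; apply: (mulfI (circle_neq0 ha)); rewrite h mulr1.
have nE : `|a * c - a| = `|c - 1|.
  by rewrite -{2}[a]mulr1 -mulrBr normrM ha mul1r.
set y := ((a * c)^*) ^+ n * g.[a * c]; have y0 : 0 <= y by apply: hpos.
have xy : `|x - y| <= (k1 + `|g.[a]| * k2) * `|c - 1|.
  have -> : x - y = g.[a] * (a^* ^+ n - (a * c)^* ^+ n) +
      (a * c)^* ^+ n * (g.[a] - g.[a * c]) by rewrite /x /y; ring.
  apply: le_trans (ler_normD _ _) _; rewrite addrC mulrDl lerD //.
    rewrite normrM normrX norm_conjC nac expr1n mul1r -nE distrC.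
    by have [|| ? _] := L1 (a * c) a; rewrite ?nac ?ha.
  rewrite normrM -mulrA ler_wpM2l // -!rmorphXn -rmorphB norm_conjC -nE distrC.
  by have [|| + _] := L2 (a * c) a; rewrite ?nac ?ha // !hornerXn.
have -> : `|x| - x = (`|x| - `|y|) + (y - x) by rewrite (ger0_norm y0); ring.
apply: le_trans (ler_normD _ _) _; rewrite mulrDl mul1r mulrDl lerD //.
  by apply: le_trans (ler_dist_dist _ _) _.
by rewrite distrC.
Qed.

(** Reality on the circle written between polynomials; off the origin it pairs every root [a] with
    its mirror image [1 / a^*]. *)
Lemma circle_real_sym n L g : (size g <= L.+1)%N ->
  (forall z, `|z| = 1 -> 0 <= (z^*) ^+ n * g.[z]) ->
  'X^L * g = 'X^(n + n) * revp L g.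
Proof.
move=> sg hg; apply: eq_on_circle => z hz; rewrite !hornerM !hornerXn revp_circle //.
have e : (z^*) ^+ n * g.[z] = z ^+ n * (g.[z])^*.
  by rewrite -[LHS](CrealP (ger0_real (hg z hz))) rmorphM rmorphXn /= conjCK.
have zn : z ^+ n * (z^*) ^+ n = 1 by rewrite -exprMn mulrC conjK_circle // expr1n.
rewrite -[g.[z] in LHS]mul1r -zn -[z ^+ n * _ * _]mulrA e exprD; ring.
Qed.

(** Roots are divided out in mirror pairs, a root on the circle being its own mirror image and
    therefore of even order. From each pair the member with [|a| >= 1] goes into [q], which keeps
    [q] zero-free in the disk. *)
Lemma fejer_riesz_scalar n g : g != 0 ->
  (forall z, `|z| = 1 -> 0 <= (z^*) ^+ n * g.[z]) ->
  exists2 q, (forall z, `|z| < 1 -> q.[z] != 0) &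
    forall z, `|z| = 1 -> (z^*) ^+ n * g.[z] = q.[z] * (q.[z])^*.
Proof.
have [N] := ubnP (size g); elim: N n g => // N IH n g /ltnSE sN g0 hg.
have sg0 : (0 < size g)%N by rewrite size_poly_gt0.
have [s1|s1] := eqVneq (size g) 1%N.
  have /size_poly1P[c c0 eg] : size g == 1%N by rewrite s1.
  have := @circle_real_sym n 0 g; rewrite s1 => /(_ isT hg).
  rewrite mul1r => /(congr1 (fun p : {poly K} => size p)); rewrite s1.
  have r0 : revp 0 g != 0 by rewrite revp_eq0 ?s1.
  rewrite mulrC size_mulXn // => /eqP.
  have : size (revp 0 g) = 1%N.
    by apply/eqP; rewrite eqn_leq size_revp size_poly_gt0.
  move=> ->; rewrite addn1 eqSS eq_sym addnn double_eq0 => /eqP n0.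
  have cge : 0 <= c by have := hg 1 (normr1 _); rewrite n0 eg hornerC expr0 mul1r.
  exists (sqrtC c)%:P => z hz; first by rewrite hornerC sqrtC_eq0.
  rewrite eg n0 !hornerC mul1r (CrealP (ger0_real _)) ?sqrtC_ge0 //.
  by rewrite -expr2 sqrtCK.
(* For [n = 0] and [L] the degree of [g], the reflection identity equates a polynomial of degree
   [2 L] with one of degree at most [L]. *)
have n_gt0 : (0 < n)%N.
  rewrite lt0n; apply/eqP => n0; case/negP: s1.
  have := @circle_real_sym n (size g).-1 g; rewrite prednK // => /(_ (leqnn _) hg).
  rewrite n0 mul1r mulrC => /(congr1 (fun p : {poly K} => size p)).
  rewrite size_mulXn // => e; have := size_revp (size g).-1 g; rewrite -e prednK //.
  by case: (size g) sg0 => // -[] // k _ /=; lia.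
case: n n_gt0 hg => // n _ hg.
have [a0 ra0] := closed_rootP _ s1.
have [a0_0|a0_n0] := eqVneq a0 0.
  have [h eh] := factor_theorem _ _ ra0; rewrite a0_0 subr0 in eh.
  have h0 : h != 0 by apply: contraNneq g0 => h0; rewrite eh h0 mul0r.
  have e z : `|z| = 1 -> (z^*) ^+ n.+1 * g.[z] = (z^*) ^+ n * h.[z].
    move=> hz; rewrite eh hornerM hornerX exprSr.
    by rewrite [h.[z] * z]mulrC mulrA -(mulrA (_ ^+ n)) conjK_circle ?mulr1.
  have [||q q1 q2] := IH n h _ h0.
  - by rewrite eh size_mulX // in sN.
  - by move=> z hz; rewrite -e // hg.
  by exists q => // z hz; rewrite e // q2.
have root_sym a : a != 0 -> g.[a] = 0 -> g.[(a^*)^-1] = 0.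
  move=> an0 ga; have sg : (size g <= (size g).-1.+1)%N by rewrite prednK.
  have := congr1 (fun p => p.[(a^*)^-1]) (circle_real_sym sg hg).
  have b0 : (a^*)^-1 != 0 by rewrite invr_eq0 conjC_eq0.
  rewrite !hornerM !hornerXn revp_horner // fmorphV /= conjCK invrK ga rmorph0 !mulr0.
  by move/eqP; rewrite mulf_eq0 expf_eq0 (negPf b0) andbF /= => /eqP.
have [a [an0 ga ha]] : exists a, [/\ a != 0, g.[a] = 0 & 1 <= `|a|].
  have [h1|h1] := real_leP (rpred1 _) (normr_real a0); first by exists a0; split=> //; apply/rootP.
  exists (a0^*)^-1; split; first by rewrite invr_eq0 conjC_eq0.
    by apply: root_sym => //; apply/rootP.
  by rewrite normfV norm_conjC invf_ge1 ?normr_gt0 // ltW.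
pose b := (a^*)^-1.
have [h eh] : exists h, g = ('X - a%:P) * ('X - b%:P) * h.
  have /factor_theorem[h1 e1] : root g a by apply/rootP.
  have h1b : h1.[b] = 0.
    have [ab|ab] := eqVneq b a.
      have a1 : `|a| = 1.
        have := congr1 (fun x => `|x| * `|a|) ab; rewrite normfV norm_conjC mulVf ?normr_eq0 //.
        move/esym => /eqP; rewrite -expr2 sqrp_eq1 // => /eqP //.
      by rewrite ab; apply: (@circle_zero_even n.+1 h1 a a1) => z hz; rewrite [_ * h1]mulrC -e1 hg.
    have := root_sym a an0 ga; rewrite -/b e1 hornerM => /eqP.
    by rewrite mulf_eq0 !hornerE subr_eq0 (negPf ab) orbF => /eqP.
  have /factor_theorem[h e2] : root h1 b by apply/rootP.
  by exists h; rewrite e1 e2; ring.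
have h0 : h != 0 by apply: contraNneq g0 => h0; rewrite eh h0 mulr0.
(* On the circle the conjugate of [z - a] is [a^* z^* (b - z)]: one power of [z^*] is used up, and
   the remaining constant is [- b]. *)
have e z : `|z| = 1 -> (z^*) ^+ n.+1 * g.[z] =
    (z - a) * (z - a)^* * ((z^*) ^+ n * (- b *: h).[z]).
  move=> hz; have zz := conjK_circle hz.
  have ba : b * a^* = 1 by rewrite mulVf // conjC_eq0.
  rewrite eh !hornerE exprSr rmorphB /=.
  have -> : z^* - a^* = a^* * z^* * (b - z).
    rewrite mulrBr mulrAC [a^* * b]mulrC ba mul1r -mulrA zz; by rewrite mulr1.
  transitivity (z^* ^+ n * z^* * ((z - a) * (z - b) * h.[z]) * (b * a^*)).
    by rewrite ba mulr1 !mulrA.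
  by ring.
have [|||q q1 q2] := IH n (- b *: h).
- have := sN; rewrite eh -mulrA size_XsubC_mul ?mulf_neq0 ?polyXsubC_eq0 //.
  rewrite size_XsubC_mul // => hs.
  by rewrite (leq_ltn_trans (size_scale_leq _ _)) // ltnW.
- by rewrite scaler_eq0 negb_or h0 oppr_eq0 invr_eq0 conjC_eq0 an0.
- move=> z hz; have [za|za] := eqVneq z a; last first.
    have := hg z hz; rewrite e // pmulr_rge0 // -normCK exprn_gt0 //.
    by rewrite normr_gt0 subr_eq0.
  have a1 : `|a| = 1 by rewrite -za.
  rewrite za; apply: circle_ge0_closure => // y hy hya.
  have := hg y hy; rewrite e // pmulr_rge0 // -normCK exprn_gt0 //.
  by rewrite normr_gt0 subr_eq0.
exists (('X - a%:P) * q) => z hz.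
  rewrite hornerM mulf_neq0 ?q1 // !hornerE subr_eq0; apply: contraTneq ha => <-.
  by rewrite -real_ltNge ?normr_real ?rpred1.
by rewrite e // q2 // hornerM !hornerE rmorphM /=; ring.
Qed.

End ScalarFejerRiesz.

(** * Matrix Fejer-Riesz factorization *)

Section MatrixFejerRiesz.
Variable K : numClosedFieldType.
Implicit Types (z a : K) (m n : nat).

Lemma adjmx_mul_eq0 m n (A : 'M[K]_(m, n)) : A^t* *m A = 0 -> A = 0.
Proof.
move=> h; apply/matrixP => i j; rewrite mxE.
have := congr1 (fun M : 'M__ => M j j) h; rewrite !mxE => /eqP.
rewrite psumr_eq0 => [|k _]; last by rewrite !mxE mulrC -normCK exprn_ge0.
move=> /allP/(_ i (mem_index_enum _)) /=.
by rewrite !mxE mulrC -normCK expf_eq0 normr_eq0 /= => /eqP.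
Qed.

Definition revmx L m n (N : 'M[{poly K}]_(m, n)) : 'M[{poly K}]_(n, m) :=
  map_mx (revp L) N^T.

Lemma revmx_at L m n (N : 'M[{poly K}]_(m, n)) z :
  (forall i j, (size (N i j) <= L.+1)%N) -> z != 0 ->
  (revmx L N).@[z] = z ^+ L *: (N.@[(z^*)^-1])^t*.
Proof.
by move=> sN z0; apply/matrixP => i j; rewrite !mxE /horner_eval revp_horner.
Qed.

Lemma revmx_circle L m n (N : 'M[{poly K}]_(m, n)) z :
  (forall i j, (size (N i j) <= L.+1)%N) -> `|z| = 1 ->
  (revmx L N).@[z] = z ^+ L *: (N.@[z])^t*.
Proof.
by move=> sN hz; rewrite revmx_at ?circle_neq0 // conj_circle // invrK.
Qed.

Lemma eqmx_on_circle m n (e : {poly K}) (A B : 'M[{poly K}]_(m, n)) : e != 0 ->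
  (forall z, `|z| = 1 -> e.[z] != 0 -> A.@[z] = B.@[z]) -> A = B.
Proof.
move=> e0 h; apply/matrixP => i j; apply: (eq_on_circle_except e0) => z hz ez.
by have := congr1 (fun M : 'M__ => M i j) (h z hz ez); rewrite !mxE.
Qed.

(* A Hermitian identity on the circle, rewritten as an identity between
   polynomials; it therefore holds everywhere once it holds off the zeros
   of some [e]. *)
Lemma circle_identity m n (e d : {poly K}) (N G : 'M[{poly K}]_m) L :
  e != 0 -> (size d <= L.+1)%N -> (forall i j, (size (N i j) <= L.+1)%N) ->
  (forall z, `|z| = 1 -> e.[z] != 0 ->
     (N.@[z])^t* *m N.@[z] = (d.[z] * (d.[z])^* * z^* ^+ n) *: G.@[z]) ->
  'X^n *: (revmx L N *m N) = (revp L d * d) *: G.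
Proof.
move=> e0 sd sN h; apply: (eqmx_on_circle e0) => z hz ez.
rewrite !mxatZ mxatM revmx_circle // -scalemxAl h // !scalerA; congr (_ *: _).
rewrite hornerM hornerXn revp_circle //.
have zn : z ^+ n * (z^*) ^+ n = 1 by rewrite -exprMn mulrC conjK_circle // expr1n.
transitivity ((z ^+ n * z^* ^+ n) * (z ^+ L * (d.[z])^* * d.[z])); first by ring.
by rewrite zn mul1r.
Qed.

Lemma circle_identityV m n (d : {poly K}) (N G : 'M[{poly K}]_m) L z :
  (size d <= L.+1)%N -> (forall i j, (size (N i j) <= L.+1)%N) ->
  'X^n *: (revmx L N *m N) = (revp L d * d) *: G -> `|z| = 1 ->
  (N.@[z])^t* *m N.@[z] = (d.[z] * (d.[z])^* * z^* ^+ n) *: G.@[z].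
Proof.
move=> sd sN /(congr1 (fun A => A.@[z])) + hz.
rewrite !mxatZ mxatM revmx_circle // -scalemxAl !scalerA hornerM hornerXn revp_circle //.
have zk k : z^* ^+ k * z ^+ k = 1 by rewrite -exprMn conjK_circle // expr1n.
move=> /(congr1 (fun A => (z^* ^+ n * z^* ^+ L) *: A)); rewrite !scalerA.
rewrite [X in X *: _ = _](_ : _ = 1); last first.
  transitivity ((z^* ^+ n * z ^+ n) * (z^* ^+ L * z ^+ L)); first by ring.
  by rewrite !zk mulr1.
rewrite scale1r => ->; congr (_ *: _).
transitivity ((z^* ^+ L * z ^+ L) * (d.[z] * (d.[z])^* * z^* ^+ n)); first by ring.
by rewrite zk mul1r.
Qed.

Lemma mx_size_bound m n (N : 'M[{poly K}]_(m, n)) :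
  exists L, forall i j, (size (N i j) <= L)%N.
Proof.
exists (\max_i \max_j size (N i j)) => i j.
by apply: leq_trans (leq_bigmax i); apply: leq_trans (leq_bigmax j).
Qed.

(** Every root [a] of [d] has [|a| >= 1]. If [|a| = 1], the hypothesis at [a] says that [N.@[a]] has
    zero Gram matrix. Otherwise the polynomial identity at the mirror point [b] in the disk, where
    [N] is invertible, shows that the reflected [N] vanishes at [b], hence [N] at [a]. So [X - a]
    divides both [N] and [d]. *)
Lemma outer_quotient m n (N G : 'M[{poly K}]_m) d :
  (forall z, `|z| < 1 -> d.[z] != 0) ->
  (forall z, `|z| < 1 -> \det N.@[z] != 0) ->
  (forall z, `|z| = 1 ->
     (N.@[z])^t* *m N.@[z] = (d.[z] * (d.[z])^* * z^* ^+ n) *: G.@[z]) ->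
  exists2 Q, N = d *: Q & forall i j, (size (Q i j) <= n.+1)%N.
Proof.
have [k] := ubnP (size d); elim: k d N => // k IH d N /ltnSE sk hd hN hG.
have d0 : d != 0.
  by apply: contraTneq (hd 0 _) => [->|]; rewrite ?horner0 ?eqxx // normr0 ltr01.
have [L0 sN0] := mx_size_bound N; pose L := maxn L0 (size d).
have sd : (size d <= L.+1)%N by rewrite leqW // leq_maxr.
have sN i j : (size (N i j) <= L.+1)%N by rewrite leqW // (leq_trans (sN0 i j)) ?leq_maxl.
have I := circle_identity (oner_neq0 _) sd sN (fun z hz _ => hG z hz).
have unitN z : `|z| < 1 -> N.@[z] \in unitmx by move=> hz; rewrite unitmxE unitfE hN.
have [s1|s1] := eqVneq (size d) 1%N.
  have /size_poly1P[c c0 ed] : size d == 1%N by rewrite s1.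
  exists (c^-1%:P *: N); first by rewrite ed scalerA -rmorphM divff // scale1r.
  move=> i j; rewrite mxE mul_polyC size_scale ?invr_eq0 //.
  (* The degree bound is the same argument at infinity, whose mirror point is 0. At formal degree
     [n + l + 1] the reflected constant [d] supplies a power of [X] beyond [X^n], so the reflected
     [N] vanishes at 0, where [N] is invertible; its value there consists of the conjugated top
     coefficients. *)
  suff h : forall l, (forall i j, (size (N i j) <= (n + l).+1)%N) ->
      forall i j, (size (N i j) <= n.+1)%N.
    by apply: (h L) => i' j'; rewrite (leq_trans (sN i' j')) // ltnS leq_addl.
  elim=> [|l IHl] hl; first by rewrite addn0 in hl.
  apply: IHl => i' j'; rewrite addnS in hl.
  have sd' : (size d <= (n + l).+2)%N by rewrite s1.
  have := circle_identity (oner_neq0 _) sd' hl (fun z hz _ => hG z hz).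
  have -> : revp (n + l).+1 d = 'X^n * ('X^l * c^*%:P * 'X).
    apply: eq_on_circle => z hz; rewrite revp_circle // ed.
    by rewrite !hornerM !hornerXn hornerX !hornerC exprS exprD; ring.
  rewrite -!mulrA -scalerA => /scalemx_inj -/(_ (monic_neq0 (monicXn _ _))).
  move=> /(congr1 (fun A => A.@[0])); rewrite mxatM mxatZ.
  rewrite !hornerM hornerX mul0r !mulr0 scale0r.
  have u0 : N.@[0] \in unitmx by rewrite unitN ?normr0 ?ltr01.
  move=> /(congr1 (mulmx ^~ (invmx N.@[0]))); rewrite mul0mx mulmxK // => e0.
  have := congr1 (fun A : 'M__ => A j' i') e0; rewrite !mxE /horner_eval.
  rewrite horner_coef0 coef_revp subn0 => /eqP; rewrite conjC_eq0 => /eqP e1.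
  rewrite leqNgt; apply/negP => lt.
  have es : size (N i' j') = (n + l).+2 by apply/eqP; rewrite eqn_leq hl.
  have := lead_coef_eq0 (N i' j'); rewrite /lead_coef es /= e1 eqxx => /esym/eqP z0.
  by rewrite z0 size_poly0 in es.
have [a ra] := closed_rootP _ s1.
have da : d.[a] = 0 by apply/rootP.
have ha : 1 <= `|a|.
  rewrite real_leNgt ?rpred1 ?normr_real //; apply/negP => /hd.
  by rewrite da eqxx.
have Na : N.@[a] = 0.
  have [a1|a1] := eqVneq `|a| 1.
    by apply: adjmx_mul_eq0; rewrite hG // da !mul0r scale0r.
  have an0 : a != 0 by rewrite -normr_gt0 (lt_le_trans ltr01).
  pose b := (a^*)^-1.
  have b0 : b != 0 by rewrite invr_eq0 conjC_eq0.
  have ab : (b^*)^-1 = a by rewrite /b fmorphV /= conjCK invrK.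
  have hb : `|b| < 1.
    rewrite normfV norm_conjC invf_lt1 ?normr_gt0 //.
    by rewrite lt_def a1.
  have := congr1 (fun A => A.@[b]) I.
  rewrite !mxatZ mxatM revmx_at // hornerM revp_horner // ab da rmorph0 mulr0 mul0r.
  rewrite scale0r -scalemxAl scalerA => /eqP; rewrite scaler_eq0 mulf_eq0.
  rewrite hornerXn !expf_eq0 (negPf b0) !andbF /= => /eqP.
  move=> /(congr1 (mulmx ^~ (invmx N.@[b]))); rewrite mul0mx mulmxK ?unitN // => e0.
  by rewrite -[LHS]trmxCK e0 adjmx0.
have [N1 eN] := mx_div_XsubC Na.
have /factor_theorem[d1 ed] := ra; rewrite mulrC in ed.
have [M1 sN1] := mx_size_bound N1.
pose L1 := maxn M1 (size d1).
have sd1' : (size d1 <= L1.+1)%N by rewrite leqW // leq_maxr.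
have sN1' i j : (size (N1 i j) <= L1.+1)%N by rewrite leqW // (leq_trans (sN1 i j)) ?leq_maxl.
have d10 : d1 != 0 by apply: contraNneq d0 => h; rewrite ed h mulr0.
have [||||Q eQ sQ] := IH d1 N1.
- by rewrite ed size_XsubC_mul // in sk.
- by move=> z /hd; rewrite ed hornerM mulf_eq0 negb_or => /andP[].
- move=> z /hN; rewrite eN mxatZ detZ mulf_eq0 negb_or => /andP[] //.
(* Cancelling the squared modulus of [y - a] is impossible at [y = a]; passing through the
   polynomial identity fills in that point when [a] is on the circle. *)
- move=> z; apply: (circle_identityV sd1' sN1').
  apply: (@circle_identity _ _ ('X - a%:P)) => //; first by rewrite polyXsubC_eq0.
  move=> y hy; rewrite !hornerE => ya.
  have := hG y hy; rewrite eN ed !mxatZ adjmxZ -scalemxAl -scalemxAr scalerA.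
  rewrite hornerM !hornerE rmorphM /= => /(congr1 (fun A => ((y - a) * (y - a)^*)^-1 *: A)).
  rewrite [in X in X -> _]scalerA [_^* * (y - a)]mulrC mulVf; last by rewrite mulf_neq0 // conjC_eq0.
  rewrite scale1r scalerA => ->; congr (_ *: _); field.
  by rewrite -rmorphB conjC_eq0 ya.
by exists Q => //; rewrite eN ed eQ scalerA.
Qed.

Definition psdmx n (M : 'M[K]_n) :=
  M^t* = M /\ forall v : 'cV_n, 0 <= (v^t* *m M *m v) 0 0.

Lemma adjmx_mul_ge0 m n (A : 'M[K]_(m, n)) i : 0 <= (A^t* *m A) i i.
Proof.
by rewrite !mxE sumr_ge0 // => k _; rewrite !mxE mulrC -normCK exprn_ge0.
Qed.

(** The form is tested on the columns [(- t b y, y)]. For [s > 0] the choice [t = s^-1] gives the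
    Schur complement, stated multiplied by [s] so that it stays polynomial later; for [s = 0] the
    form is affine in [t] and can be nonnegative only if [b y = 0]. *)
Lemma psd_block n (s : K) (b : 'rV[K]_n) (c : 'cV_n) (M : 'M_n) :
  psdmx (block_mx (s%:M : 'M_1) b c M) ->
  [/\ 0 <= s, c = b^t*, M^t* = M, s = 0 -> b = 0 & psdmx (s *: M - c *m b)].
Proof.
move=> [hh hp]; move: hh; rewrite tr_block_mx map_block_mx => /eq_block_mx[_ _ ec eM].
have quad (x : 'cV_1) (y : 'cV_n) :
   0 <= (x^t* *m s%:M *m x + x^t* *m b *m y + (y^t* *m c *m x + y^t* *m M *m y)) 0 0.
  have := hp (col_mx x y); rewrite tr_col_mx map_row_mx mul_row_block mul_row_col.
  by rewrite !mulmxDl addrACA.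
have s0 : 0 <= s.
  have := quad 1%:M 0; rewrite trmx0 map_mx0 adjmx1 !mulmx0 !mul0mx !addr0 mulmx1 mul1mx.
  by rewrite mxE eqxx.
have form (t : K) (y : 'cV_n) : t \is Num.real ->
    0 <= (t * t * s - 2 * t) * ((b *m y)^t* *m (b *m y)) 0 0 + (y^t* *m M *m y) 0 0.
  move=> tR; have := quad (- (t *: (b *m y))) y; set w := b *m y.
  have -> : (- (t *: w))^t* = - (t *: w^t*).
    by rewrite -scaleNr adjmxZ rmorphN /= (CrealP tR) scaleNr.
  rewrite !mulmxN !mulNmx opprK mul_mx_scalar -!scalemxAl -!scalemxAr -(mulmxA (w^t*)) -/w.
  have -> : y^t* *m c *m w = w^t* *m w.
    by rewrite -ec -adjmxM.
  set W := w^t* *m w; set Z := _ *m M *m y; rewrite !scalerA !mxE.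
  by congr (0 <= _); ring.
have b0 : s = 0 -> b = 0.
  move=> s_0; suff h (y : 'cV_n) : b *m y = 0.
    by apply/rowP => j; have := congr1 (fun A : 'M__ => A 0 0) (h (delta_mx j 0));
      rewrite -colE !mxE.
  apply: adjmx_mul_eq0; rewrite (mx11_scalar (_ *m _)); set be := (_ *m _) 0 0.
  suff -> : be = 0 by rewrite raddf0.
  apply/eqP; apply: contraT => ben0.
  have be0 : 0 < be by rewrite lt_def ben0 adjmx_mul_ge0.
  set mu := (y^t* *m M *m y) 0 0; have mu0 : 0 <= mu by have := form 0 y (rpred0 _);
    rewrite !mul0r mulr0 subr0 mul0r add0r.
  (* For [s = 0] the form equals [mu - 2 t be]; this [t] makes it -1. *)
  have tR : (mu + 1) / (2 * be) \is Num.real.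
    by rewrite ger0_real // divr_ge0 ?addr_ge0 // mulr_ge0 ?ltW.
  have := form _ y tR; rewrite s_0 mulr0 sub0r -/mu -/be.
  have -> : - (2 * ((mu + 1) / (2 * be))) * be + mu = -1.
    by field; rewrite gt_eqF.
  by rewrite oppr_ge0 ler10.
split=> //; split.
  by rewrite adjmxB adjmxZ (CrealP (ger0_real s0)) eM -ec adjmxM trmxCK.
move=> y; have [s_0|sn0] := eqVneq s 0.
  by rewrite s_0 (b0 s_0) mulmx0 scale0r subr0 mulmx0 mul0mx mxE.
have sp : 0 < s by rewrite lt_def sn0.
have tR : s^-1 \is Num.real by rewrite rpredV ger0_real.
have := form _ y tR; rewrite -(pmulr_rge0 _ sp).
rewrite mulmxBr mulmxBl -scalemxAr -scalemxAl.
have -> : y^t* *m (c *m b) *m y = (b *m y)^t* *m (b *m y).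
  by rewrite -ec adjmxM !mulmxA.
set W := _^t* *m (b *m y); set Z := _ *m M *m y.
have -> : (s *: Z - W) 0 0 = s * Z 0 0 - W 0 0 by rewrite !mxE.
by congr (0 <= _); field.
Qed.

(** Block Cholesky without division. The scaled Schur complement [S = g M - c b] is polynomial and
    positive with weight [n + n]. The scalar factor [q] of [g] and the denominator [d1] of the
    factor of [S] are collected in [d] instead of being divided out. *)
Lemma fejer_riesz_rational m n (G : 'M[{poly K}]_m) : \det G != 0 ->
  (forall z, `|z| = 1 -> psdmx (z^* ^+ n *: G.@[z])) ->
  exists N d, [/\ forall z, `|z| < 1 -> d.[z] != 0, \det N != 0 &
    forall z, `|z| = 1 ->
      (N.@[z])^t* *m N.@[z] = (d.[z] * (d.[z])^* * z^* ^+ n) *: G.@[z]].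
Proof.
elim: m n G => [|m IH] n G.
  exists 1%:M, 1; split; rewrite ?det_mx00 ?oner_neq0 //.
    by move=> z _; rewrite hornerC oner_neq0.
  by move=> z _; apply/matrixP => -[].
rewrite -[m.+1]/(1 + m)%N in G *; rewrite -[G]submxK [ulsubmx G]mx11_scalar.
move: (ulsubmx G 0 0) (ursubmx G) (dlsubmx G) (drsubmx G) => g b c M {G} G0 hG.
pose t z := z^* ^+ n.
have eGz z : t z *: (block_mx g%:M b c M).@[z] =
    block_mx ((t z * g.[z])%:M : 'M_1) (t z *: b.@[z]) (t z *: c.@[z]) (t z *: M.@[z]).
  by rewrite map_block_mx map_scalar_mx scale_block_mx scale_scalar_mx.
have P z : `|z| = 1 -> [/\ 0 <= t z * g.[z], t z *: c.@[z] = (t z *: b.@[z])^t*,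
    t z * g.[z] = 0 -> t z *: b.@[z] = 0 &
    psdmx ((t z * g.[z]) *: (t z *: M.@[z]) - (t z *: c.@[z]) *m (t z *: b.@[z]))].
  by move=> hz; have := hG z hz; rewrite eGz => /psd_block[].
have tt z : `|z| = 1 -> (t z)^* * t z = 1.
  by move=> hz; rewrite /t rmorphXn /= conjCK -exprMn mulrC conjK_circle // expr1n.
have g0 : g != 0.
  apply: contraNneq G0 => g0; have -> : b = 0.
    apply: (eqmx_on_circle (oner_neq0 _)) => z hz _; have [_ _ h _] := P z hz.
    rewrite g0 horner0 mulr0 in h; rewrite map_mx0 -[LHS]scale1r -(tt z hz) -scalerA h //.
    by rewrite scaler0.
  by rewrite det_lblock g0 det_scalar1 mul0r.
have [|q q1 q2] := @fejer_riesz_scalar _ n g g0; first by move=> z /P[].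
pose S := g *: M - c *m b.
have S0 : \det S != 0.
  apply: contraNneq G0 => S0.
  have e : block_mx 1%:M 0 (- c) g%:M *m block_mx (g%:M : 'M_1) b c M = block_mx g%:M b 0 S.
    rewrite mulmx_block !mul1mx !mul0mx !addr0 mul_mx_scalar !mul_scalar_mx.
    by rewrite scalerN addNr mulNmx addrC.
  have := congr1 determinant e; rewrite det_mulmx det_lblock det_ublock S0 mulr0 det1.
  by rewrite mul1r det_scalar => /eqP; rewrite mulf_eq0 expf_eq0 (negPf g0) andbF.
have [z hz|N1 [d1 [d1_0 N1_0 eN1]]] := IH (n + n)%N S S0.
  have [_ _ _] := P z hz; rewrite !map_mxB /= mxatZ mxatM; congr psdmx.
  rewrite scalerBr !scalerA exprD -/(t z) -scalemxAl -scalemxAr scalerA.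
  by congr (_ *: _ - _); ring.
exists (block_mx ((d1 * g)%:M : 'M_1) (d1 *: b) 0 N1), (d1 * q); split.
- by move=> z hz; rewrite hornerM mulf_neq0 ?d1_0 ?q1.
- by rewrite det_ublock det_scalar1 !mulf_neq0 // -size_poly_eq0; apply: contraTneq (d1_0 0 _) => [|];
    rewrite ?normr0 ?ltr01 // => /eqP; rewrite size_poly_eq0 => /eqP ->; rewrite horner0 eqxx.
move=> z hz; have [s_ge0 ec _ _] := P z hz.
set s := t z * g.[z] in s_ge0 ec; set b' := t z *: b.@[z] in ec.
have sr : s^* = s by apply/CrealP/ger0_real.
have eg : g.[z] = (t z)^* * s by rewrite mulrA tt // mul1r.
have eb : b.@[z] = (t z)^* *: b' by rewrite scalerA tt // scale1r.
have -> : (d1 * q).[z] * (d1 * q).[z]^* * z^* ^+ n = d1.[z] * d1.[z]^* * s * t z.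
  by rewrite /s q2 // hornerM rmorphM /= /t; ring.
have es : s = t z * g.[z] by [].
have eb' : b' = t z *: b.@[z] by [].
rewrite -scalerA eGz -/s -/b' ec; clearbody s b'.
rewrite map_block_mx map_scalar_mx map_mx0 mxatZ /= !horner_evalE hornerM.
rewrite tr_block_mx map_block_mx mulmx_block eg eb !tr_scalar_mx !map_scalar_mx trmx0 map_mx0.
rewrite !mul0mx !mulmx0 !addr0 eN1 // scale_block_mx !adjmxZ !mul_scalar_mx !mul_mx_scalar.
rewrite -scalemxAr -!scalemxAl !scalerA !scale_scalar_mx.
rewrite !rmorphM /=.
rewrite sr conjCK.
have tz := tt z hz.
congr block_mx.
- by rewrite -!(rmorphM (@scalar_mx K 1)); congr (_%:M); ring: tz.
- by congr (_ *: _); ring: tz.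
- by congr (_ *: _); ring: tz.
rewrite -ec /S !map_mxB /= mxatZ mxatM exprD -/(t z) scalerBr !scalerA.
rewrite eb' -scalemxAr scalerA -scalemxAl scalerA.
rewrite addrC -addrA -[RHS]addr0 es; congr (_ *: _ + _).
  by ring.
rewrite -scalemxAr scalerA -scaleNr -scalerDl -[RHS](scale0r (c.@[z] *m b.@[z])); congr (_ *: _).
by ring: tz.
Qed.

(** The rational factor may be singular in the disk. Potapov factors take these zeros away without
    changing the Gram matrix on the circle, and the result meets the hypotheses of [outer_quotient],
    which removes the denominator. *)
Lemma fejer_riesz m n (G : 'M[{poly K}]_m) : \det G != 0 ->
  (forall z, `|z| = 1 -> psdmx (z^* ^+ n *: G.@[z])) ->
  exists Q : 'M[{poly K}]_m, [/\ forall i j, (size (Q i j) <= n.+1)%N,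
    forall z, `|z| < 1 -> \det Q.@[z] != 0 &
    forall z, `|z| = 1 -> (Q.@[z])^t* *m Q.@[z] = z^* ^+ n *: G.@[z]].
Proof.
move=> G0 hG; have [N [d [d_0 N0 eN]]] := fejer_riesz_rational G0 hG.
have [s [r [es hs hr]]] := split_disk_roots N0.
have [A [B [C [D [N' [hU hD hN' eN']]]]]] := potapov_factorization hs hr es.
have eNN z : `|z| = 1 -> (N'.@[z])^t* *m N'.@[z] = (d.[z] * (d.[z])^* * z^* ^+ n) *: G.@[z].
  move=> hz; rewrite -eN //; apply/esym.
  apply: (transfer_norm_circle hU _ hz (eN' z _)); rewrite ?hz //.
  by apply: colligation_den_unit hs (hD z) _; rewrite hz.
have [Q eQ sQ] := outer_quotient d_0 hN' eNN.
have d0 : d != 0.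
  by apply: contraTneq (d_0 0 _) => [->|]; rewrite ?horner0 ?eqxx // normr0 ltr01.
exists Q; split=> //.
  by move=> z hz; have := hN' z hz; rewrite eQ mxatZ detZ mulf_eq0 negb_or => /andP[].
have sQ' L i j : (size (Q i j) <= (n + L).+1)%N.
  by rewrite (leq_trans (sQ i j)) // ltnS leq_addr.
move=> z hz; have := @circle_identityV m n 1 Q G n z _ sQ _ hz.
rewrite hornerC rmorph1 mul1r mul1r; apply; first by rewrite size_poly1.
apply: (circle_identity d0) => //; first by rewrite size_poly1.
move=> y hy dy; have := eNN y hy; rewrite eQ mxatZ adjmxZ -scalemxAl -scalemxAr scalerA.
move=> /(congr1 (fun A => (d.[y] * d.[y]^* )^-1 *: A)); rewrite hornerC rmorph1 !mul1r.
have u0 : d.[y] * d.[y]^* != 0 by rewrite mulf_neq0 // conjC_eq0.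
rewrite !scalerA [d.[y]^* * _]mulrC mulVf // scale1r => ->; congr (_ *: _).
by rewrite mulrA mulVf // mul1r.
Qed.

End MatrixFejerRiesz.

(** * Gram and companion matrices of a polynomial with unimodular roots *)

Section GramMatrix.
Variable K : numClosedFieldType.
Implicit Types (z a w : K) (m n : nat) (q : {poly K}).

(* The outer variable of [P] is [w] and the inner one [z], opposite to [p]. *)
Definition polyat (P : {poly {poly K}}) z : {poly K} := map_poly (horner_eval z) P.

Lemma coef_polyat P z j : (polyat P z)`_j = (P`_j).[z].
Proof. by rewrite coef_map. Qed.

(** The coefficient of [w^a H^b] in [F / (1 - w H)], where [f] lists the coefficients of [F]. *)
Fixpoint diagonal_sum (R : nmodType) (f : nat -> nat -> R) (a b : nat) : R :=
  f a b + match a, b with a'.+1, b'.+1 => diagonal_sum f a' b' | _, _ => 0 end.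

Lemma diagonal_sum_morph (R S : nmodType) (h : R -> S) (f : nat -> nat -> R)
    (a b : nat) : h 0 = 0 -> {morph h : x y / x + y} ->
  h (diagonal_sum f a b) = diagonal_sum (fun i j => h (f i j)) a b.
Proof.
by move=> h0 hD; elim: a b => [|a IH] [|b] /=; rewrite hD ?h0 ?IH.
Qed.

Lemma deriv_prod_XsubC (s : seq K) c :
  (c *: \prod_(a <- s) ('X - a%:P))^`() =
  \sum_(a <- s) ((c *: \prod_(b <- s) ('X - b%:P)) %/ ('X - a%:P)).
Proof.
rewrite derivZ [RHS](eq_bigr (fun a => c *: ((\prod_(b <- s) ('X - b%:P)) %/ ('X - a%:P)))); last first.
  by move=> a _; rewrite divpZl.
rewrite -scaler_sumr; congr (_ *: _); elim: s => [|x s IH].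
  by rewrite !big_nil -polyC1 derivC.
rewrite !big_cons derivM derivXsubC mul1r IH mulKp ?polyXsubC_eq0 //; congr (_ + _).
rewrite mulr_sumr; apply: eq_big_seq => a ha /=.
by rewrite divp_mulA // dvdp_XsubCl root_prod_XsubC.
Qed.

Lemma prod_XsubC_div (s : seq K) c x : x \in s ->
  c *: \prod_(b <- s) ('X - b%:P) =
  ('X - x%:P) * ((c *: \prod_(b <- s) ('X - b%:P)) %/ ('X - x%:P)).
Proof.
by move=> hx; rewrite divpZl -scalerAr mulrC divpK // dvdp_XsubCl root_prod_XsubC.
Qed.

(* The matrix of the Hermitian form with generating function
   [(m q(w) Q - w q'(w) Q - q(w) H Q') / (1 - w H)], where [Q], [Q'], [H] are
   the conjugates of [q(eta)], [q'(eta)], [eta]; for [q] with all roots on the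
   circle it is the Gram matrix of the quotients [q / (w - x)]. *)
Lemma gram_diagonal_sum q (s : seq K) c (a b : nat) : q = c *: \prod_(x <- s) ('X - x%:P) ->
  (forall x, x \in s -> `|x| = 1) ->
  diagonal_sum (fun i j => ((size s)%:R - i%:R - j%:R) * (q`_i * (q`_j)^*)) a b =
  \sum_(x <- s) (q %/ ('X - x%:P))`_a * ((q %/ ('X - x%:P))`_b)^*.
Proof.
move=> eq hs; pose p x := q %/ ('X - x%:P).
have sp i : \sum_(x <- s) ('X * p x)`_i = i%:R * q`_i.
  case: i => [|i]; first by rewrite mul0r big1 // => x _; rewrite coefXM.
  rewrite (eq_bigr (fun x => (p x)`_i)); last by move=> x _; rewrite coefXM.
  have := congr1 (fun r : {poly K} => r`_i) (deriv_prod_XsubC s c).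
  by rewrite -eq coef_deriv coef_sum => <-; rewrite mulr_natl.
have qE x i : x \in s -> q`_i = ('X * p x)`_i - x * (p x)`_i.
  move=> hx; have e : q = ('X - x%:P) * p x by rewrite /p eq; apply: prod_XsubC_div.
  by rewrite {1}e mulrBl coefB coefCM.
(* As [|x| = 1], the product equals [(x p)_i] times the conjugate of [(x p)_j], and [x p = X p - q].
   The cross terms sum to coefficients of [X q'], whence the factor with [- i - j]. *)
have step i j : \sum_(x <- s) (p x)`_i * ((p x)`_j)^* =
    ((size s)%:R - i%:R - j%:R) * (q`_i * (q`_j)^*) +
    \sum_(x <- s) ('X * p x)`_i * (('X * p x)`_j)^*.
  rewrite (eq_big_seq (fun x => q`_i * (q`_j)^* - ('X * p x)`_i * (q`_j)^* -
      q`_i * (('X * p x)`_j)^* + ('X * p x)`_i * (('X * p x)`_j)^*)); last first.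
    move=> x hx /=; have xx : x^* * x = 1 by rewrite conjK_circle // hs.
    rewrite (qE x i hx) (qE x j hx) rmorphB rmorphM /=.
    set e1 := ('X * _)`_i; set e2 := ('X * _)`_j; ring: xx.
  rewrite !big_split /= !sumrN -!mulr_suml -!mulr_sumr -rmorph_sum sp.
  rewrite sp big_const_seq count_predT iter_addr addr0 -mulr_natl rmorphM /= rmorph_nat.
  by congr (_ + _); ring.
elim: a b => [|a IH] [|b] /=; rewrite step /=; congr (_ + _).
- by rewrite big1 // => x _; rewrite !coefXM mul0r.
- by rewrite big1 // => x _; rewrite !coefXM mul0r.
- by rewrite big1 // => x _; rewrite !coefXM rmorph0 mulr0.
- by rewrite IH; apply: eq_bigr => x _; rewrite !coefXM.
Qed.

(** [companionmx] with its size as a separate parameter, so that the type does not depend on the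
    polynomial. *)
Definition compmx m (q : seq K) : 'M[K]_m :=
  \matrix_(i, j) if (i == m.-1 :> nat) then - q`_j else (i.+1 == j :> nat)%:R.

Lemma char_poly_compmx m q : q \is monic -> size q = m.+1 ->
  char_poly (compmx m q) = q.
Proof.
move=> mon sq; have em : m = (size q).-1 by rewrite sq.
by move: sq; rewrite em => _; exact: companionmxK.
Qed.

Lemma char_poly_horner m (A : 'M[K]_m) w : (char_poly A).[w] = \det (w%:M - A).
Proof.
rewrite -horner_evalE -det_map_mx; congr (\det _); apply/matrixP => i j.
by rewrite !mxE /= horner_evalE !hornerE hornerMn hornerX.
Qed.

Lemma compmx_monomials m q w : q \is monic -> size q = m.+1 -> q.[w] = 0 ->
  compmx m q *m (\col_(j < m) w ^+ j) = w *: (\col_(j < m) w ^+ j).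
Proof.
move=> mon sq qw; apply/colP => i; rewrite !mxE.
case: m i sq => [[]//|m] i sq.
have [im|im] := eqVneq (i : nat) m.
  transitivity (- \sum_(j < m.+1) q`_j * w ^+ j).
    by rewrite -sumrN; apply: eq_bigr => j _; rewrite !mxE /= im eqxx mulNr.
  move: qw; rewrite (horner_coef_wide _ (leq_trans (leqnn _) (eq_leq sq))).
  rewrite big_ord_recr /= => /eqP; rewrite addrC addr_eq0 => /eqP <-.
  have -> : q`_m.+1 = 1 by have := monicP mon; rewrite lead_coefE sq.
  by rewrite mul1r im -exprS.
have li : (i.+1 < m.+1)%N by rewrite ltnS ltn_neqAle im -ltnS ltn_ord.
rewrite (bigD1 (Ordinal li)) //= !mxE /= (negPf im) eqxx mul1r -exprS big1 ?addr0 //.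
move=> j; rewrite -val_eqE /= => nj; rewrite !mxE /= (negPf im) eq_sym (negPf nj) mul0r.
by [].
Qed.

Definition quotient_mx m q (s : seq K) : 'M[K]_m :=
  \matrix_(i, j) (q %/ ('X - (s`_i)%:P))`_j.

(** On coefficient rows the companion matrix multiplies by [X] modulo [q], and
    [(X - x) (q / (X - x))] is 0 modulo [q]: the rows are left eigenvectors. *)
Lemma quotient_mx_comp m q (s : seq K) c : c != 0 -> size s = m ->
  q = c *: \prod_(x <- s) ('X - x%:P) ->
  quotient_mx m q s *m compmx m (c^-1 *: q) =
  diag_mx (\row_(i < m) s`_i) *m quotient_mx m q s.
Proof.
case: m => [|m] c0 ss eq; first by apply/matrixP => -[].
apply/matrixP => i j; rewrite mul_diag_mx !mxE.
set x := s`_i; have hx : x \in s by rewrite mem_nth ?ss.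
pose p := q %/ ('X - x%:P).
have e : q = ('X - x%:P) * p by rewrite /p eq; apply: prod_XsubC_div.
have qj : q`_j = ('X * p)`_j - x * p`_j by rewrite {1}e mulrBl coefB coefCM.
have sq : size q = m.+2 by rewrite eq size_scale // size_prod_XsubC ss.
have pc : p`_m = c.
  have p0 : p != 0.
    by apply: contra_eq_neq sq => p0; rewrite e p0 mulr0 size_poly0.
  have sp : size p = m.+1 by move: sq; rewrite e size_XsubC_mul // => -[].
  have := lead_coefM ('X - x%:P) p; rewrite -e lead_coefXsubC mul1r.
  rewrite [lead_coef p]lead_coefE sp => <-; rewrite eq lead_coefZ.
  by rewrite (monicP (monic_prod_XsubC _ _ _)) mulr1.
rewrite big_ord_recr !mxE /= eqxx -/p pc coefZ.
rewrite mulrN mulVKf // qj opprB addrC.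
rewrite (eq_bigr (fun k : 'I_m => p`_k * (k.+1 == j)%:R)); last first.
  by move=> k _; rewrite !mxE /= ltn_eqF.
suff -> : \sum_(k < m) p`_k * (k.+1 == j)%:R = ('X * p)`_j by rewrite subrK.
rewrite coefXM; case: (j : nat) (ltn_ord j) => [|k] hk /=.
  by rewrite big1 // => l _; rewrite mulr0.
rewrite (bigD1 (Ordinal (hk : (k < m)%N))) //= eqxx mulr1 big1 ?addr0 // => l.
by rewrite -val_eqE /= eqSS => /negPf ->; rewrite mulr0.
Qed.

(** Multiplying by the Vandermonde matrix of the roots evaluates the quotients there, leaving a
    diagonal matrix that is nonsingular because the roots are simple. *)
Lemma quotient_mx_det m q (s : seq K) c : c != 0 -> size s = m -> uniq s ->
  q = c *: \prod_(x <- s) ('X - x%:P) -> \det (quotient_mx m q s) != 0.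
Proof.
move=> c0 ss us eq; pose V := \matrix_(i < m, j < m) s`_j ^+ i.
have sq : size q = m.+1 by rewrite eq size_scale // size_prod_XsubC ss.
have q0 : q != 0 by rewrite -size_poly_eq0 sq.
suff e : quotient_mx m q s *m V =
    diag_mx (\row_(i < m) (q %/ ('X - (s`_i)%:P)).[s`_i]).
  have := congr1 determinant e; rewrite det_mulmx det_diag => e2.
  have : \prod_(i < m) (\row_(i < m) (q %/ ('X - (s`_i)%:P)).[s`_i]) 0 i != 0.
    apply/prodf_neq0 => i _; rewrite mxE; apply/negP => /eqP h.
    have hx : s`_i \in s by rewrite mem_nth ?ss.
    have /factor_theorem[r er] : root (q %/ ('X - (s`_i)%:P)) s`_i by apply/rootP.
    have := prod_XsubC_div c hx; rewrite -eq er => e3.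
    have sep : separable_poly (\prod_(x <- s) ('X - x%:P)) by rewrite separable_prod_XsubC.
    have : ('X - (s`_i)%:P) ^+ 2 %| \prod_(x <- s) ('X - x%:P).
      rewrite -(dvdpZr _ _ c0) -eq e3; apply/dvdpP; exists r; ring.
    by rewrite (separable_nosquare sep) // size_XsubC.
  by rewrite -e2 mulf_eq0 negb_or => /andP[].
apply/matrixP => i j; rewrite !mxE.
set p := q %/ _.
have hx : s`_i \in s by rewrite mem_nth ?ss.
have e : q = ('X - (s`_i)%:P) * p by rewrite /p eq; apply: prod_XsubC_div.
have p0 : p != 0 by apply: contraNneq q0 => p0; rewrite e p0 mulr0.
have sp : size p = m by move: sq; rewrite e size_XsubC_mul // => -[].
transitivity p.[s`_j].
  rewrite (horner_coef_wide _ (eq_leq sp)); apply: eq_bigr => k _.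
  by rewrite !mxE.
have [<-|ij] := eqVneq i j; first by rewrite mulr1n.
rewrite mulr0n; have : q.[s`_j] = 0.
  by apply/rootP; rewrite eq rootZ // root_prod_XsubC mem_nth ?ss.
rewrite e hornerM hornerXsubC => /eqP; rewrite mulf_eq0 subr_eq0 nth_uniq ?ss //.
by rewrite eq_sym [_ == _](negPf ij) /= => /eqP.
Qed.

End GramMatrix.

(** * Realization of the conjugated companion matrix *)

Section InnerRealization.
Variable K : numClosedFieldType.
Variables (n m : nat) (P : {poly {poly K}}) (c : K) (s : seq K).
Hypothesis m_gt0 : (0 < m)%N.
Hypothesis sizeP : size P = m.+1.
Hypothesis size_coefP : forall j : nat, (size (P`_j)%R <= n.+1)%N.
Hypothesis leadP : forall z : K, `|z| <= 1 -> (P`_m).[z] != 0.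
Hypothesis rootsP : forall z w : K, `|z| = 1 -> (polyat P z).[w] = 0 -> `|w| = 1.
Hypothesis coef0P : P`_0 = c *: \prod_(a <- s) ('X - a%:P).
Hypothesis disk_s : forall a, a \in s -> `|a| < 1.
Hypothesis c_neq0 : c != 0.
Implicit Types (z w : K).

Local Notation lc z := ((P`_m).[z]).

Lemma size_polyat z : `|z| <= 1 -> size (polyat P z) = m.+1.
Proof.
move=> hz; apply/eqP; rewrite eqn_leq; apply/andP; split.
  by rewrite -sizeP size_poly.
rewrite ltnNge; apply/negP => h; have := leadP hz.
by rewrite -coef_polyat nth_default // eqxx.
Qed.

Lemma lead_coef_polyat z : `|z| <= 1 -> lead_coef (polyat P z) = lc z.
Proof. by move=> hz; rewrite lead_coefE size_polyat // coef_polyat. Qed.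

Lemma monic_polyat z : `|z| <= 1 -> (lc z)^-1 *: polyat P z \is monic.
Proof.
by move=> hz; rewrite monicE lead_coefZ lead_coef_polyat // mulVf ?leadP.
Qed.

Lemma size_monic_polyat z : `|z| <= 1 -> size ((lc z)^-1 *: polyat P z) = m.+1.
Proof. by move=> hz; rewrite size_scale ?invr_eq0 ?leadP // size_polyat. Qed.

(** On the circle [revp n] turns conjugated coefficients into polynomials at the price of [z ^+ n].
    The indices are exchanged because the Gram matrix is taken in the form [L^* L]. *)
Definition gram_poly : 'M[{poly K}]_m :=
  \matrix_(b, a) diagonal_sum (fun i j =>
    (m%:R - i%:R - j%:R)%:P * (P`_i * revp n P`_j)) a b.

Definition comp_at z : 'M[K]_m := compmx m ((lc z)^-1 *: polyat P z).

Definition comp_poly : 'M[{poly K}]_m :=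
  \matrix_(i, j) if (i == m.-1 :> nat) then - P`_j else P`_m * (i.+1 == j :> nat)%:R.

Lemma comp_poly_at z : `|z| <= 1 -> comp_poly.@[z] = lc z *: comp_at z.
Proof.
move=> hz; apply/matrixP => i j; rewrite !mxE /horner_eval; case: ifP => _.
  by rewrite hornerN coefZ coef_polyat mulrN mulVKf ?leadP.
by rewrite hornerM -[_%:R]polyC_natr hornerC.
Qed.

Lemma circle_roots z : `|z| = 1 -> exists2 r : seq K, size r = m &
  polyat P z = lc z *: \prod_(x <- r) ('X - x%:P) /\ (forall x, x \in r -> `|x| = 1).
Proof.
move=> hz; have hz1 : `|z| <= 1 by rewrite hz.
have q0 : polyat P z != 0 by rewrite -size_poly_eq0 size_polyat.
have [r er sr] := poly_prod_XsubC q0; rewrite lead_coef_polyat // in er.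
exists r; first by move: sr; rewrite size_polyat // => -[].
split=> // x hx; apply: (rootsP hz); apply/rootP.
by rewrite er rootZ ?leadP // root_prod_XsubC.
Qed.

Lemma gram_poly_at z (r : seq K) : `|z| = 1 -> size r = m ->
  polyat P z = lc z *: \prod_(x <- r) ('X - x%:P) -> (forall x, x \in r -> `|x| = 1) ->
  z^* ^+ n *: gram_poly.@[z] =
  (quotient_mx m (polyat P z) r)^t* *m quotient_mx m (polyat P z) r.
Proof.
move=> hz sr er hr; apply/matrixP => b a; rewrite !mxE /horner_eval.
transitivity (diagonal_sum (fun i j => (m%:R - i%:R - j%:R) *
    ((polyat P z)`_i * ((polyat P z)`_j)^*)) a b).
  rewrite (diagonal_sum_morph (h := fun p : {poly K} => z^* ^+ n * p.[z])); first last.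
  - by move=> p q; rewrite hornerD mulrDr.
  - by rewrite horner0 mulr0.
  congr (diagonal_sum _ a b).
  apply: boolp.funext => i; apply: boolp.funext => j.
  rewrite !hornerM hornerC revp_circle // !coef_polyat.
  have zn : z^* ^+ n * z ^+ n = 1 by rewrite -exprMn conjK_circle // expr1n.
  by ring: zn.
have E := gram_diagonal_sum a b er hr; rewrite sr in E.
rewrite E (big_nth 0) big_mkord sr.
by apply: eq_bigr => i _; rewrite !mxE mulrC.
Qed.

Lemma gram_poly_psd z : `|z| = 1 -> psdmx (z^* ^+ n *: gram_poly.@[z]).
Proof.
move=> hz; have [r sr [er hr]] := circle_roots hz; rewrite (gram_poly_at hz sr er hr).
split; first by rewrite adjmxM trmxCK.
by move=> v; rewrite mulmxA -mulmxA -adjmxM; apply: adjmx_mul_ge0.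
Qed.

Lemma gram_poly_comp z : `|z| = 1 ->
  (comp_at z)^t* *m gram_poly.@[z] *m comp_at z = gram_poly.@[z].
Proof.
move=> hz; have [r sr [er hr]] := circle_roots hz.
have zn : z^* ^+ n != 0 by rewrite expf_neq0 // conjC_eq0 circle_neq0.
apply: (can_inj (scalerK zn)); rewrite scalemxAl scalemxAr (gram_poly_at hz sr er hr).
have l0 : lc z != 0 by rewrite leadP ?hz.
have E := quotient_mx_comp l0 sr er; rewrite -/(comp_at z) in E.
set L := quotient_mx _ _ _ in E *; set D := diag_mx _ in E.
have DD : D^t* *m D = 1%:M.
  apply/matrixP => i j; rewrite tr_diag_mx map_diag_mx mul_diag_mx !mxE.
  case: eqP => [->|_]; last by rewrite !mulr0n mulr0.
  by rewrite !mulr1n conjK_circle // hr // mem_nth ?sr.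
by rewrite mulmxA -adjmxM -mulmxA E adjmxM -!mulmxA (mulmxA (D^t*)) DD mul1mx.
Qed.

Lemma gram_poly_det z : `|z| = 1 ->
  (forall w, (polyat P z).[w] = 0 -> (polyat P z)^`().[w] != 0) ->
  \det gram_poly.@[z] != 0.
Proof.
move=> hz hs; have [r sr [er hr]] := circle_roots hz.
have l0 : lc z != 0 by rewrite leadP ?hz.
have q0 : polyat P z != 0 by rewrite -size_poly_eq0 size_polyat ?hz.
have ur : uniq r.
  rewrite -separable_prod_XsubC separable_poly.unlock -(coprimepZl _ _ l0) -(coprimepZr _ _ l0).
  rewrite -derivZ -er; apply/Pdiv.ClosedField.coprimepP => x /rootP; exact: hs.
have := congr1 determinant (gram_poly_at hz sr er hr).
rewrite det_mulmx detZ => e.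
have : \det (quotient_mx m (polyat P z) r) != 0 by apply: quotient_mx_det er.
move=> h; apply: contraNneq h => h0; move/eqP: e; rewrite h0 mulr0 eq_sym mulf_eq0.
by rewrite det_map_mx det_tr conjC_eq0 orbb.
Qed.

(** As [P_m] has no zeros in the closed disk, the zeros of this determinant there are those of
    [P_0]; they fix the number of states. *)
Lemma det_comp_poly : \det comp_poly = (-1) ^+ m *: (P`_0 * P`_m ^+ m.-1).
Proof.
apply: eq_on_circle => z hz; have hz1 : `|z| <= 1 by rewrite hz.
rewrite -mxat_det comp_poly_at // detZ hornerZ hornerM horner_exp.
have := char_poly_compmx (monic_polyat hz1) (size_monic_polyat hz1).
move=> /(congr1 (fun q : {poly K} => q.[0])); rewrite char_poly_horner raddf0 sub0r.
rewrite -scaleN1r detZ horner_coef0 coefZ coef_polyat -/(comp_at z) => e.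
have -> : \det (comp_at z) = (-1) ^+ m * ((lc z)^-1 * (P`_0).[z]).
  by rewrite -e mulrA -exprMn mulrNN mul1r expr1n mul1r.
case: (m) m_gt0 leadP => // k _ l0; rewrite exprS /=; field.
by rewrite l0.
Qed.

Theorem inner_realization :
  (exists2 z, `|z| = 1 &
     forall w, (polyat P z).[w] = 0 -> (polyat P z)^`().[w] != 0) ->
  exists (A : 'M[K]_m) (B : 'M_(m, size s)) (C : 'M_(size s, m)) (D : 'M_(size s))
    (Q : 'M[{poly K}]_m),
  [/\ block_mx A B C D \is unitarymx,
      forall z, \det (1%:M - z *: D) = \prod_(a <- s) (1 - a^* * z) &
      forall i j, (size (Q i j) <= n.+1)%N] /\
  [/\ forall z, `|z| < 1 -> \det Q.@[z] != 0,
      forall z, `|z| = 1 -> (Q.@[z])^t* *m Q.@[z] = z^* ^+ n *: gram_poly.@[z] &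
      forall z, `|z| < 1 -> transfer_fun A B C D z *m Q.@[z] = Q.@[z] *m comp_at z].
Proof.
case=> z0 hz0 /(gram_poly_det hz0) d0.
have G0 : \det gram_poly != 0 by apply: contraNneq d0 => e; rewrite mxat_det e horner0.
have [Q [sQ hQ eQ]] := fejer_riesz G0 gram_poly_psd.
(* [N / d] is [Q Comp Q^-1] with denominators cleared, and [d] is zero-free in the disk. *)
pose N := Q *m comp_poly *m \adj Q; pose d := P`_m * \det Q.
have hd z : `|z| < 1 -> d.[z] != 0.
  by move=> hz; rewrite hornerM mulf_neq0 ?leadP ?(ltW hz) // -mxat_det hQ.
have Nat z : N.@[z] = Q.@[z] *m comp_poly.@[z] *m \adj Q.@[z].
  by rewrite /N !mxatM map_mx_adj.
have hN z : `|z| = 1 -> (N.@[z])^t* *m N.@[z] = (d.[z] * d.[z]^* * z^* ^+ 0) *: (1%:M).@[z].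
  move=> hz; have hz1 : `|z| <= 1 by rewrite hz.
  have key : (comp_at z)^t* *m ((Q.@[z])^t* *m Q.@[z]) *m comp_at z =
      (Q.@[z])^t* *m Q.@[z].
    by rewrite eQ // -scalemxAr -scalemxAl gram_poly_comp.
  have QA := mul_mx_adj Q.@[z]; set Aj := \adj Q.@[z] in QA *.
  rewrite Nat comp_poly_at // -scalemxAr -scalemxAl adjmxZ -scalemxAl -scalemxAr scalerA.
  rewrite !adjmxM -/Aj.
  have -> : Aj^t* *m ((comp_at z)^t* *m (Q.@[z])^t*) *m (Q.@[z] *m comp_at z *m Aj) =
      Aj^t* *m ((comp_at z)^t* *m ((Q.@[z])^t* *m Q.@[z]) *m comp_at z) *m Aj.
    by rewrite !mulmxA.
  rewrite key !mulmxA -adjmxM -mulmxA QA adjmx_scalar -scalar_mxM map_mx1.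
  have -> : d.[z] = lc z * \det Q.@[z] by rewrite hornerM mxat_det.
  rewrite scale_scalar_mx scalemx1; congr scalar_mx; rewrite rmorphM /=; ring.
have eN : \det N = \prod_(a <- s) ('X - a%:P) *
    ((-1) ^+ m *: (c *: P`_m ^+ m.-1) * \det Q ^+ m).
  rewrite /N !det_mulmx mulrAC -det_mulmx mul_mx_adj det_scalar det_comp_poly coef0P.
  rewrite mulrC -!mul_polyC; ring.
have hr z : `|z| < 1 -> ((-1) ^+ m *: (c *: P`_m ^+ m.-1) * \det Q ^+ m).[z] != 0.
  move=> hz; rewrite hornerM !hornerZ !horner_exp !mulf_neq0 ?expf_neq0 ?oppr_eq0 ?oner_eq0 //.
    by rewrite leadP ?ltW.
  by rewrite -mxat_det hQ.
have [A [B [C [D [N' [hU hD hN' eN']]]]]] := potapov_factorization disk_s hr eN.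
have unitD z : `|z| <= 1 -> 1%:M - z *: D \in unitmx.
  exact: colligation_den_unit disk_s (hD z).
(* With weight 0 the degree bound makes the quotient constant. It is unitary, as seen at a point of
   the circle where [d] does not vanish, and can be absorbed into [A] and [C]. *)
have [X eX sX] : exists2 X, N' = d *: X & forall i j, (size (X i j) <= 1)%N.
  apply: (@outer_quotient _ _ _ _ 1%:M) => // z hz; rewrite -hN //; apply/esym.
  by apply: (transfer_norm_circle hU _ hz (eN' z _)); rewrite ?unitD ?hz.
pose X0 := X.@[0].
have eX0 z : X.@[z] = X0.
  apply/matrixP => i j; rewrite !mxE /horner_eval.
  by rewrite (size1_polyC (sX i j)) !hornerC.
have d_neq0 : d != 0.
  by apply: contraTneq (hd 0 _) => [->|]; rewrite ?horner0 ?eqxx // normr0 ltr01.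
have uX : X0 \is unitarymx.
  have [z hz dz] := circle_nonroot d_neq0.
  have : (N'.@[z])^t* *m N'.@[z] = (d.[z] * d.[z]^*)%:M.
    have := hN z hz; rewrite map_mx1 scalemx1 mulr1 => <-; apply/esym.
    by apply: (transfer_norm_circle hU _ hz (eN' z _)); rewrite ?unitD ?hz.
  rewrite eX mxatZ eX0 adjmxZ -scalemxAl -scalemxAr scalerA -scalemx1 [d.[z]^* * _]mulrC.
  have dz2 : d.[z] * d.[z]^* != 0 by rewrite mulf_neq0 // conjC_eq0.
  by move=> /(can_inj (scalerK dz2)) /mulmx1C h; apply/unitarymxP.
have [hU' eT] := transfer_mulr_unitary hU uX.
exists (A *m X0), B, (C *m X0), D, Q; split; split=> // z hz.
have hz1 := ltW hz; rewrite eT.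
have := eN' z hz1; rewrite eX mxatZ eX0 -scalemxAr Nat => e.
apply: (can_inj (scalerK (hd z hz))); rewrite scalemxAl -e.
rewrite -(mulmxA _ (\adj _)) mul_adj_mx mul_mx_scalar.
by rewrite comp_poly_at // -scalemxAr scalerA mxat_det hornerM mulrC.
Qed.

End InnerRealization.

(** * Bounds for polynomials and generic simplicity of roots *)

Section Bounds.
Variable K : numClosedFieldType.
Implicit Types (z w a x y : K) (q : {poly K}) (P : {poly {poly K}}).

Lemma polyatMXaddC P (c : {poly K}) z :
  polyat (P * 'X + c%:P) z = polyat P z * 'X + (c.[z])%:P.
Proof. by rewrite /polyat rmorphD rmorphM /= map_polyX map_polyC. Qed.

Lemma lipschitz_ball2 P (b : K) : 0 <= b -> exists2 k : K, 0 <= k &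
  forall z z' w w', `|z| <= b -> `|z'| <= b -> `|w| <= b -> `|w'| <= b ->
    `|(polyat P z).[w] - (polyat P z').[w']| <= k * (`|z - z'| + `|w - w'|) /\
    `|(polyat P z).[w]| <= k.
Proof.
move=> b0; elim/poly_ind: P => [|P c [k k0 IH]].
  exists 0 => // z z' w w' _ _ _ _.
  by rewrite /polyat !rmorph0 !horner0 subrr normr0 mul0r.
have [k1 k10 Hc] := lipschitz_ball c b0.
exists (k * b + k + k1) => [|z z' w w' hz hz' hw hw'].
  by rewrite !addr_ge0 // mulr_ge0.
have [I1 I2] := IH z z' w w' hz hz' hw hw'.
have [_ I3] := IH z' z w' w hz' hz hw' hw.
have [H1 H2] := Hc z z' hz hz'.
rewrite !polyatMXaddC !hornerE; split.
  set u := (polyat P z).[w] in I1 I2 *; set v := (polyat P z').[w'] in I1 I3 *.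
  have -> : u * w + c.[z] - (v * w' + c.[z']) =
      (u - v) * w + v * (w - w') + (c.[z] - c.[z']) by ring.
  set S := `|z - z'| + `|w - w'|.
  have -> : (k * b + k + k1) * S = k * b * S + k * S + k1 * S by ring.
  apply: le_trans (ler_normD _ _) _; apply: lerD; last first.
    by apply: le_trans H1 _; rewrite mulrDr lerDl mulr_ge0.
  apply: le_trans (ler_normD _ _) _; rewrite [`|_ * w|]normrM [`|v * _|]normrM.
  apply: lerD; first by rewrite mulrAC ler_pM.
  by rewrite mulrDr; apply: le_trans (ler_wpM2r (normr_ge0 _) I3) _; rewrite lerDr mulr_ge0.
apply: le_trans (ler_normD _ _) _; rewrite normrM lerD //.
by rewrite -[leLHS]addr0 lerD // ler_pM.
Qed.

Lemma prod_XsubC_root0 q (s : seq K) c x :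
  q = c *: \prod_(a <- s) ('X - a%:P) -> x \in s -> q.[x] = 0.
Proof.
move=> -> hx; rewrite hornerZ; have /rootP -> : root (\prod_(a <- s) ('X - a%:P)) x.
  by rewrite root_prod_XsubC.
by rewrite mulr0.
Qed.

(** In place of compactness: [|z - x|] is at least [|1 - |x||] for each root [x]. *)
Lemma circle_lower q : (forall z, `|z| = 1 -> q.[z] != 0) ->
  exists2 k : K, 0 < k & forall z, `|z| = 1 -> k <= `|q.[z]|.
Proof.
move=> hq; have q0 : q != 0.
  by apply: contraTneq (hq 1 (normr1 _)) => ->; rewrite horner0 eqxx.
have [s es _] := poly_prod_XsubC q0.
have hs x : x \in s -> `|x| != 1.
  move=> hx; apply/negP => /eqP /hq /negP[]; apply/eqP.
  exact: prod_XsubC_root0 es hx.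
exists (`|lead_coef q| * \prod_(x <- s) `|1 - `|x| |).
  rewrite mulr_gt0 ?normr_gt0 ?lead_coef_eq0 // big_seq prodr_gt0 // => x /hs.
  by rewrite normr_gt0 subr_eq0 eq_sym.
move=> z hz; rewrite es hornerZ normrM lead_coefZ (monicP (monic_prod_XsubC _ _ _)) mulr1.
rewrite ler_wpM2l // horner_prod normr_prod ler_prod // => x _.
by rewrite normr_ge0 hornerXsubC -hz ler_dist_dist.
Qed.

(** A Harnack-type bound: for a root [|x| >= 1] one has [|z - x| >= |x| (1 - |z|)]. Apart from the
    value at 0 it depends on [q] only through the degree. *)
Lemma disk_lower q N z : (forall y, `|y| < 1 -> q.[y] != 0) -> (size q <= N.+1)%N ->
  `|z| < 1 -> `|q.[0]| * (1 - `|z|) ^+ N <= `|q.[z]|.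
Proof.
move=> hq sq hz; have q0 : q != 0.
  by apply: contraTneq (hq 0 _) => [->|]; rewrite ?horner0 ?eqxx // normr0 ltr01.
have [s es ss] := poly_prod_XsubC q0.
have hs x : x \in s -> 1 <= `|x|.
  move=> hx; rewrite real_leNgt ?rpred1 ?normr_real //; apply/negP => /hq /negP[]; apply/eqP.
  exact: prod_XsubC_root0 es hx.
have z1 : 0 <= 1 - `|z| by rewrite subr_ge0 ltW.
have sN : (size s <= N)%N by rewrite ss in sq.
rewrite {1}es [in leRHS]es !hornerZ !normrM -mulrA ler_wpM2l // !horner_prod !normr_prod.
apply: (@le_trans _ _ ((\prod_(x <- s) `|('X - x%:P).[0]|) * (1 - `|z|) ^+ size s)).
  rewrite ler_wpM2l ?prodr_ge0 //.
  by rewrite ler_wiXn2l // lerBlDr lerDl.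
elim: s hs {es ss sN} => [|x s IH] hs; first by rewrite !big_nil expr0 mulr1.
rewrite !big_cons exprS mulrACA; apply: ler_pM.
- by rewrite mulr_ge0.
- by rewrite mulr_ge0 ?exprn_ge0 // prodr_ge0.
- rewrite !hornerXsubC sub0r normrN.
  have hx : 1 <= `|x| by rewrite hs ?mem_head.
  apply: (@le_trans _ _ (`|x| - `|z|)); last by rewrite distrC lerB_dist.
  by rewrite mulrBr mulr1 lerD2l lerN2 ler_peMl.
- by apply: IH => y hy; rewrite hs // inE hy orbT.
Qed.

Lemma le0_radial (x k : K) : x \is Num.real -> 0 <= k ->
  (forall r : K, 0 <= r -> r < 1 -> x <= k * (1 - r)) -> x <= 0.
Proof.
move=> xR k0 h; rewrite real_leNgt ?rpred0 //; apply/negP => x0.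
have d0 : 0 < x + k + 1 by rewrite ltr_wpDl ?ltr01 // addr_ge0 // ltW.
pose t := x / (x + k + 1).
have t0 : 0 < t by rewrite divr_gt0.
have t1 : t <= 1 by rewrite ler_pdivrMr // mul1r -addrA lerDl addr_ge0.
have := h (1 - t); rewrite subr_ge0 gtrDl oppr_lt0 t1 t0 subKr => /(_ isT isT).
rewrite mulrA ler_pdivlMr // mulrC ler_pM2r //.
have -> : x + k + 1 = k + (x + 1) by ring.
by rewrite gerDl => /(lt_le_trans (addr_gt0 x0 ltr01)); rewrite ltxx.
Qed.

Lemma circle_projection z : z != 0 -> `|z / `|z| | = 1 /\ `|z - z / `|z| | = `| `|z| - 1|.
Proof.
move=> z0; have n0 : `|z| != 0 by rewrite normr_eq0.
split; first by rewrite normf_div normr_id divff.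
have -> : z - z / `|z| = (z / `|z|) * (`|z| - 1) by field.
by rewrite normrM normf_div normr_id divff // mul1r.
Qed.

(** Exceptional [z], the zeros of [e], are allowed because gcds and elimination over [{poly K}] give
    the right zeros only where certain coefficients do not vanish. *)
Definition generically_minimal P := forall (F : {poly {poly K}}) (e : {poly K}),
  e != 0 -> F != 0 ->
  (forall z, `|z| < 1 -> e.[z] != 0 -> forall w, `|w| < 1 ->
     (polyat F z).[w] = 0 <-> (polyat P z).[w] = 0) ->
  (size P <= size F)%N.

Lemma polyatM P Q z : polyat (P * Q) z = polyat P z * polyat Q z.
Proof. exact: rmorphM. Qed.

Lemma polyatZ c P z : polyat (c *: P) z = c.[z] *: polyat P z.
Proof. exact: map_polyZ. Qed.

Lemma polyat_deriv P z : polyat P^`() z = (polyat P z)^`().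
Proof. by rewrite /polyat deriv_map. Qed.

Lemma quotient_gcd_deriv_root (p q g p' : {poly K}) (c c' : K) w :
  p != 0 -> c != 0 -> c' != 0 -> c *: p = q * g -> c' *: p^`() = p' * g ->
  p.[w] = 0 -> q.[w] = 0.
Proof.
move=> p0 c0 c'0 e e' pw; apply/eqP; apply: contraT => qw.
have [k [u nu eu]] := multiplicity_XsubC p w; rewrite p0 /= in nu.
have k0 : (0 < k)%N.
  rewrite lt0n; apply: contraNneq nu => k0; rewrite k0 expr0 mulr1 in eu.
  by apply/rootP; rewrite -eu.
have cop : coprimep (('X - w%:P) ^+ k) q.
  by rewrite coprimep_expl // coprimep_sym coprimep_XsubC /root.
have dg : ('X - w%:P) ^+ k %| g.
  by rewrite -(Gauss_dvdpr _ cop) -e dvdpZr // eu dvdp_mull.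
have : ('X - w%:P) ^+ k %| p^`().
  by rewrite -(dvdpZr _ _ c'0) e' dvdp_mull.
rewrite eu derivM deriv_exp derivXsubC mul1r dvdp_addr; last exact: dvdp_mull.
have -> : u * (('X - w%:P) ^+ k.-1 *+ k) = (u * k%:R) * ('X - w%:P) ^+ k.-1.
  by rewrite -mulr_natr; ring.
rewrite -{1}(prednK k0) exprS dvdp_mul2r ?expf_neq0 ?polyXsubC_eq0 // dvdp_XsubCl.
rewrite rootM (negPf nu) /= -polyC_natr /root hornerC pnatr_eq0.
by rewrite -leqn0 leqNgt k0.
Qed.

(** The resultant of [P] and its derivative serves as [e]. If it were zero, dividing [P] by its gcd
    with the derivative would give a polynomial of smaller degree with generically the same
    zeros. *)
Lemma generically_squarefree P : (1 < size P)%N -> generically_minimal P ->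
  exists2 e : {poly K}, e != 0 & forall z, e.[z] != 0 -> forall w,
    (polyat P z).[w] = 0 -> (polyat P z)^`().[w] != 0.
Proof.
move=> s1 hmin; have P0 : P != 0 by rewrite -size_poly_gt0 (ltn_trans _ s1).
have lead_nat k : (0 < k)%N -> k%:R != 0 :> {poly K}.
  by move=> k0; rewrite -polyC_natr polyC_eq0 pnatr_eq0 -lt0n.
have sP' : size P^`() = (size P).-1.
  apply/eqP; rewrite eqn_leq -ltnS prednK ?lt_size_deriv ?size_poly_gt0 //=.
  rewrite -(subnK s1) addn2 /= ltnNge; apply/negP => h.
  have : (P^`())`_(size P - 2) = 0 by rewrite nth_default.
  rewrite coef_deriv -mulr_natr => /eqP; rewrite mulf_eq0 (negPf (lead_nat _ _)) // orbF.
  have := lead_coef_eq0 P; rewrite lead_coefE -{1}(subnK s1) addn2 /= => ->.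
  by rewrite (negPf P0).
(* [resultant_in_ideal] requires a nonconstant derivative. *)
have [s2|s2] := eqVneq (size P) 2%N.
  have /eqP/size_poly1P[c c0 e] : size P^`() = 1%N by rewrite sP' s2.
  exists c => // z cz w _; rewrite -polyat_deriv e /polyat map_polyC hornerC //.
have s3 : (1 < size P^`())%N by rewrite sP'; case: (size P) s1 s2 => // -[|[]].
have [res0|res0] := eqVneq (resultant P P^`()) 0; last first.
  exists (resultant P P^`()) => // z rz w pw; apply/eqP => pw'.
  have [[u v] _ /= e] := resultant_in_ideal s1 s3.
  have := congr1 (fun Q => (polyat Q z).[w]) e.
  rewrite {1}/polyat map_polyC hornerC /polyat rmorphD !rmorphM /= -!/(polyat _ z).
  rewrite hornerD !hornerM polyat_deriv pw pw' !mulr0 addr0 => e0.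
  by rewrite -horner_evalE e0 eqxx in rz.
move/eqP: res0; rewrite resultant_eq0; set g := gcdp _ _ => sg.
have /Pdiv.Idomain.dvdpP[[c q] /= c0 e] := dvdp_gcdl P P^`().
have /Pdiv.Idomain.dvdpP[[c' p'] /= c'0 e'] := dvdp_gcdr P P^`().
rewrite -/g in e e'.
have q0 : q != 0.
  apply: contraNneq P0 => q0; move: e; rewrite q0 mul0r => /eqP.
  by rewrite scale_poly_eq0 (negPf c0).
have g0 : g != 0 by rewrite -size_poly_gt0 (ltn_trans _ sg).
have lP0 : lead_coef P != 0 by rewrite lead_coef_eq0.
have := hmin q (c * c' * lead_coef P).
rewrite !mulf_neq0 // => /(_ isT q0).
have -> : (size P <= size q)%N = false.
  have := congr1 (fun Q : {poly {poly K}} => size Q) e.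
  rewrite size_scale // size_mul // => es; apply/negP => le.
  by move: sg le; rewrite es; case: (size g) => // k; rewrite addnS /= => ?;
    rewrite -[X in (_ <= X)%N]addn0 leq_add2l leqn0 => /eqP ?; lia.
suff h : forall z, `|z| < 1 -> (c * c' * lead_coef P).[z] != 0 -> forall w, `|w| < 1 ->
  (polyat q z).[w] = 0 <-> (polyat P z).[w] = 0 by move=> /(_ h).
move=> z _; rewrite !hornerM !mulf_eq0 !negb_or => /andP[/andP[cz c'z] lz] w _.
have ez : c.[z] *: polyat P z = polyat q z * polyat g z.
  by rewrite -polyatZ e polyatM.
have ez' : c'.[z] *: (polyat P z)^`() = polyat p' z * polyat g z.
  by rewrite -polyat_deriv -polyatZ e' polyatM.
have Pz0 : polyat P z != 0.
  apply: contraNneq lz => h; rewrite lead_coefE -coef_polyat h coef0 //.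
split; last exact: quotient_gcd_deriv_root ez ez'.
move=> qw; have := congr1 (fun Q : {poly K} => Q.[w]) ez.
rewrite hornerZ hornerM qw mul0r => /eqP; rewrite mulf_eq0 (negPf cz) => /eqP //.
Qed.

End Bounds.

(** * A Liouville principle in the disk *)

Section DiskApproximation.
Variable K : numClosedFieldType.
Hypothesis arch : forall r e : K, 0 <= r -> r < 1 -> 0 < e -> exists M : nat, r ^+ M < e.
Implicit Types (z w a x r e : K) (q : {poly K}) (y : K -> K).

(* Locally uniform limits of polynomials on the open disk: these stand for the
   holomorphic functions there. *)
Definition disk_approx y := forall r e, 0 <= r -> r < 1 -> 0 < e ->
  exists q, forall z, `|z| <= r -> `|y z - q.[z]| <= e.

Lemma disk_approx_ext y y' : (forall z, `|z| < 1 -> y z = y' z) ->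
  disk_approx y -> disk_approx y'.
Proof.
move=> h hy r e r0 r1 e0; have [q hq] := hy r e r0 r1 e0; exists q => z hz.
by rewrite -h ?hq // (le_lt_trans hz).
Qed.

Lemma disk_approx_lim y : (forall r e, 0 <= r -> r < 1 -> 0 < e ->
    exists2 y', disk_approx y' & forall z, `|z| <= r -> `|y z - y' z| <= e) ->
  disk_approx y.
Proof.
move=> h r e r0 r1 e0; have e2 : 0 < e / 2 by rewrite divr_gt0.
have [y' hy' hyy] := h r _ r0 r1 e2; have [q hq] := hy' r _ r0 r1 e2.
exists q => z hz; have -> : y z - q.[z] = (y z - y' z) + (y' z - q.[z]) by ring.
have -> : e = e / 2 + e / 2 by field.
by apply: le_trans (ler_normD _ _) _; rewrite lerD ?hyy ?hq.
Qed.

Lemma disk_approx_poly q : disk_approx (fun z => q.[z]).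
Proof. by move=> r e _ _ e0; exists q => z _; rewrite subrr normr0 ltW. Qed.

Lemma disk_approxD y y' : disk_approx y -> disk_approx y' ->
  disk_approx (fun z => y z + y' z).
Proof.
move=> hy hy' r e r0 r1 e0; have e2 : 0 < e / 2 by rewrite divr_gt0.
have [q hq] := hy r _ r0 r1 e2; have [q' hq'] := hy' r _ r0 r1 e2.
exists (q + q') => z hz; rewrite hornerD.
have -> : y z + y' z - (q.[z] + q'.[z]) = (y z - q.[z]) + (y' z - q'.[z]) by ring.
have -> : e = e / 2 + e / 2 by field.
by apply: le_trans (ler_normD _ _) _; rewrite lerD ?hq ?hq'.
Qed.

Lemma disk_approxM y y' : disk_approx y -> disk_approx y' ->
  disk_approx (fun z => y z * y' z).
Proof.
move=> hy hy' r e r0 r1 e0.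
have [p hp] := hy' r 1 r0 r1 ltr01; have [k1 k10 L1] := lipschitz_ball p r0.
have b1 z : `|z| <= r -> `|y' z| <= k1 + 1.
  move=> hz; have -> : y' z = p.[z] + (y' z - p.[z]) by ring.
  by apply: le_trans (ler_normD _ _) _; rewrite lerD ?hp // (L1 z z hz hz).2.
have k1p : 0 < k1 + 1 by rewrite ltr_wpDl ?ltr01.
have ea : 0 < e / 2 / (k1 + 1) by rewrite !divr_gt0.
have [q hq] := hy r _ r0 r1 ea; have [k2 k20 L2] := lipschitz_ball q r0.
have k2p : 0 < k2 + 1 by rewrite ltr_wpDl ?ltr01.
have eb : 0 < e / 2 / (k2 + 1) by rewrite !divr_gt0.
have [q' hq'] := hy' r _ r0 r1 eb.
exists (q * q') => z hz; rewrite hornerM.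
have -> : y z * y' z - q.[z] * q'.[z] = (y z - q.[z]) * y' z + q.[z] * (y' z - q'.[z]).
  by ring.
have -> : e = e / 2 / (k1 + 1) * (k1 + 1) + (k2 + 1) * (e / 2 / (k2 + 1)).
  by field; rewrite !gt_eqF.
apply: le_trans (ler_normD _ _) _; rewrite !normrM lerD // ler_pM ?hq ?hq' ?b1 //.
by apply: le_trans (L2 z z hz hz).2 _; rewrite lerDl.
Qed.

Lemma disk_approx_sum (I : Type) (s : seq I) (Q : pred I) (f : I -> K -> K) :
  (forall i, disk_approx (f i)) -> disk_approx (fun z => \sum_(i <- s | Q i) f i z).
Proof.
move=> h; elim: s => [|i s IH].
  apply: (disk_approx_ext (y := fun z => (0 : {poly K}).[z])) (disk_approx_poly 0).
  by move=> z _; rewrite big_nil horner0.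
case: (boolP (Q i)) => hi.
  apply: disk_approx_ext (disk_approxD (h i) IH) => z _.
  by rewrite big_cons hi.
by apply: disk_approx_ext IH => z _; rewrite big_cons (negPf hi).
Qed.

Lemma disk_approxX y n : disk_approx y -> disk_approx (fun z => y z ^+ n).
Proof.
move=> h; elim: n => [|n IH].
  apply: (disk_approx_ext (y := fun z => (1 : {poly K}).[z])) (disk_approx_poly 1).
  by move=> z _; rewrite hornerC expr0.
by apply: disk_approx_ext (disk_approxM h IH) => z _; rewrite exprS.
Qed.

Lemma geometric_sum_mul x M : (1 - x) * (\sum_(k < M) x ^+ k) = 1 - x ^+ M.
Proof.
elim: M => [|M IH]; first by rewrite big_ord0 mulr0 expr0 subrr.
by rewrite big_ord_recr /= mulrDr IH exprS; ring.
Qed.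

Lemma geometric_sum_le r M : 0 <= r -> r < 1 -> \sum_(k < M) r ^+ k <= (1 - r)^-1.
Proof.
move=> r0 r1; have d0 : 0 < 1 - r by rewrite subr_gt0.
by rewrite -div1r ler_pdivlMr // mulrC geometric_sum_mul gerBl exprn_ge0.
Qed.

Lemma disk_approx_inv_XsubC a : 1 <= `|a| -> disk_approx (fun z => (z - a)^-1).
Proof.
move=> ha r e r0 r1 e0.
have an0 : a != 0 by rewrite -normr_gt0 (lt_le_trans ltr01).
have d0 : 0 < 1 - r by rewrite subr_gt0.
have [M hM] := arch r0 r1 (mulr_gt0 e0 d0).
exists (\poly_(k < M) (- a^-1 ^+ k.+1)) => z hz; rewrite horner_poly.
have az : `|z / a| <= r.
  by rewrite normf_div ler_pdivrMr ?normr_gt0 // (le_trans hz) // ler_peMr.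
have za : 1 - r <= `|z - a|.
  apply: (@le_trans _ _ (`|a| - `|z|)); first by rewrite lerB.
  by rewrite distrC lerB_dist.
have za0 : z - a != 0 by rewrite -normr_gt0 (lt_le_trans d0).
have -> : (z - a)^-1 - \sum_(k < M) - a^-1 ^+ k.+1 * z ^+ k = (z / a) ^+ M / (z - a).
  have -> : \sum_(k < M) - a^-1 ^+ k.+1 * z ^+ k = - a^-1 * \sum_(k < M) (z / a) ^+ k.
    rewrite mulr_sumr; apply: eq_bigr => k _; rewrite exprS exprMn; ring.
  have := geometric_sum_mul (z / a) M; set S := \sum_(_ < _) _ => eS.
  have -> : (z / a) ^+ M = 1 - (1 - z / a) * S by rewrite eS; ring.
  by field; rewrite za0.
rewrite normf_div normrX ler_pdivrMr ?normr_gt0 //.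
apply: (@le_trans _ _ (r ^+ M)); first by rewrite lerXn2r ?nnegrE.
apply: (@le_trans _ _ (e * (1 - r))); first exact: ltW.
by rewrite ler_pM2l.
Qed.

Lemma disk_approx_inv q : (forall z, `|z| < 1 -> q.[z] != 0) ->
  disk_approx (fun z => q.[z]^-1).
Proof.
move=> hq; have q0 : q != 0.
  by apply: contraTneq (hq 0 _) => [->|]; rewrite ?horner0 ?eqxx // normr0 ltr01.
have [s es _] := poly_prod_XsubC q0.
have hs x : x \in s -> 1 <= `|x|.
  move=> hx; rewrite real_leNgt ?rpred1 ?normr_real //; apply/negP => /hq /negP[].
  by apply/eqP; exact: prod_XsubC_root0 es hx.
apply: (disk_approx_ext (y := fun z =>
    ((lead_coef q)^-1%:P).[z] * \prod_(x <- s) (z - x)^-1)).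
  move=> z _; rewrite hornerC prodfV es hornerZ lead_coefZ (monicP (monic_prod_XsubC _ _ _)) mulr1.
  rewrite invfM horner_prod; congr (_ * _^-1).
  by apply: eq_bigr => x _; rewrite hornerXsubC.
apply: disk_approxM (disk_approx_poly _) _; elim: s hs {es} => [|x s IH] hs.
  apply: (disk_approx_ext (y := fun z => (1 : {poly K}).[z])) (disk_approx_poly 1).
  by move=> z _; rewrite big_nil hornerC.
apply: (disk_approx_ext (y := fun z => (z - x)^-1 * \prod_(x <- s) (z - x)^-1)).
  by move=> z _; rewrite big_cons.
apply: disk_approxM.
  by apply: disk_approx_inv_XsubC; rewrite hs ?mem_head.
by apply: IH => t ht; rewrite hs // inE ht orbT.
Qed.

Lemma primitive_root_exists M : (0 < M)%N -> exists x : K, M.-primitive_root x.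
Proof.
move=> M0; pose p : {poly K} := 'X^M - 1.
have [s Dp] := closed_field_poly_normal p.
rewrite (monicP _) ?monicXnsubC // scale1r in Dp.
have rn1 : all M.-unity_root s by apply/allP => z; rewrite -root_prod_XsubC -Dp.
have sz : (M < (size s).+1)%N by rewrite -(size_prod_XsubC s id) -Dp size_XnsubC.
have [|z] := hasP (has_prim_root M0 rn1 _ sz); last by exists z.
by rewrite -separable_prod_XsubC -Dp separable_Xn_sub_1 // pnatr_eq0 -lt0n.
Qed.

Lemma primitive_root_norm M x : M.-primitive_root x -> `|x| = 1.
Proof.
move=> hx; have M0 := prim_order_gt0 hx; apply/eqP.
by rewrite -(@pexpr_eq1 _ _ M) // -normrX prim_expr_order // normr1.
Qed.

Lemma primitive_root_sum M x j : M.-primitive_root x ->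
  \sum_(i < M) x ^+ (i * j) = if (M %| j)%N then M%:R else 0.
Proof.
move=> hx; rewrite (eq_bigr (fun i : 'I_M => (x ^+ j) ^+ i)); last first.
  by move=> i _; rewrite -exprM mulnC.
case: ifP => hj.
  have -> : x ^+ j = 1 by apply/eqP; rewrite -(prim_order_dvd hx).
  by rewrite (eq_bigr (fun=> 1)) ?sumr_const ?card_ord // => i _; rewrite expr1n.
have xj : 1 - x ^+ j != 0 by rewrite subr_eq0 eq_sym -(prim_order_dvd hx) hj.
apply: (mulfI xj); rewrite geometric_sum_mul mulr0 -exprM mulnC exprM.
by rewrite (prim_expr_order hx) expr1n subrr.
Qed.

(** Cauchy's estimate; the average over the roots of unity of order [size q] extracts a coefficient
    exactly. *)
Lemma coef_le_circle q (c : K) j : (forall z, `|z| = 1 -> `|q.[z]| <= c) -> `|q`_j| <= c.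
Proof.
move=> hq; have [sj|sj] := leqP (size q) j.
  by rewrite nth_default // normr0 (le_trans _ (hq 1 (normr1 _))).
have [x hx] := primitive_root_exists (leq_ltn_trans (leq0n _) sj).
set M := size q in sj hx *; have nx := primitive_root_norm hx.
have M0 : (M%:R : K) != 0 by rewrite pnatr_eq0 -lt0n (leq_ltn_trans _ sj).
have e : M%:R * q`_j = \sum_(i < M) x ^+ (i * (M - j)) * q.[x ^+ i].
  rewrite (eq_bigr (fun i : 'I_M => \sum_(k < M) q`_k * x ^+ (i * (M - j + k)))); last first.
    move=> i _; rewrite horner_coef mulr_sumr; apply: eq_bigr => k _.
    by rewrite mulnDr exprD -exprM; ring.
  rewrite exchange_big /= (bigD1 (Ordinal sj)) //= -mulr_sumr primitive_root_sum //.
  rewrite subnK ?dvdnn ?(ltnW sj) // mulrC big1 ?addr0 // => k hk.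
  rewrite -mulr_sumr primitive_root_sum //; case: ifP; rewrite ?mulr0 //.
  move: hk; rewrite -val_eqE /= => hk h; exfalso.
  have lt1 : (k < M)%N := ltn_ord k.
  move/dvdnP: h => [[|[|t]] ht]; rewrite ?mul0n ?mul1n in ht; first by lia.
    by move/eqP: hk; lia.
  by move: ht; rewrite !mulSn => ht; lia.
have : `|M%:R * q`_j| <= M%:R * c.
  rewrite e (le_trans (ler_norm_sum _ _ _)) // mulr_natl -[X in _ *+ X]card_ord -sumr_const.
  by apply: ler_sum => i _; rewrite normrM normrX nx expr1n mul1r hq // normrX nx expr1n.
by rewrite normrM normr_nat ler_pM2l // ltr0n (leq_ltn_trans _ sj).
Qed.

(** Nodes common to all degrees up to [N] turn pointwise closeness on a disk into closeness at any
    given point, in place of a compactness argument for polynomials of bounded degree. *)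
Lemma lagrange_interpolation N : exists (x : 'I_N.+1 -> K) (L : 'I_N.+1 -> {poly K}),
  [/\ forall j, `|x j| <= 2^-1, forall j, (size (L j) <= N.+1)%N &
    forall q, (size q <= N.+1)%N -> q = \sum_j q.[x j] *: L j].
Proof.
pose x (j : 'I_N.+1) : K := (j.+2)%:R^-1.
have xinj i j : x i = x j -> i = j.
  by move=> /invr_inj /eqP; rewrite eqr_nat !eqSS => /eqP h; apply/val_inj.
pose L0 j := \prod_(i | i != j) ('X - (x i)%:P).
have sL0 j : size (L0 j) = N.+1.
  rewrite /L0 -big_filter size_prod_XsubC size_filter -sum1_count sum1_card.
  by rewrite cardC1 card_ord.
have L0j j : (L0 j).[x j] != 0.
  rewrite horner_prod; apply/prodf_neq0 => i ij; rewrite hornerXsubC subr_eq0.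
  by apply: contraNneq ij => /xinj ->.
have L0i i j : i != j -> (L0 j).[x i] = 0.
  by move=> ij; rewrite horner_prod (bigD1 i) //= hornerXsubC subrr mul0r.
exists x, (fun j => (L0 j).[x j]^-1 *: L0 j); split.
- by move=> j; rewrite normfV normr_nat lef_pV2 ?posrE ?ltr0n // ler_nat.
- by move=> j; rewrite (leq_trans (size_scale_leq _ _)) ?sL0.
move=> q sq; apply/eqP; rewrite -subr_eq0; apply: contraT => d0.
pose s := [seq x j | j <- enum 'I_N.+1].
have us : uniq s by rewrite map_inj_uniq ?enum_uniq.
have rs : all (root (q - \sum_j q.[x j] *: ((L0 j).[x j]^-1 *: L0 j))) s.
  apply/allP => _ /mapP[j _ ->]; rewrite rootE hornerD hornerN horner_sum.
  rewrite (bigD1 j) //= big1 => [|i ij].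
    by rewrite !hornerZ mulVf // mulr1 addr0 subrr.
  by rewrite !hornerZ (L0i j i) 1?eq_sym // !mulr0.
have := max_poly_roots d0 rs us; rewrite size_map size_enum_ord ltnNge => /negP[].
rewrite (leq_trans (size_polyD _ _)) // size_polyN geq_max sq /=.
rewrite (leq_trans (size_sum _ _ _)) //; apply/bigmax_leqP => j _.
by rewrite !(leq_trans (size_scale_leq _ _)) ?sL0.
Qed.

Definition scale_arg r q := \poly_(i < size q) (q`_i * r ^+ i).

Lemma scale_arg_horner r q z : (scale_arg r q).[z] = q.[r * z].
Proof.
by rewrite horner_poly horner_coef; apply: eq_bigr => i _; rewrite exprMn mulrA.
Qed.

Lemma coef_scale_arg r q i : (scale_arg r q)`_i = q`_i * r ^+ i.
Proof. by rewrite coef_poly; case: ltnP => // h; rewrite nth_default // mul0r. Qed.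

(* [z ^+ N * (y' z)^*] has no Fourier modes above [N] on a
   circle, so the high coefficients of a polynomial approximant of [y] are small. *)
Lemma disk_liouville N y y' : disk_approx y -> disk_approx y' ->
  (forall e, 0 < e -> exists r, [/\ 0 <= r, r < 1 &
     forall z, r <= `|z| -> `|z| < 1 -> `|y z - z ^+ N * (y' z)^*| <= e]) ->
  exists2 q : {poly K}, (size q <= N.+1)%N & forall z, `|z| < 1 -> y z = q.[z].
Proof.
move=> hy hy' hb.
have approx rho e : 0 <= rho -> rho < 1 -> 0 < e -> exists2 q : {poly K}, (size q <= N.+1)%N &
    forall z, `|z| <= rho -> `|y z - q.[z]| <= e.
  (* [tau] is the ratio of [rho] to [(1 + rho) / 2 <= r], so [rho <= r tau] and the discarded tail
     is at most [3 d / (1 - tau)]. The value of [d] makes the total at most [e]. *)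
  move=> p0 p1 e0; pose tau := 2 * rho / (1 + rho).
  have rp : 0 < 1 + rho by rewrite ltr_pwDl ?ltr01.
  have tau0 : 0 <= tau by rewrite divr_ge0 ?mulr_ge0 // ltW.
  have tau1 : tau < 1.
    rewrite ltr_pdivrMr // mul1r -subr_gt0.
    by rewrite (_ : _ - _ = 1 - rho) ?subr_gt0 //; ring.
  have dt : 0 < 1 - tau by rewrite subr_gt0.
  pose d := e * (1 - tau) / 4.
  have d0 : 0 < d by rewrite divr_gt0 // mulr_gt0.
  have [r0 [r00 r01 hr0]] := hb d d0.
  pose r := 1 - (1 - r0) * (1 - rho) / 2.
  have a0 : 0 < 1 - r0 by rewrite subr_gt0.
  have a1 : 0 < 1 - rho by rewrite subr_gt0.
  have rr0 : r0 <= r.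
    rewrite -subr_ge0 (_ : r - r0 = (1 - r0) * ((1 + rho) / 2)); last by rewrite /r; field.
    by rewrite mulr_ge0 ?divr_ge0 // ltW.
  have rrho : (1 + rho) / 2 <= r.
    rewrite -subr_ge0 (_ : r - _ = (1 - rho) * (r0 / 2)); last by rewrite /r; field.
    by rewrite mulr_ge0 ?divr_ge0 // ltW.
  have r1 : r < 1 by rewrite gtrDl oppr_lt0 divr_gt0 // mulr_gt0.
  have rpos : 0 < r by rewrite (lt_le_trans _ rrho) // divr_gt0.
  have r_ge0 := ltW rpos.
  have [q hq] := hy r d r_ge0 r1 d0; have [q' hq'] := hy' r d r_ge0 r1 d0.
  pose S := size q'.
  (* The factor [z ^+ S] makes the conjugate part a polynomial, of degree at most [N + S]. For
     [l > N] the coefficient of index [l + S] therefore comes from [q] alone. *)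
  pose h := 'X^S * scale_arg r q - (r ^+ N) *: ('X^N * revp S (scale_arg r q')).
  have sq' : (size (scale_arg r q') <= S.+1)%N by rewrite leqW // size_poly.
  have hh z : `|z| = 1 -> `|h.[z]| <= d + d + d.
    move=> hz; have nrz : `|r * z| = r by rewrite normrM hz mulr1 ger0_norm.
    have -> : h.[z] = z ^+ S * (q.[r * z] - (r * z) ^+ N * (q'.[r * z])^*).
      rewrite /h hornerD hornerN hornerM hornerZ hornerM !hornerXn revp_circle //.
      by rewrite !scale_arg_horner exprMn; ring.
    rewrite normrM normrX hz expr1n mul1r.
    have -> : q.[r * z] - (r * z) ^+ N * (q'.[r * z])^* =
        (y (r * z) - (r * z) ^+ N * (y' (r * z))^*) - (y (r * z) - q.[r * z]) +
        (r * z) ^+ N * (y' (r * z) - q'.[r * z])^*.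
      by rewrite rmorphB /=; ring.
    apply: le_trans (ler_normD _ _) _; apply: lerD.
      apply: le_trans (ler_normB _ _) _; apply: lerD; last by rewrite hq ?nrz.
      by rewrite hr0 ?nrz.
    rewrite normrM normrX nrz norm_conjC -[leRHS]mul1r ler_pM ?exprn_ge0 //.
      by rewrite exprn_ile1 // ltW.
    by rewrite hq' ?nrz.
  have coef_small l : (N < l)%N -> `|q`_l| * r ^+ l <= d + d + d.
    move=> hl; have := coef_le_circle (l + S) hh.
    rewrite coefB coefZ coefXnM coefXnM coef_revp.
    rewrite ltnNge leq_addl /= addnK coef_scale_arg.
    have -> : (l + S < N)%N = false.
      by apply/negbTE; rewrite -leqNgt (leq_trans (ltnW hl)) ?leq_addr.
    have -> : (l + S - N <= S)%N = false.
      by apply/negbTE; rewrite -ltnNge ltn_subRL ltn_add2r.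
    by rewrite mulr0 subr0 normrM normrX (ger0_norm r_ge0).
  exists (\poly_(i < N.+1) q`_i); first exact: size_poly.
  move=> z hz; have hzr : `|z| <= r.
    apply: le_trans hz (le_trans _ rrho); rewrite ler_pdivlMr // mulr2n mulrDr mulr1.
    by rewrite lerD2r ltW.
  have -> : y z - (\poly_(i < N.+1) q`_i).[z] =
     (y z - q.[z]) + (q.[z] - (\poly_(i < N.+1) q`_i).[z]) by ring.
  apply: (@le_trans _ _ (d + (d + d + d) / (1 - tau))); last first.
    have -> : (d + d + d) / (1 - tau) = e * 3 / 4 by rewrite /d; field; rewrite gt_eqF.
    rewrite [leRHS](_ : e = e / 4 + e * 3 / 4); last by field.
    rewrite lerD2r /d ler_pM2r ?invr_gt0 // ler_piMr ?(ltW e0) //.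
    by rewrite gerBl.
  apply: le_trans (ler_normD _ _) _; apply: lerD; first exact: hq.
  set k := size q.
  have -> : q.[z] - (\poly_(i < N.+1) q`_i).[z] =
      \sum_(i < maxn k N.+1) (if (i <= N)%N then 0 else q`_i * z ^+ i).
    rewrite (horner_coef_wide z (leq_maxl k N.+1)).
    rewrite (horner_coef_wide z (leq_trans (size_poly _ _) (leq_maxr k N.+1))).
    rewrite -sumrB; apply: eq_bigr => i _; rewrite coef_poly ltnS.
    by case: ifP => _; rewrite ?subrr // mul0r subr0.
  apply: le_trans (ler_norm_sum _ _ _) _.
  apply: (@le_trans _ _ (\sum_(i < maxn k N.+1) (d + d + d) * tau ^+ i)); last first.
    rewrite -mulr_sumr ler_wpM2l ?geometric_sum_le //.
    by rewrite !addr_ge0 // ltW.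
  apply: ler_sum => i _; case: leqP => hi.
    by rewrite normr0 mulr_ge0 ?exprn_ge0 // !addr_ge0 // ltW.
  apply: (@le_trans _ _ (`|q`_i| * (r * tau) ^+ i)).
    have rt0 : 0 <= r * tau := mulr_ge0 r_ge0 tau0.
    rewrite normrM normrX ler_wpM2l // lerXn2r ?nnegrE //.
    apply: le_trans hz _; apply: (@le_trans _ _ ((1 + rho) / 2 * tau)); last first.
      by rewrite ler_wpM2r.
    by rewrite /tau (_ : _ * _ = rho) //; field; rewrite gt_eqF.
  by rewrite exprMn mulrA ler_wpM2r ?exprn_ge0 // coef_small.
(* The limit is obtained by interpolating [y] itself; an approximant of degree at most [N] is
   interpolated from the same nodes, so the two are close. *)
have [x [L [hx sL hL]]] := lagrange_interpolation N.
exists (\sum_j y (x j) *: L j).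
  rewrite (leq_trans (size_sum _ _ _)) //; apply/bigmax_leqP => j _.
  by rewrite (leq_trans (size_scale_leq _ _)).
move=> z hz; apply/eqP; rewrite -subr_eq0 -normr_eq0.
pose c := 1 + \sum_j `|(L j).[z]|.
have c0 : 0 < c by rewrite ltr_pwDl ?ltr01 ?sumr_ge0.
rewrite eq_le normr_ge0 andbT real_leNgt ?rpred0 ?normr_real //; apply/negP => n0.
set u := `|_| in n0; have e0 : 0 < u / (2 * c) by rewrite divr_gt0 // mulr_gt0.
have rho0 : 0 <= (1 + `|z|) / 2 by rewrite divr_ge0 ?addr_ge0.
have rho1 : (1 + `|z|) / 2 < 1.
  by rewrite ltr_pdivrMr // mul1r (_ : 2 = 1 + 1) ?ltrD2l //; ring.
have [q sq hq] := approx _ _ rho0 rho1 e0.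
have zr : `|z| <= (1 + `|z|) / 2.
  by rewrite ler_pdivlMr // mulr2n mulrDr mulr1 lerD2r ltW.
have xr j : `|x j| <= (1 + `|z|) / 2.
  apply: le_trans (hx j) _; rewrite -[leLHS]mul1r ler_pM2r ?invr_gt0 //.
  by rewrite lerDl.
have : u <= u / (2 * c) * c.
  move: (u / (2 * c)) hq => v hq; rewrite /u horner_sum.
  have -> : y z - \sum_j (y (x j) *: L j).[z] =
      (y z - q.[z]) - \sum_j (y (x j) - q.[x j]) * (L j).[z].
    rewrite [in X in _ = _ - X - _](hL q sq) horner_sum.
    have -> : \sum_j (y (x j) - q.[x j]) * (L j).[z] =
       \sum_j (y (x j) *: L j).[z] - \sum_j (q.[x j] *: L j).[z].
      by rewrite -sumrB; apply: eq_bigr => j _; rewrite !hornerZ; ring.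
    by ring.
  apply: le_trans (ler_normB _ _) _; rewrite /c mulrDr mulr1; apply: lerD; first exact: hq.
  apply: le_trans (ler_norm_sum _ _ _) _; rewrite mulr_sumr; apply: ler_sum => j _.
  by rewrite normrM ler_wpM2r // hq.
have -> : u / (2 * c) * c = u / 2 by field; rewrite gt_eqF.
rewrite ler_pdivlMr // mulr2n mulrDr mulr1 gerDl => h.
by have := lt_le_trans n0 h; rewrite ltxx.
Qed.

End DiskApproximation.

(** * Power sums of the roots in the disk *)

Section RootSums.
Variable K : numClosedFieldType.
Hypothesis arch : forall r e : K, 0 <= r -> r < 1 -> 0 < e -> exists M : nat, r ^+ M < e.
Variables (n m : nat) (P : {poly {poly K}}).
Hypothesis sizeP : (size P <= m.+1)%N.
Hypothesis size_coefP : forall j : nat, (size (P`_j)%R <= n.+1)%N.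
Hypothesis nz_disk_circle : forall z w : K, `|z| < 1 -> `|w| = 1 -> (polyat P z).[w] != 0.
Implicit Types (z w x r e : K).

Definition roots_at z : seq K := sval (closed_field_poly_normal (polyat P z)).

Lemma roots_atE z :
  polyat P z = lead_coef (polyat P z) *: \prod_(x <- roots_at z) ('X - x%:P).
Proof. exact: svalP (closed_field_poly_normal (polyat P z)). Qed.

Lemma polyat_neq0 z : `|z| < 1 -> polyat P z != 0.
Proof.
move=> hz; apply: contraTneq (nz_disk_circle hz (normr1 _)) => ->.
by rewrite horner0 eqxx.
Qed.

Lemma mem_roots_at z x : `|z| < 1 -> (x \in roots_at z) = ((polyat P z).[x] == 0).
Proof.
move=> hz; rewrite -rootE [in RHS]roots_atE rootZ ?lead_coef_eq0 ?polyat_neq0 //.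
by rewrite root_prod_XsubC.
Qed.

Lemma size_roots_at z : `|z| < 1 -> size (polyat P z) = (size (roots_at z)).+1.
Proof.
move=> hz; rewrite {1}roots_atE size_scale ?lead_coef_eq0 ?polyat_neq0 //.
exact: size_prod_XsubC.
Qed.

Lemma size_roots_at_le z : `|z| < 1 -> (size (roots_at z) <= m)%N.
Proof.
by move=> hz; rewrite -ltnS -size_roots_at // (leq_trans _ sizeP) // size_poly.
Qed.

Lemma horner_polyat z w : (polyat P z).[w] = (P.[w%:P]).[z].
Proof. by rewrite -[in LHS](hornerC w z) /polyat horner_map. Qed.

Lemma size_horner_coef w : (size (P.[w%:P]) <= n.+1)%N.
Proof.
rewrite horner_coef (leq_trans (size_sum _ _ _)) //; apply/bigmax_leqP => j _.
by rewrite -polyC_exp mulrC mul_polyC (leq_trans (size_scale_leq _ _)).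
Qed.

(** [disk_lower] in [z], started from [circle_lower] at [z = 0], bounds [|P(z, w)|] below by some
    [c] for [|z| <= r] and [|w| = 1]. The Lipschitz bound then keeps roots at distance [d] from the
    circle, and [rho = 1 / (1 + d)]. *)
Lemma root_annulus r : 0 <= r -> r < 1 -> exists rho : K, [/\ 0 < rho, rho < 1 &
  forall z x, `|z| <= r -> (polyat P z).[x] = 0 -> `|x| <= rho \/ 1 <= rho * `|x|].
Proof.
move=> r0 r1; have d1 : 0 < 1 - r by rewrite subr_gt0.
have h0 : `|0 : K| < 1 by rewrite normr0 ltr01.
have [kap kap0 hkap] := circle_lower (fun w => nz_disk_circle h0 (w := w)).
have [k k0 L] := @lipschitz_ball2 _ P 2 (ler0n _ _).
pose c := kap * (1 - r) ^+ n; have c0 : 0 < c by rewrite mulr_gt0 // exprn_gt0.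
have low z w : `|z| <= r -> `|w| = 1 -> c <= `|(polyat P z).[w]|.
  move=> hz hw; have hz1 : `|z| < 1 by apply: le_lt_trans r1.
  rewrite horner_polyat; apply: le_trans (disk_lower _ (size_horner_coef w) hz1); last first.
    by move=> y hy; rewrite -horner_polyat nz_disk_circle.
  rewrite -horner_polyat ler_pM ?exprn_ge0 ?(ltW kap0) ?(ltW d1) ?hkap //.
  by rewrite lerXn2r ?nnegrE ?lerB // ?subr_ge0 ltW.
have [d [d0 dlt1 kd]] := small_multiplier k0 c0.
have dp : 0 < 1 + d by rewrite ltr_wpDl ?ler01.
have gap z x : `|z| <= r -> (polyat P z).[x] = 0 -> `|x| <= 2 -> d <= `| `|x| - 1|.
  move=> hz hx x2; rewrite real_leNgt ?normr_real ?gtr0_real //; apply/negP => lt.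
  have x0 : x != 0.
    by apply: contraTneq lt => ->; rewrite normr0 sub0r normrN1 lt_gtF.
  have [p1 p2] := circle_projection x0.
  have [|||| h _] := L z z (x / `|x| ) x; rewrite ?p1 ?ler1n //.
  - by apply: le_trans hz _; rewrite (le_trans (ltW r1)) ?ler1n.
  - by apply: le_trans hz _; rewrite (le_trans (ltW r1)) ?ler1n.
  move: h; rewrite hx subr0 subrr normr0 add0r distrC p2 => h.
  have := le_trans (low z _ hz p1) h => h'.
  have : k * `| `|x| - 1| <= k * d by rewrite ler_wpM2l // ltW.
  by move=> /(le_trans h') /le_lt_trans /(_ kd); rewrite ltxx.
exists (1 + d)^-1; split; first by rewrite invr_gt0.
  by rewrite invf_lt1 // ltrDl.
move=> z x hz hx; have [x1|x1] := real_leP (normr_real x) (rpred1 _).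
  left; have x2 : `|x| <= 2 by rewrite (le_trans x1) // ler1n.
  have := gap z x hz hx x2; rewrite distrC ger0_norm ?subr_ge0 // => h.
  rewrite -div1r ler_pdivlMr //.
  have h2 : `|x| <= 1 - d by rewrite lerBrDr -lerBrDl.
  apply: (@le_trans _ _ ((1 - d) * (1 + d))); first by rewrite ler_wpM2r // ltW.
  have -> : (1 - d) * (1 + d) = 1 - d * d by ring.
  by rewrite gerBl mulr_ge0 // ltW.
right; rewrite mulrC ler_pdivlMr // mul1r.
have [x2|x2] := real_leP (normr_real x) (realn K 2).
  have := gap z x hz hx x2; rewrite ger0_norm ?subr_ge0 ?(ltW x1) //.
  by rewrite lerBrDr addrC.
by apply: le_trans (ltW x2); rewrite -[2]/(1 + 1) lerD2l ltW.
Qed.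

(** A discrete Cauchy integral: as [M] grows, [x ^+ l / (1 - x ^+ M)] tends to [x ^+ l] inside the
    circle and to 0 outside, so the average selects the roots in the disk. *)
Lemma root_of_unity_average x M l (u : K) : M.-primitive_root u -> x ^+ M != 1 ->
  (l < M)%N ->
  \sum_(i < M) (u ^+ i) ^+ l.+1 / (u ^+ i - x) = M%:R * (x ^+ l / (1 - x ^+ M)).
Proof.
move=> hu hx lM; have x1 : 1 - x ^+ M != 0 by rewrite subr_eq0 eq_sym.
apply: (mulfI x1); rewrite mulr_sumr.
rewrite (eq_bigr (fun i : 'I_M => \sum_(k < M) x ^+ k * u ^+ (i * (l + (M - k))))).
  rewrite exchange_big /= (bigD1 (Ordinal lM)) //= -mulr_sumr primitive_root_sum //.
  rewrite subnKC ?(ltnW lM) // dvdnn big1 ?addr0; first by field.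
  move=> k hk; rewrite -mulr_sumr primitive_root_sum //; case: ifP; rewrite ?mulr0 //.
  move: hk; rewrite -val_eqE /= => hk h; exfalso.
  have lt1 : (k < M)%N := ltn_ord k.
  move/dvdnP: h => [[|[|t]] ht]; rewrite ?mul0n ?mul1n in ht; first by lia.
    by move/eqP: hk; lia.
  by move: ht; rewrite !mulSn => ht; lia.
move=> i _; set w := u ^+ i.
have wM : w ^+ M = 1 by rewrite -exprM mulnC exprM (prim_expr_order hu) expr1n.
have wx : w - x != 0 by rewrite subr_eq0; apply: contraNneq hx => <-; apply/eqP.
rewrite -{1}wM subrXX; set S := (X in _ * X * _).
have -> : (w - x) * S * (w ^+ l.+1 / (w - x)) = S * w ^+ l.+1 by field.
rewrite mulr_suml; apply: eq_bigr => k _.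
rewrite exprM -/w mulrC mulrA mulrC -exprD; congr (_ * w ^+ _).
by have := ltn_ord k; lia.
Qed.

Lemma log_deriv (q : {poly K}) (s : seq K) c w : q = c *: \prod_(x <- s) ('X - x%:P) ->
  q.[w] != 0 -> q^`().[w] / q.[w] = \sum_(x <- s) (w - x)^-1.
Proof.
move=> eq qw; rewrite eq deriv_prod_XsubC -eq horner_sum mulr_suml.
apply: eq_big_seq => x hx.
have e : q = ('X - x%:P) * (q %/ ('X - x%:P)) by rewrite eq; apply: prod_XsubC_div.
move: qw; rewrite {1 3}e hornerM hornerXsubC mulf_eq0 negb_or => /andP[w0 q0].
by field; rewrite q0 w0.
Qed.

Definition disk_root_sum (g : K -> K -> K) z := \sum_(x <- roots_at z | `|x| < 1) g z x.

(** The argument principle for [w^l P_w / P], with the integral replaced by an average over [M]-th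
    roots of unity [w]. Each summand is a polynomial in [z] over one without zeros in the disk, and
    [root_annulus] makes the error uniform for [|z| <= r]. *)
Lemma disk_approx_power_sum l : disk_approx (disk_root_sum (fun _ x => x ^+ l)).
Proof.
apply: disk_approx_lim => r e r0 r1 e0.
have [rho [p0 p1 hrho]] := root_annulus r0 r1.
pose e' := e / m.+1%:R; have e'0 : 0 < e' by rewrite divr_gt0 // ltr0n.
have d0 : 0 < 1 + e' by rewrite ltr_wpDl ?ler01.
pose eta := e' / (1 + e') / 2.
have eta0 : 0 < eta by rewrite !divr_gt0.
have eta_half : eta <= 2^-1.
  by rewrite /eta -[leRHS]mul1r ler_pM2r ?invr_gt0 // ler_pdivrMr // mul1r lerDr.
have eta_e : 2 * eta <= e'.
  have -> : 2 * eta = e' / (1 + e') by rewrite /eta; field; rewrite gt_eqF.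
  by rewrite ler_pdivrMr // mulrDr mulr1 lerDl mulr_ge0 // ltW.
have [M' hM'] := arch (ltW p0) p1 eta0.
(* The error at a root [x] is of order [|x|^(l + M)] inside and [|x|^-(M - l)] outside; both
   exponents are at least [M']. *)
pose M := (l + M').+1.
have [u hu] := primitive_root_exists K (ltn0Sn (l + M')); rewrite -/M in hu.
have nu := primitive_root_norm hu.
have lM : (l < M)%N by rewrite ltnS leq_addr.
have nui i : `|u ^+ i| = 1 by rewrite normrX nu expr1n.
exists (fun z => \sum_(i < M) ((M%:R^-1 * (u ^+ i) ^+ l.+1) *: P^`().[(u ^+ i)%:P]).[z] *
    (P.[(u ^+ i)%:P]).[z]^-1).
  apply: disk_approx_sum => i; apply: disk_approxM (disk_approx_poly _) _.
  by apply: disk_approx_inv => // z hz; rewrite -horner_polyat nz_disk_circle.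
move=> z hz; have hz1 : `|z| < 1 by apply: le_lt_trans r1.
have xM x : x \in roots_at z -> x ^+ M != 1.
  rewrite mem_roots_at // => /eqP hx; apply: contraTneq isT => /(congr1 Num.norm).
  rewrite normrX normr1 => /eqP; rewrite pexpr_eq1 // => /eqP h.
  by have := nz_disk_circle hz1 h; rewrite hx eqxx.
have M0 : (M%:R : K) != 0 by rewrite pnatr_eq0.
have -> : \sum_(i < M) ((M%:R^-1 * (u ^+ i) ^+ l.+1) *: P^`().[(u ^+ i)%:P]).[z] *
    (P.[(u ^+ i)%:P]).[z]^-1 = \sum_(x <- roots_at z) x ^+ l / (1 - x ^+ M).
  transitivity (\sum_(i < M) \sum_(x <- roots_at z)
      M%:R^-1 * ((u ^+ i) ^+ l.+1 / (u ^+ i - x))).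
    apply: eq_bigr => i _; rewrite hornerZ -mulrA -horner_polyat.
    have -> : P^`().[(u ^+ i)%:P].[z] = (polyat P z)^`().[u ^+ i].
      by rewrite -polyat_deriv -[in RHS](hornerC (u ^+ i) z) /polyat horner_map.
    rewrite (log_deriv (roots_atE z)) ?nz_disk_circle // mulr_sumr.
    by apply: eq_bigr => x _; rewrite mulrA.
  rewrite exchange_big /=; apply: eq_big_seq => x hx.
  by rewrite -mulr_sumr root_of_unity_average ?xM // mulKf.
rewrite /disk_root_sum big_mkcond /= -sumrB.
apply: (@le_trans _ _ (\sum_(x <- roots_at z) e')); last first.
  rewrite big_const_seq count_predT iter_addr addr0 -mulr_natr /e'.
  rewrite mulrAC ler_pdivrMr ?ltr0n // ler_pM2l // ler_nat leqW //.
  exact: size_roots_at_le.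
apply: le_trans (ler_norm_sum _ _ _) _; rewrite big_seq [leRHS]big_seq.
apply: ler_sum => x hx; apply: le_trans eta_e.
have rhoM : rho ^+ M <= eta.
  rewrite /M -addSn addnC exprD; apply: le_trans (ltW hM').
  by rewrite ler_piMr ?exprn_ge0 ?exprn_ile1 // ltW.
have half t : `|t| <= rho -> 2^-1 <= `|1 - t ^+ M|.
  move=> ht; have : `|t ^+ M| <= 2^-1.
    rewrite normrX (le_trans _ eta_half) // (le_trans _ rhoM) //.
    by rewrite lerXn2r ?nnegrE // ltW.
  move=> h; apply: (@le_trans _ _ (1 - `|t ^+ M|)).
    by rewrite [X in X <= _](_ : _ = 1 - 2^-1) ?lerD2l ?lerN2 //; field.
  by rewrite -{1}[1](normr1 K) lerB_dist.
have bound (t c : K) k : `|t| <= rho -> (M' <= k)%N -> `|c| = `|t ^+ k / (1 - t ^+ M)| ->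
    `|c| <= 2 * eta.
  move=> ht hk ->; have h2 := half t ht.
  have h3 : 0 < `|1 - t ^+ M| by rewrite (lt_le_trans _ h2) // invr_gt0.
  rewrite normf_div normrX ler_pdivrMr //.
  apply: (@le_trans _ _ eta).
    apply: le_trans (ltW hM'); apply: (@le_trans _ _ (rho ^+ k)).
      by rewrite lerXn2r ?nnegrE // ltW.
    by rewrite ler_wiXn2l // ltW.
  have -> : 2 * eta * `|1 - t ^+ M| = eta * (2 * `|1 - t ^+ M|) by ring.
  by rewrite ler_peMr ?(ltW eta0) // -[X in X <= _](mulfV (_ : 2 != 0)) ?ler_pM2l ?pnatr_eq0.
have hx0 : (polyat P z).[x] = 0 by apply/eqP; rewrite -mem_roots_at.
have [hxr|hxr] := hrho z x hz hx0.
  rewrite (le_lt_trans hxr p1); apply: (bound x _ (l + M)%N hxr).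
    exact: leq_trans (leq_addl l M') (leq_trans (leqnSn _) (leq_addl l M)).
  rewrite -normrN; congr `|_|; rewrite exprD; field.
  by rewrite subr_eq0 eq_sym xM.
have x0 : x != 0.
  by apply: contraTneq hxr => ->; rewrite normr0 mulr0 lt_geF ?ltr01.
have x1 : (`|x| < 1) = false.
  apply/negP => x1; have := lt_le_trans (mulr_ilt1 _ _ p1 x1) hxr.
  by rewrite (ltW p0) normr_ge0 ltxx => /(_ isT isT).
rewrite x1 sub0r normrN; apply: (bound x^-1 _ (M - l)%N).
- by rewrite normfV -[rho]mulr1 -(@mulfV _ `|x|) ?normr_eq0 // mulrA ler_peMl ?invr_ge0.
- by rewrite /M -addnS addKn.
have -> : x ^+ l / (1 - x ^+ M) = - (x^-1 ^+ (M - l) / (1 - x^-1 ^+ M)).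
  have nx : x ^+ M != 0 by rewrite expf_neq0.
  have h1 : 1 - x ^+ M != 0 by rewrite subr_eq0 eq_sym xM.
  have h2 : x ^+ M - 1 != 0 by rewrite subr_eq0 xM.
  have e2 : x ^+ l = x ^+ M / x ^+ (M - l).
    by rewrite -{1}(subnKC (ltnW lM)) exprD mulfK // expf_neq0.
  rewrite !exprVn e2; field.
  by rewrite ?h1 ?h2 ?nx ?x0 ?expf_neq0.
by rewrite normrN.
Qed.

Lemma disk_approx_root_sum (g : {poly {poly K}}) :
  disk_approx (disk_root_sum (fun z x => (polyat g z).[x])).
Proof.
apply: (disk_approx_ext (y := fun z => \sum_(j < size g)
   (g`_j).[z] * disk_root_sum (fun _ x => x ^+ j) z)); last first.
  apply: disk_approx_sum => j; apply: disk_approxM (disk_approx_poly _) _.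
  exact: disk_approx_power_sum.
move=> z _; rewrite /disk_root_sum.
under eq_bigr do rewrite mulr_sumr.
rewrite exchange_big /=; apply: eq_bigr => x _.
rewrite (horner_coef_wide x (size_poly _ _ : (size (polyat g z) <= size g)%N)).
by apply: eq_bigr => j _; rewrite coef_polyat.
Qed.

End RootSums.

(** * Reflection of the power sums in the circle *)

Section PolynomialPowerSums.
Variable K : numClosedFieldType.
Hypothesis arch : forall r e : K, 0 <= r -> r < 1 -> 0 < e -> exists M : nat, r ^+ M < e.
Variables (n m : nat) (P : {poly {poly K}}).
Hypothesis sizeP : (size P <= m.+1)%N.
Hypothesis size_coefP : forall j : nat, (size (P`_j)%R <= n.+1)%N.
Hypothesis nz_circle_disk : forall z w : K, `|z| = 1 -> `|w| < 1 -> (polyat P z).[w] != 0.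
Hypothesis nz_disk_circle : forall z w : K, `|z| < 1 -> `|w| = 1 -> (polyat P z).[w] != 0.
Implicit Types (z w x r e : K).

Lemma horner_polyat0 z : (polyat P z).[0] = (P`_0).[z].
Proof. by rewrite horner_coef0 coef_polyat. Qed.

(** At the radial projection [u] of [z] the polynomial [P(u, .)] is zero-free in the disk, so
    [disk_lower] bounds [|P(u, x)|] below by a multiple of [(1 - |x|)^m]; at a root [x] for [z] it
    is also at most a multiple of [1 - |z|]. *)
Lemma disk_roots_near_circle e : 0 < e -> e < 1 -> exists r, [/\ 0 < r, r < 1, 1 - r <= e &
  forall z x, r <= `|z| -> `|z| < 1 -> `|x| < 1 -> (polyat P z).[x] = 0 -> 1 - e <= `|x|].
Proof.
move=> e0 e1.
have P0 z : `|z| = 1 -> (P`_0).[z] != 0.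
  by move=> hz; rewrite -horner_polyat0 nz_circle_disk ?normr0 ?ltr01.
have [kap kap0 hkap] := circle_lower P0.
have [k k0 L] := @lipschitz_ball2 _ P 1 ler01.
have c0 : 0 < kap * e ^+ m by rewrite mulr_gt0 // exprn_gt0.
have [d [d0 d1 kd]] := small_multiplier k0 c0.
have de1 : d * e < 1 by rewrite mulr_ilt1 // ltW.
exists (1 - d * e); split.
- by rewrite subr_gt0.
- by rewrite gtrDl oppr_lt0 mulr_gt0.
- by rewrite subKr ger_pMl // ltW.
move=> z x hz z1 x1 hx; rewrite real_leNgt ?rpredB ?rpred1 ?normr_real ?gtr0_real //.
apply/negP => lt.
have z0 : z != 0.
  by apply: contraTneq hz => ->; rewrite normr0 lt_geF // subr_gt0.
have [p1 p2] := circle_projection z0.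
have [|||| h _] := L z (z / `|z|) x x; rewrite ?p1 ?(ltW z1) ?(ltW x1) //.
move: h; rewrite hx sub0r normrN subrr normr0 addr0 p2 distrC [`|1 - _|]ger0_norm ?subr_ge0 ?(ltW z1) //.
have := @disk_lower _ (polyat P (z / `|z|)) m x (fun y hy => nz_circle_disk p1 hy)
  (leq_trans (size_poly _ _) sizeP) x1.
move=> lw h; have {lw h} := le_trans lw h; rewrite horner_polyat0 => h.
have h1 : kap * e ^+ m <= `|(P`_0).[z / `|z|]| * (1 - `|x|) ^+ m.
  rewrite ler_pM ?exprn_ge0 ?hkap ?(ltW kap0) ?(ltW e0) //.
  by rewrite lerXn2r ?nnegrE ?subr_ge0 ?(ltW x1) ?(ltW e0) // lerBrDr -lerBrDl ltW.
have := le_trans h1 h; apply/negP; rewrite lt_geF //; apply: le_lt_trans kd.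
rewrite ler_wpM2l //; apply: (@le_trans _ _ (d * e)); first by rewrite lerBlDr -lerBlDl.
by rewrite ger_pMr // ltW.
Qed.

(** At a root [x] it plays the part of [P_0 / x], but is polynomial in [z] and [x]. *)
Definition root_cofactor : {poly {poly K}} := - drop_poly 1 P.

Lemma root_cofactorE z x : (polyat P z).[x] = 0 -> (P`_0).[z] = x * (polyat root_cofactor z).[x].
Proof.
have e : P = (P`_0)%:P - root_cofactor * 'X.
  rewrite /root_cofactor mulNr opprK -{1}(poly_take_drop 1 P) expr1; congr (_ + _).
  by apply/polyP => -[|i]; rewrite coef_take_poly coefC.
rewrite {1}e /polyat rmorphB rmorphM /= map_polyX map_polyC /= !hornerE => h.
by apply/eqP; rewrite -subr_eq0 [x * _]mulrC; apply/eqP.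
Qed.

Lemma revp_boundary (q : {poly K}) : (size q <= n.+1)%N -> exists2 k : K, 0 <= k &
  forall z, z != 0 -> `|z| < 1 -> `|(revp n q).[z] - z ^+ n * (q.[z])^*| <= k * (1 - `|z|).
Proof.
move=> sq; have [k1 k10 L1] := lipschitz_ball (revp n q) ler01.
have [k2 k20 L2] := lipschitz_ball q ler01.
have [k3 k30 L3] := lipschitz_ball ('X^n : {poly K}) ler01.
exists (k1 + (k3 * k2 + k2)) => [|z z0 z1]; first by rewrite !addr_ge0 // mulr_ge0.
have [p1 p2] := circle_projection z0.
set u := z / `|z| in p1 p2; have u1 : `|u| <= 1 by rewrite p1.
have d1 : `|z - u| = 1 - `|z| by rewrite p2 distrC ger0_norm // subr_ge0 ltW.
have [h1 _] := L1 z u (ltW z1) u1; have [h2 h2'] := L2 z u (ltW z1) u1.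
have [h3 _] := L3 z u (ltW z1) u1; have [_ h4] := L3 u z u1 (ltW z1).
rewrite d1 in h1 h2 h3; rewrite !hornerXn in h3 h4.
have -> : (revp n q).[z] - z ^+ n * (q.[z])^* = ((revp n q).[z] - (revp n q).[u])
    - ((z ^+ n - u ^+ n) * (q.[z])^* + u ^+ n * (q.[z] - q.[u])^*).
  by rewrite (revp_circle sq p1) rmorphB /=; ring.
rewrite [leRHS]mulrDl; apply: le_trans (ler_normB _ _) _; rewrite lerD //.
rewrite [leRHS]mulrDl; apply: le_trans (ler_normD _ _) _; rewrite lerD //.
  by rewrite normrM norm_conjC mulrAC ler_pM.
by rewrite normrM norm_conjC normrX p1 expr1n mul1r.
Qed.

(** Near the circle the reversed [P_0] is close to [z^n] times the conjugate of
    [P_0 = x * root_cofactor], and [|x|] is close to 1. Hence each term [a] is close to [b], the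
    power sum to [z^(n l)] times the conjugate of a root sum of [root_cofactor ^+ l], and
    [disk_liouville] applies. *)
Lemma disk_power_sum_poly l : exists2 q : {poly K}, (size q <= (n * l).+1)%N &
  forall z, `|z| < 1 -> (revp n P`_0).[z] ^+ l * disk_root_sum P (fun _ x => x ^+ l) z = q.[z].
Proof.
have ha := disk_approx_root_sum arch sizeP size_coefP nz_disk_circle.
have hY : disk_approx (fun z => (revp n P`_0).[z] ^+ l * disk_root_sum P (fun _ x => x ^+ l) z).
  apply: disk_approxM.
    by apply: disk_approxX; apply: disk_approx_poly.
  apply: disk_approx_ext (ha ('X^l)) => z _; apply: eq_bigr => x _.
  by rewrite /polyat map_polyXn hornerXn.
have hY' := ha (root_cofactor ^+ l).
apply: (disk_liouville hY hY') => e e0.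
have [k1 k10 L1] := @lipschitz_ball2 _ root_cofactor 1 ler01.
have [k2 k20 L2] := revp_boundary (size_coefP 0).
have [k3 k30 L3] := lipschitz_ball (revp n P`_0) ler01.
have [k4 k40 L4] := lipschitz_ball ('X^l : {poly K}) (addr_ge0 k10 k30).
have C0 : 0 <= m%:R * (k4 * (k2 + 2 * k1)).
  by rewrite !(mulr_ge0, addr_ge0).
have [d [d0 d1 Cd]] := small_multiplier C0 e0.
have [r [r0 r1 rd near]] := disk_roots_near_circle d0 d1.
exists r; split => //; first exact: ltW.
move=> z rz z1; have z0 : z != 0 by rewrite -normr_gt0 (lt_le_trans r0).
rewrite /disk_root_sum mulr_sumr rmorph_sum mulr_sumr -sumrB.
apply: le_trans (ler_norm_sum _ _ _) _; apply: le_trans (ltW Cd); rewrite -mulrA.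
apply: (@le_trans _ _ (\sum_(x <- roots_at P z) k4 * (k2 + 2 * k1) * d)); last first.
  rewrite big_const_seq count_predT iter_addr addr0 -[_ *+ size _]mulr_natl ler_wpM2r //.
    by rewrite !(mulr_ge0, addr_ge0) // ltW.
  by rewrite ler_nat (size_roots_at_le sizeP nz_disk_circle).
rewrite big_mkcond big_seq [leRHS]big_seq; apply: ler_sum => x hx; case: ifP => x1; last first.
  by rewrite !(mulr_ge0, addr_ge0) // ltW.
have hx0 : (polyat P z).[x] = 0 by apply/eqP; rewrite -(mem_roots_at nz_disk_circle).
have xd := near z x rz z1 x1 hx0.
have [_ hb] := L1 z z x x (ltW z1) (ltW z1) (ltW x1) (ltW x1).
set a := (revp n P`_0).[z] * x; set b := z ^+ n * ((polyat root_cofactor z).[x])^*.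
have ab : (revp n P`_0).[z] ^+ l * x ^+ l -
    z ^+ (n * l) * ((polyat (root_cofactor ^+ l) z).[x])^* = a ^+ l - b ^+ l.
  by rewrite /a /b !exprMn exprM /polyat rmorphXn horner_exp rmorphXn.
have hbk : `|b| <= k1.
  rewrite normrM norm_conjC normrX -[leRHS]mul1r ler_pM ?exprn_ge0 // exprn_ile1 // ltW //.
have hak : `|a| <= k3.
  have [_ h] := L3 z z (ltW z1) (ltW z1).
  by rewrite normrM -[leRHS]mulr1 ler_pM // ltW.
have ha2 : `|a| <= k1 + k3 by rewrite (le_trans hak) // lerDr.
have hb2 : `|b| <= k1 + k3 by rewrite (le_trans hbk) // lerDl.
rewrite /= ab; have [h4 _] := L4 a b ha2 hb2.
rewrite !hornerXn in h4; apply: le_trans h4 _.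
rewrite -mulrA ler_wpM2l //.
(* The first term is the error of reflecting [P_0], of order [1 - |z|]; the second measures how far
   [x] is from the circle. *)
have -> : a - b = x * ((revp n P`_0).[z] - z ^+ n * ((P`_0).[z])^*) - b * (1 - `|x| ^+ 2).
  by rewrite (root_cofactorE hx0) rmorphM /= normCK /a /b; ring.
apply: le_trans (ler_normB _ _) _; rewrite mulrDl lerD // normrM.
  apply: (@le_trans _ _ (1 * (k2 * (1 - `|z|)))); first by rewrite ler_pM ?L2 // ltW.
  by rewrite mul1r ler_wpM2l // (le_trans _ rd) // lerB.
rewrite [2 * k1]mulrC -mulrA ler_pM //.
have x2 : 0 <= 1 - `|x| by rewrite subr_ge0 ltW.
have -> : 1 - `|x| ^+ 2 = (1 + `|x|) * (1 - `|x|) by ring.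
have x3 : 0 <= 1 + `|x| by rewrite addr_ge0.
rewrite normrM (ger0_norm x3) (ger0_norm x2) ler_pM //.
  by rewrite -[2]/(1 + 1) lerD2l ltW.
by rewrite lerBlDr -lerBlDl.
Qed.

(** The power sum for [l = 0] counts the roots and is a polynomial of degree 0 in [z]. *)
Lemma disk_root_count : exists k : nat, forall z, `|z| < 1 ->
  size [seq x <- roots_at P z | `|x| < 1] = k.
Proof.
have [q sq hq] := disk_power_sum_poly 0.
exists (size [seq x <- roots_at P 0 | `|x| < 1]) => z hz.
have h0 : `|0 : K| < 1 by rewrite normr0 ltr01.
have e y : `|y| < 1 -> (size [seq x <- roots_at P y | `|x| < 1])%:R = q`_0.
  move=> hy; rewrite muln0 in sq; rewrite [q](size1_polyC sq) coefC eqxx in hq *.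
  have := hq y hy; rewrite hornerC expr0 mul1r /disk_root_sum -big_filter => <-.
  by rewrite big_const_seq count_predT iter_addr addr0.
by apply/eqP; rewrite -(eqr_nat K) !e.
Qed.

End PolynomialPowerSums.

(** * Reflection symmetry of the defining polynomial *)

Section DistinguishedStructure.
Variable K : numClosedFieldType.
Hypothesis arch : forall r e : K, 0 <= r -> r < 1 -> 0 < e -> exists M : nat, r ^+ M < e.
Variables (n m : nat) (P : {poly {poly K}}).
Hypothesis m_gt0 : (0 < m)%N.
Hypothesis sizeP : size P = m.+1.
Hypothesis size_coefP : forall j : nat, (size (P`_j)%R <= n.+1)%N.
Hypothesis size_coefP_max : exists j : nat, size (P`_j)%R = n.+1.
Hypothesis nz_polyat : forall z : K, polyat P z != 0.
Hypothesis nz_circle_disk : forall z w : K, `|z| = 1 -> `|w| < 1 -> (polyat P z).[w] != 0.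
Hypothesis nz_disk_circle : forall z w : K, `|z| < 1 -> `|w| = 1 -> (polyat P z).[w] != 0.
Hypothesis minimalP : generically_minimal P.
Implicit Types (z w x r e : K).

Let sizeP_le : (size P <= m.+1)%N. Proof. by rewrite sizeP. Qed.

Lemma prodr_const_seq (s : seq K) (c : K) : \prod_(x <- s) c = c ^+ size s.
Proof. by rewrite big_const_seq count_predT iter_mulr_1. Qed.

(* Newton sums of the [k] roots in the disk satisfy a linear recurrence whose
   coefficients are polynomials in [z], by Hankel elimination. *)
Lemma disk_root_recurrence k :
  exists F : {poly {poly K}}, [/\ F != 0, (size F <= k.+1)%N &
    forall z (g : {poly K}), `|z| < 1 -> (revp n P`_0).[z] != 0 -> (size g <= k)%N ->
      \sum_(x <- roots_at P z | `|x| < 1) g.[x] * (polyat F z).[x] = 0].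
Proof.
have [q hq] : exists q : nat -> {poly K}, forall l z, `|z| < 1 ->
    (revp n P`_0).[z] ^+ l * disk_root_sum P (fun _ x => x ^+ l) z = (q l).[z].
  have [q hq] := boolp.choice (fun l => let: ex_intro2 q _ h := disk_power_sum_poly arch
    sizeP_le size_coefP nz_circle_disk nz_disk_circle l in ex_intro _ q h).
  by exists q.
(* The Hankel matrix of power sums, each entry brought to the common weight [2 k] in the reversed
   [P_0]. The zero last column makes it singular, and a left null vector provides the coefficients
   of [F]. *)
pose M : 'M[{poly K}]_k.+1 := \matrix_(j, i)
  if (i < k)%N then revp n P`_0 ^+ (k.*2 - (i + j)) * q (i + j)%N else 0.
have /eqP/det0P[v v0 hv] : \det M = 0.
  by rewrite (expand_det_col M ord_max) big1 // => i _; rewrite mxE ltnn mul0r.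
have FE z x : (polyat (\poly_(j < k.+1) v 0 (inord j)) z).[x] =
    \sum_(j < k.+1) (v 0 j).[z] * x ^+ j.
  rewrite (@horner_coef_wide _ k.+1) ?(leq_trans (size_poly _ _)) ?size_poly //.
  by apply: eq_bigr => j _; rewrite coef_polyat coef_poly ltn_ord inord_val.
exists (\poly_(j < k.+1) v 0 (inord j)); split; rewrite ?size_poly //.
  apply: contra v0 => /eqP F0; apply/eqP/rowP => j; rewrite !mxE.
  have := congr1 (fun p : {poly {poly K}} => p`_j) F0.
  by rewrite coef_poly ltn_ord inord_val coef0.
move=> z g hz Rz sg.
have key i : (i < k)%N ->
    \sum_(x <- roots_at P z | `|x| < 1) x ^+ i * \sum_(j < k.+1) (v 0 j).[z] * x ^+ j = 0.
  move=> ik; have ik1 : (i < k.+1)%N := ltnW ik.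
  have /(congr1 (horner^~ z)) := congr1 (fun A : 'rV__ => A 0 (Ordinal ik1)) hv.
  rewrite !mxE hornerC horner_sum => h.
  apply: (mulfI (expf_neq0 k.*2 Rz)); rewrite mulr0 -[RHS]h.
  under eq_bigr do rewrite mulr_sumr.
  rewrite exchange_big mulr_sumr; apply: eq_bigr => j _ /=.
  rewrite !mxE /= ik !hornerM !horner_exp -hq // /disk_root_sum.
  have e : (k.*2 = k.*2 - (i + j) + (i + j))%N.
    have jk : (j <= k)%N := ltn_ord j.
    by rewrite subnK // -addnn leq_add // ltnW.
  rewrite {1}e exprD -!mulrA [RHS]mulrCA; congr (_ * _).
  rewrite [RHS]mulrCA; congr (_ * _); rewrite mulr_sumr; apply: eq_bigr => x _.
  by rewrite exprD; ring.
under eq_bigr => x _ do rewrite FE (horner_coef_wide _ sg) mulr_suml.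
rewrite exchange_big big1 // => i _.
under eq_bigr do rewrite -mulrA.
by rewrite -mulr_sumr key ?mulr0.
Qed.

Lemma roots_at_uniq z : (forall w, (polyat P z).[w] = 0 -> (polyat P z)^`().[w] != 0) ->
  uniq (roots_at P z).
Proof.
move=> h; have l0 : lead_coef (polyat P z) != 0 by rewrite lead_coef_eq0.
rewrite -separable_prod_XsubC separable_poly.unlock -(coprimepZl _ _ l0) -(coprimepZr _ _ l0).
rewrite -derivZ -roots_atE; apply/Pdiv.ClosedField.root_coprimep => w /rootP.
exact: h.
Qed.

(** For generic [z] the [k] roots in the disk are distinct, so [F], of degree at most [k] and
    vanishing at all of them, has no further zeros; minimality compares its degree with [m]. *)
Lemma disk_root_count_ge k : (forall z, `|z| < 1 ->
  size [seq x <- roots_at P z | `|x| < 1] = k) -> (m <= k)%N.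
Proof.
move=> hk; have [F [F0 sF hF]] := disk_root_recurrence k.
have s1 : (1 < size P)%N by rewrite sizeP.
have [e e0 he] := generically_squarefree s1 minimalP.
have R0 : revp n P`_0 != 0.
  rewrite revp_eq0 //; apply: contraTneq (nz_circle_disk (normr1 K) (w := 0) _) => [h|].
    by rewrite horner_polyat0 h horner0 eqxx.
  by rewrite normr0 ltr01.
rewrite -ltnS -sizeP; apply: (leq_trans _ sF).
apply: (minimalP (e := e * revp n P`_0 * lead_coef F)) => //.
  by rewrite !mulf_neq0 // lead_coef_eq0.
move=> z hz; rewrite !hornerM !mulf_eq0 !negb_or => /andP[/andP[ez Rz] lz].
have Fz : polyat F z != 0.
  apply: contraNneq lz => /(congr1 (fun p : {poly K} => p`_(size F).-1)).
  by rewrite coef_polyat coef0 => /eqP.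
have sFz : (size (polyat F z) <= k.+1)%N := leq_trans (size_poly _ _) sF.
set r := [seq x <- roots_at P z | `|x| < 1].
have ur : uniq r by rewrite filter_uniq // roots_at_uniq //; apply: he.
have rP w : w \in r = (`|w| < 1) && ((polyat P z).[w] == 0).
  by rewrite mem_filter (mem_roots_at nz_disk_circle).
have rF : all (root (polyat F z)) r.
  apply/allP => w hw; rewrite /root.
  (* Testing with the product over the other roots isolates the term at [w]. *)
  have sg : (size (\prod_(x <- rem w r) ('X - x%:P))%R <= k)%N.
    by rewrite size_prod_XsubC size_rem // -/r hk // prednK // -(hk z hz) -/r; case: (r) hw.
  have := hF z _ hz Rz sg; rewrite -(big_filter (roots_at P z) (fun x => `|x| < 1)) -/r.
  rewrite (big_rem w hw) /=.
  rewrite [X in _ + X]big1_seq ?addr0.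
    move/eqP; rewrite mulf_eq0 => /orP[|//].
    move=> h; have : root (\prod_(x <- rem w r) ('X - x%:P)) w := h.
    by rewrite root_prod_XsubC mem_rem_uniq // !inE eqxx.
  move=> x /andP[_ xr]; suff /rootP-> : root (\prod_(x <- rem w r) ('X - x%:P)) x by rewrite mul0r.
  by rewrite root_prod_XsubC.
move=> w w1; split=> [Fw|Pw]; last first.
  by apply/rootP/(allP rF); rewrite rP w1 Pw eqxx.
apply/eqP; apply: contraT => Pw.
have wr : w \notin r by rewrite rP negb_and Pw orbT.
have := @max_poly_roots _ (polyat F z) (w :: r) Fz; rewrite /= wr ur rF andbT.
by rewrite (hk z hz) => /(_ (introT rootP Fw) isT) /leq_trans /(_ sFz); rewrite ltnn.
Qed.

Lemma disk_roots z : `|z| < 1 -> (P`_m).[z] != 0 /\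
  exists s : seq K, [/\ polyat P z = (P`_m).[z] *: \prod_(x <- s) ('X - x%:P), size s = m &
    forall x, x \in s -> `|x| < 1].
Proof.
move=> hz; have [k hk] := disk_root_count arch sizeP_le size_coefP nz_circle_disk nz_disk_circle.
have mk := disk_root_count_ge hk; have kz := hk z hz.
have sm := size_roots_at_le sizeP_le nz_disk_circle hz.
have ks : (k <= size (roots_at P z))%N by rewrite -kz size_filter count_size.
have sr : size (roots_at P z) = m by apply/eqP; rewrite eqn_leq sm (leq_trans mk ks).
have lc : lead_coef (polyat P z) = (P`_m).[z].
  by rewrite lead_coefE (size_roots_at nz_disk_circle hz) sr coef_polyat.
split; first by rewrite -lc lead_coef_eq0.
exists (roots_at P z); split; rewrite -?lc //; first exact: roots_atE.
suff /all_filterP <- : all (fun x => `|x| < 1) (roots_at P z).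
  by move=> x; rewrite mem_filter => /andP[].
rewrite all_count eqn_leq count_size -size_filter kz sr; exact: mk.
Qed.

Lemma disk_coef_le z j : `|z| < 1 -> `|(P`_j).[z]| <= 2 ^+ m * `|(P`_m).[z]|.
Proof.
move=> hz; have [_ [s [e ss hs]]] := disk_roots hz.
rewrite -coef_polyat e coefZ normrM mulrC ler_wpM2r //.
apply: coef_le_circle => w hw; rewrite horner_prod normr_prod.
rewrite -ss -prodr_const_seq big_seq [leRHS]big_seq ler_prod // => x hx.
rewrite normr_ge0 hornerXsubC; apply: le_trans (ler_normB _ _) _.
by rewrite hw -[2]/(1 + 1) lerD2l ltW ?hs.
Qed.

(** With all roots in the disk, every coefficient is bounded by [2 ^+ m] times the leading one. A
    zero of [P_m] on the circle would pass radially to [P_0], giving the forbidden root [w = 0]. *)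
Lemma lead_neq0 z : `|z| <= 1 -> (P`_m).[z] != 0.
Proof.
rewrite le_eqVlt => /orP[/eqP hz|/disk_roots[]//].
apply/negP => /eqP hm; have h0 : `|0 : K| < 1 by rewrite normr0 ltr01.
have := nz_circle_disk hz h0; rewrite horner_polyat0 -normr_le0.
have [k k0 L] := lipschitz_ball P`_0 ler01; have [k' k'0 L'] := lipschitz_ball P`_m ler01.
apply/negP/negPn; apply: (@le0_radial _ _ (k + 2 ^+ m * k')); rewrite ?normr_real //.
  by rewrite addr_ge0 ?mulr_ge0 ?exprn_ge0.
move=> r r0 r1; have hr : `|r * z| = r by rewrite normrM hz mulr1 ger0_norm.
have hd : `|z - r * z| = 1 - r.
  by rewrite -{1}[z]mul1r -mulrBl normrM hz mulr1 ger0_norm // subr_ge0 ltW.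
have z1 : `|z| <= 1 by rewrite hz.
have rz1 : `|r * z| <= 1 by rewrite hr ltW.
have [h _] := L z (r * z) z1 rz1; have [h' _] := L' z (r * z) z1 rz1.
rewrite hm sub0r normrN !hd in h h'.
rewrite -[(P`_0).[z]](subrK (P`_0).[r * z]) mulrDl; apply: le_trans (ler_normD _ _) _.
rewrite lerD //; apply: le_trans (disk_coef_le _ _) _; first by rewrite hr.
by rewrite -mulrA ler_wpM2l ?exprn_ge0.
Qed.

(** For [|w| > 1] and [r < 1] all roots over [r z] lie in the disk, so [|P(r z, w)|] is at least
    [|P_m(r z)| (|w| - 1)^m]; letting [r] tend to 1 contradicts [lead_neq0]. *)
Lemma circle_roots_circle z w : `|z| = 1 -> (polyat P z).[w] = 0 -> `|w| = 1.
Proof.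
move=> hz hw; have [w1|w1|//] := real_ltgtP (normr_real w) (rpred1 _).
  by have := nz_circle_disk hz w1; rewrite hw eqxx.
have z1 : `|z| <= 1 by rewrite hz.
have [k k0 L] := @lipschitz_ball2 _ P `|w| (normr_ge0 _).
have [k' k'0 L'] := lipschitz_ball P`_m ler01.
have w10 : 0 < `|w| - 1 by rewrite subr_gt0.
have := lead_neq0 z1; rewrite -normr_eq0.
suff : `|(P`_m).[z]| * (`|w| - 1) ^+ m <= 0.
  by rewrite pmulr_lle0 ?exprn_gt0 // normr_le0 normr_eq0 => ->.
apply: (@le0_radial _ _ (k' * (`|w| - 1) ^+ m + k)).
- by rewrite realM ?normr_real ?rpredX ?gtr0_real.
- by rewrite addr_ge0 ?mulr_ge0 ?exprn_ge0 ?(ltW w10).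
move=> r r0 r1; have hr : `|r * z| = r by rewrite normrM hz mulr1 ger0_norm.
have hd : `|z - r * z| = 1 - r.
  by rewrite -{1}[z]mul1r -mulrBl normrM hz mulr1 ger0_norm // subr_ge0 ltW.
have rz1 : `|r * z| <= 1 by rewrite hr ltW.
have [h' _] := L' z (r * z) z1 rz1.
have [|||| h _] := L (r * z) z w w => //; rewrite ?hz ?(le_trans rz1) ?(ltW w1) //.
rewrite hw subr0 subrr normr0 addr0 distrC !hd in h h'.
have [|_ [s [e ss hs]]] := @disk_roots (r * z); first by rewrite hr.
have lw : `|(P`_m).[r * z]| * (`|w| - 1) ^+ m <= k * (1 - r).
  apply: le_trans h; rewrite e hornerZ normrM ler_wpM2l // horner_prod normr_prod.
  rewrite -ss -prodr_const_seq big_seq [leRHS]big_seq ler_prod // => x hx.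
  rewrite (ltW w10) hornerXsubC /=; apply: le_trans (lerB_dist _ _).
  by rewrite lerD2l lerN2 ltW ?hs.
rewrite -[(P`_m).[z]](subrK (P`_m).[r * z]) mulrDl.
apply: (@le_trans _ _ ((k' * (1 - r) + `|(P`_m).[r * z]|) * (`|w| - 1) ^+ m)).
  rewrite ler_wpM2r ?exprn_ge0 ?(ltW w10) //; apply: le_trans (ler_normD _ _) _.
  by rewrite lerD2r.
by rewrite [leLHS]mulrDl lerD // mulrAC.
Qed.

Lemma revp_prod_circle (s : seq K) (c : K) : (forall x, x \in s -> `|x| = 1) ->
  let p := c *: \prod_(x <- s) ('X - x%:P) in c *: revp (size s) p = (p`_0)^* *: p.
Proof.
move=> hs p; have sp : (size p <= (size s).+1)%N.
  by rewrite (leq_trans (size_scale_leq _ _)) // size_prod_XsubC.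
apply: eq_on_circle => w hw; rewrite !hornerZ revp_circle // -horner_coef0.
rewrite !hornerZ !horner_prod !rmorphM /= !rmorph_prod.
have -> : w ^+ size s * (c^* * \prod_(x <- s) (('X - x%:P).[w])^*) =
    c^* * \prod_(x <- s) (w * (('X - x%:P).[w])^*).
  by rewrite big_split /= prodr_const_seq mulrCA.
rewrite mulrCA -[RHS]mulrA; congr (_ * _); rewrite mulrCA; congr (_ * _).
rewrite -big_split /= big_seq [RHS]big_seq; apply: eq_bigr => x hx.
rewrite !hornerXsubC sub0r rmorphB rmorphN /= (conj_circle hw) (conj_circle (hs x hx)).
by field; rewrite (circle_neq0 hw) (circle_neq0 (hs x hx)).
Qed.

Lemma coef_reflection j : (j <= m)%N ->
  revp n P`_(m - j) * P`_m = revp n P`_0 * P`_j.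
Proof.
move=> jm; apply: eq_on_circle => z hz; rewrite !hornerM !revp_circle //.
have z1 : `|z| <= 1 by rewrite hz.
have l0 := lead_neq0 z1.
have sz : size (polyat P z) = m.+1.
  apply/eqP; rewrite eqn_leq -{1}sizeP size_poly ltnNge; apply: contra l0 => h.
  by rewrite -coef_polyat nth_default.
have lc : lead_coef (polyat P z) = (P`_m).[z] by rewrite lead_coefE sz coef_polyat.
have [s es ss] := poly_prod_XsubC (nz_polyat z); rewrite lc in es.
have hs x : x \in s -> `|x| = 1.
  by move=> hx; apply: (circle_roots_circle hz); apply: prod_XsubC_root0 es hx.
have ssm : size s = m by apply/eqP; rewrite -eqSS -ss sz.
have := congr1 (fun p : {poly K} => p`_j) (revp_prod_circle (P`_m).[z] hs).
rewrite /= -es ssm !coefZ coef_revp jm !coef_polyat => e.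
by rewrite -mulrA [_^* * _]mulrC e mulrA.
Qed.

(** By [coef_reflection], what remains of [P_m] after cancelling its gcd with the reversed [P_0]
    divides every coefficient of [P]; a root of it would be a vertical line. The quotient is then
    constant, by comparing degrees at a coefficient of degree exactly [n]. *)
Lemma lead_reflection : exists2 c : K, c != 0 & revp n P`_0 = c *: P`_m.
Proof.
have l0 : P`_m != 0 by have := lead_coef_eq0 P; rewrite lead_coefE sizeP -size_poly_eq0 sizeP => ->.
have R0 : revp n P`_0 != 0.
  rewrite revp_eq0 //; apply: contraTneq (nz_circle_disk (normr1 K) (w := 0) _) => [h|].
    by rewrite horner_polyat0 h horner0 eqxx.
  by rewrite normr0 ltr01.
have dv : P`_m %| revp n P`_0.
  set A := P`_m in l0 *; set B := revp n P`_0 in R0 *; pose g := gcdp A B.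
  have eA : A = (A %/ g) * g by rewrite divpK // dvdp_gcdl.
  have eB : B = (B %/ g) * g by rewrite divpK // dvdp_gcdr.
  have g0 : g != 0 by rewrite gcdp_eq0 negb_and l0.
  have cop : coprimep (A %/ g) (B %/ g) by rewrite coprimep_div_gcd // l0.
  have dA j : (j <= m)%N -> A %/ g %| P`_j.
    move=> jm; rewrite -(Gauss_dvdpr _ cop).
    suff -> : B %/ g * P`_j = revp n P`_(m - j) * (A %/ g) by rewrite dvdp_mull.
    by apply: (mulIf g0); rewrite mulrAC -eB -mulrA -eA coef_reflection.
  have : size (A %/ g) == 1%N.
    rewrite -[_ == _]negbK; apply/negP => /closed_rootP[a ra].
    have /negP := nz_polyat a; apply; apply/eqP/polyP => j; rewrite coef_polyat coef0.
    have [jm|mj] := leqP j m; last by rewrite nth_default ?horner0 // sizeP.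
    by have [u ->] := dvdpP _ _ (dA j jm); rewrite hornerM (rootP ra) mulr0.
  rewrite size_poly_eq1 => /eqp_dvdl h.
  by rewrite eA eB dvdp_mul // h dvd1p.
have [e he] := dvdpP _ _ dv.
have e0 : e != 0 by apply: contraNneq R0 => e0; rewrite he e0 mul0r.
have [j0 hj0] := size_coefP_max.
have jm : (j0 <= m)%N.
  rewrite -ltnS -sizeP ltnNge; apply/negP => /(nth_default 0) h.
  by rewrite h size_poly0 in hj0.
have := coef_reflection jm; rewrite he mulrAC => /(mulIf l0) h.
have p0 : P`_j0 != 0 by rewrite -size_poly_eq0 hj0.
have se : (size e <= 1)%N.
  have := size_revp n P`_(m - j0); rewrite h size_mul // hj0 addnS /=.
  by rewrite -[n.+1]add1n leq_add2r.
exists e`_0; last by rewrite {1}(size1_polyC se) mul_polyC.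
by apply: contraNneq e0 => h0; rewrite (size1_polyC se) h0.
Qed.

(** The reversed [P_0] is a multiple of [P_m]. Its nonvanishing at 0 gives degree exactly [n], and
    on the closed disk it keeps the roots of [P_0] from lying outside. *)
Lemma coef0_roots : exists c s, [/\ c != 0, P`_0 = c *: \prod_(a <- s) ('X - a%:P),
  size s = n & forall a, a \in s -> `|a| < 1].
Proof.
have [c c0 hc] := lead_reflection.
have h0 : `|0 : K| <= 1 by rewrite normr0 ler01.
have sP0 : size P`_0 = n.+1.
  apply/eqP; rewrite eqn_leq size_coefP ltnNge; apply/negP => h.
  have := congr1 (fun p : {poly K} => p`_0) hc.
  rewrite coef_revp subn0 nth_default // rmorph0 coefZ => /esym/eqP.
  by rewrite mulf_eq0 (negPf c0) -horner_coef0 (negPf (lead_neq0 h0)).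
have P00 : P`_0 != 0 by rewrite -size_poly_eq0 sP0.
have [s es ss] := poly_prod_XsubC P00.
exists (lead_coef P`_0), s; split=> //; first by rewrite lead_coef_eq0.
  by apply/eqP; rewrite -eqSS -ss sP0.
move=> a ha; have ra : (P`_0).[a] = 0 by apply: prod_XsubC_root0 es ha.
have [//|a1|a1] := real_ltgtP (normr_real a) (rpred1 _).
  have a0 : a != 0 by rewrite -normr_gt0 (lt_trans ltr01).
  have b1 : `|(a^*)^-1| <= 1 by rewrite normfV norm_conjC invf_le1 ?ltW // (lt_trans ltr01).
  have := congr1 (horner^~ (a^*)^-1) hc.
  have eb : ((a^*^-1)^*)^-1 = a by rewrite fmorphV /= conjCK invrK.
  rewrite revp_horner ?invr_eq0 ?conjC_eq0 // eb ra rmorph0 mulr0 hornerZ.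
  by move/esym/eqP; rewrite mulf_eq0 (negPf c0) (negPf (lead_neq0 b1)).
have := nz_circle_disk a1 (w := 0); rewrite normr0 ltr01 horner_polyat0 ra eqxx.
by move=> /(_ isT).
Qed.

End DistinguishedStructure.

(** * The determinantal representation *)

Section DeterminantalForm.
Variable K : numClosedFieldType.
Implicit Types (z w : K).

Lemma eq_on_disk (q h : {poly K}) : (forall z, `|z| < 1 -> q.[z] = h.[z]) -> q = h.
Proof.
move=> e; have h2 : (2^-1 : K) != 0 by rewrite invr_eq0 pnatr_eq0.
have /polyP E : scale_arg 2^-1 (q - h) = 0.
  apply: eq0_on_circle => z hz; rewrite scale_arg_horner !hornerE e ?subrr //.
  by rewrite normrM hz mulr1 normfV normr_nat invf_lt1 ?ltr1n.
apply/eqP; rewrite -subr_eq0; apply/eqP/polyP => i; have := E i.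
by rewrite coef_scale_arg coef0 => /eqP; rewrite mulf_eq0 expf_eq0 (negPf h2) andbF orbF => /eqP.
Qed.

Lemma det_colligation_pencil m n (A : 'M[K]_m) (B : 'M_(m, n)) (C : 'M_(n, m)) (D : 'M_n) z w :
  1%:M - z *: D \in unitmx ->
  \det (block_mx (A - w%:M) (z *: B) C (z *: D - 1%:M)) =
  (-1) ^+ (m + n) * (\det (1%:M - z *: D) * \det (w%:M - transfer_fun A B C D z)).
Proof.
move=> hE; set E := 1%:M - z *: D in hE *; set G := invmx E *m C.
have detN k (M : 'M[K]_k) : \det (- M) = (-1) ^+ k * \det M by rewrite -scaleN1r detZ.
have e : block_mx (A - w%:M) (z *: B) C (z *: D - 1%:M) *m block_mx 1%:M 0 G 1%:M =
    block_mx (- (w%:M - transfer_fun A B C D z)) (z *: B) 0 (- E).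
  rewrite mulmx_block !mulmx1 !mulmx0 !add0r; congr block_mx; last by rewrite opprB.
    by rewrite opprB /transfer_fun -/E /G -scalemxAl mulmxA addrAC.
  by rewrite -opprB -/E mulNmx /G mulKVmx // subrr.
have := congr1 determinant e; rewrite det_mulmx det_lblock !det1 !mulr1 => ->.
by rewrite det_ublock !detN exprD -!mulrA; congr (_ * _); rewrite mulrCA [_ * \det E]mulrC.
Qed.

Lemma revp_prod_XsubC (s : seq K) (c : K) :
  revp (size s) (c *: \prod_(a <- s) ('X - a%:P)) = c^* *: \prod_(a <- s) (1 - a^* *: 'X).
Proof.
apply: eq_on_circle => z hz; rewrite revp_circle //; last first.
  by rewrite (leq_trans (size_scale_leq _ _)) // size_prod_XsubC.
rewrite !hornerZ !horner_prod rmorphM rmorph_prod mulrCA; congr (_ * _).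
rewrite -prodr_const_seq -big_split; apply: eq_bigr => a _ /=.
rewrite !hornerE rmorphB /= (conj_circle hz); field.
exact: circle_neq0.
Qed.

Lemma det_sqr_dvd m (T : 'M[{poly K}]_m) (i j : 'I_m) z : i != j ->
  (forall k, (T i k).[z] = 0) -> (forall k, (T j k).[z] = 0) ->
  ('X - z%:P) ^+ 2 %| \det T.
Proof.
move=> ij hi hj; set b := 'X - z%:P.
pose d : 'rV[{poly K}]_m := \row_k if (k == i) || (k == j) then b else 1.
pose T' : 'M_m := \matrix_(k, l) if (k == i) || (k == j) then T k l %/ b else T k l.
have -> : T = diag_mx d *m T'.
  apply/matrixP => k l; rewrite mul_diag_mx !mxE; case: ifP => [h|]; last by rewrite mul1r.
  rewrite mulrC divpK // dvdp_XsubCl; apply/rootP.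
  by case/orP: h => /eqP->.
rewrite det_mulmx det_diag dvdp_mulr // (bigD1 i) //= (bigD1 j) /=; last by rewrite eq_sym.
by rewrite !mxE !eqxx orbT mulrA dvdp_mulr.
Qed.

Lemma sqr_dvd_deriv (q : {poly K}) z : ('X - z%:P) ^+ 2 %| q -> q^`().[z] = 0.
Proof.
move=> /dvdpP[r ->]; rewrite derivM deriv_exp derivXsubC mul1r expr1
    !(hornerXsubC, hornerD, hornerM, hornerMn, horner_exp) subrr.
by ring. Qed.

Lemma unitary_diagonalization m (F : 'M[K]_m) : F \is unitarymx ->
  exists (U : 'M[K]_m) (d : 'rV_m), U \in unitmx /\ U *m F = diag_mx d *m U.
Proof.
move=> hF; have nF : F \is normalmx.
  apply/normalmxP; have /unitarymxP e := hF; rewrite e.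
  by rewrite (mulmx1C e).
exists (spectralmx F), (spectral_diag F); split; first exact: spectral_unit.
by have /orthomx_spectralP e := nF; rewrite {2}e -mulmxA mulKVmx ?spectral_unit.
Qed.

Section Existence.
Hypothesis arch : forall r e : K, 0 <= r -> r < 1 -> 0 < e -> exists M : nat, r ^+ M < e.
Variables (n m : nat) (P : {poly {poly K}}).
Hypothesis m_gt0 : (0 < m)%N.
Hypothesis sizeP : size P = m.+1.
Hypothesis size_coefP : forall j : nat, (size (P`_j)%R <= n.+1)%N.
Hypothesis size_coefP_max : exists j : nat, size (P`_j)%R = n.+1.
Hypothesis nz_polyat : forall z : K, polyat P z != 0.
Hypothesis nz_circle_disk : forall z w : K, `|z| = 1 -> `|w| < 1 -> (polyat P z).[w] != 0.
Hypothesis nz_disk_circle : forall z w : K, `|z| < 1 -> `|w| = 1 -> (polyat P z).[w] != 0.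
Hypothesis minimalP : generically_minimal P.

Definition smooth_on_torus := forall z w, `|z| = 1 -> `|w| = 1 -> (polyat P z).[w] = 0 ->
  (polyat P z)^`().[w] = 0 -> (P.[w%:P])^`().[z] = 0 -> False.

Theorem determinantal_form :
  exists (A : 'M[K]_m) (B : 'M_(m, n)) (C : 'M_(n, m)) (D : 'M_n) (Q : 'M[{poly K}]_m) (c : K),
  [/\ block_mx A B C D \is unitarymx, forall i j, (size (Q i j) <= n.+1)%N,
      forall z, `|z| <= 1 -> 1%:M - z *: D \in unitmx &
      forall z w, (polyat P z).[w] = c * \det (block_mx (A - w%:M) (z *: B) C (z *: D - 1%:M))] /\
  [/\ forall z w, `|z| < 1 -> (polyat P z).[w] = 0 <->
        \det (w%:M - transfer_fun A B C D z) = 0,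
      forall z, `|z| < 1 -> \det Q.@[z] != 0,
      forall z w, `|z| < 1 -> (polyat P z).[w] = 0 ->
        transfer_fun A B C D z *m (Q.@[z] *m \col_j w ^+ j) = w *: (Q.@[z] *m \col_j w ^+ j) &
      smooth_on_torus -> forall z, `|z| = 1 -> \det Q.@[z] != 0].
Proof.
have leadP := lead_neq0 arch m_gt0 sizeP size_coefP nz_polyat nz_circle_disk nz_disk_circle minimalP.
have rootsP :=
  circle_roots_circle arch m_gt0 sizeP size_coefP nz_polyat nz_circle_disk nz_disk_circle minimalP.
have [c [s [c0 cE hn hs]]] := coef0_roots arch m_gt0 sizeP size_coefP size_coefP_max
  nz_polyat nz_circle_disk nz_disk_circle minimalP.
have [e e0 he] := lead_reflection arch m_gt0 sizeP size_coefP size_coefP_max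
  nz_polyat nz_circle_disk nz_disk_circle minimalP.
have simple : exists2 z, `|z| = 1 &
     forall w, (polyat P z).[w] = 0 -> (polyat P z)^`().[w] != 0.
  have [|q q0 hq] := generically_squarefree _ minimalP; first by rewrite sizeP.
  by have [z hz qz] := circle_nonroot q0; exists z => //; apply: hq.
have [A [B [C [D [Q [[hU hdet sQ] [hQ hQQ hT]]]]]]] :=
  inner_realization m_gt0 sizeP size_coefP leadP rootsP cE hs c0 simple.
(* Reversing [P_0] gives both [e P_m] and [c^*] times the product that equals [det (1 - z D)]. *)
pose b := e / c^*; have b0 : b != 0 by rewrite mulf_neq0 ?invr_eq0 ?conjC_eq0.
have hpi z : \det (1%:M - z *: D) = b * (P`_m).[z].
  have := congr1 (horner^~ z) he; rewrite -{1}hn cE revp_prod_XsubC !hornerZ => E.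
  have c'0 : c^* != 0 by rewrite conjC_eq0.
  rewrite hdet /b mulrAC -E mulrC mulKf // horner_prod; apply: eq_bigr => a _.
  by rewrite !hornerE.
have unitD z : `|z| <= 1 -> 1%:M - z *: D \in unitmx.
  by move=> hz; rewrite unitmxE unitfE hpi mulf_neq0 ?leadP.
have hchar z w : `|z| < 1 -> \det (w%:M - transfer_fun A B C D z) = ((P`_m).[z])^-1 * (polyat P z).[w].
  move=> hz; have hz1 := ltW hz.
  have := congr1 determinant (congr1 (fun M => w *: Q.@[z] - M) (hT z hz)).
  rewrite -{1}mul_scalar_mx -mulmxBl -(mul_mx_scalar w Q.@[z]) -mulmxBr !det_mulmx mulrC.
  move/(mulfI (hQ z hz)) => ->.
  rewrite -char_poly_horner char_poly_compmx ?(monic_polyat sizeP leadP) //.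
    by rewrite hornerZ.
  exact: size_monic_polyat.
pose k := (-1) ^+ (m + size s) / b.
have k0 : k != 0 by rewrite mulf_neq0 ?invr_eq0 ?signr_eq0.
have pencilE z w : (polyat P z).[w] =
    k * \det (block_mx (A - w%:M) (z *: B) C (z *: D - 1%:M)).
  (* Both sides are polynomial in [z], so they need comparing only on the disk, where [1 - z D] is
     invertible. *)
  pose M : 'M[{poly K}]_(m + size s) := block_mx (map_mx polyC (A - w%:M))
    ('X *: map_mx polyC B) (map_mx polyC C) ('X *: map_mx polyC D - 1%:M).
  have Mz y : (\det M).[y] = \det (block_mx (A - w%:M) (y *: B) C (y *: D - 1%:M)).
    rewrite -mxat_det /M map_block_mx !mxat_polyC map_mxB !mxatZ !mxat_polyC hornerX.
    by rewrite map_scalar_mx /= /horner_eval hornerC.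
  rewrite horner_polyat -Mz -hornerZ; congr (_.[z]); apply: eq_on_disk => y hy.
  rewrite hornerZ Mz det_colligation_pencil ?unitD ?ltW // hchar // hpi -horner_polyat.
  have l0 : (P`_m).[y] != 0 by rewrite leadP // ltW.
  rewrite /k; set u := (-1) ^+ _; have uu : u * u = 1 by rewrite -expr2 sqrr_sign.
  by rewrite -[LHS]mul1r -uu; field; rewrite l0 b0.
have shift z w : `|z| < 1 -> (polyat P z).[w] = 0 ->
    transfer_fun A B C D z *m (Q.@[z] *m \col_j w ^+ j) = w *: (Q.@[z] *m \col_j w ^+ j).
  move=> hz hw; have hz1 := ltW hz; rewrite mulmxA hT // -mulmxA /comp_at.
  rewrite compmx_monomials ?(monic_polyat sizeP leadP) ?(size_monic_polyat sizeP leadP) //.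
    by rewrite -scalemxAr.
  by rewrite hornerZ hw mulr0.
rewrite -hn; exists A, B, C, D, Q, k; split; split=> //.
- by move=> i j; rewrite hn.
- move=> z w hz; rewrite hchar //; split=> [->|/eqP]; first by rewrite mulr0.
  by rewrite mulf_eq0 invr_eq0 (negPf (leadP z (ltW hz))) => /eqP.
move=> smooth z0 hz0; have hz1 : `|z0| <= 1 by rewrite hz0.
suff /(gram_poly_det sizeP size_coefP leadP rootsP hz0) : forall w, (polyat P z0).[w] = 0 ->
    (polyat P z0)^`().[w] != 0.
  apply: contra => /eqP dQ; have := congr1 determinant (hQQ z0 hz0).
  rewrite det_mulmx dQ mulr0 detZ => /esym/eqP; rewrite mulf_eq0 !expf_eq0 conjC_eq0.
  by rewrite (negPf (circle_neq0 hz0)) !andbF.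
move=> w0 hw0; apply/negP => /eqP hw0'.
apply: (smooth z0 w0 hz0 (rootsP z0 w0 hz0 hw0) hw0 hw0').
pose D1 : 'M[{poly K}]_(size s) := 1%:M - 'X *: map_mx polyC D.
have D1at z : D1.@[z] = 1%:M - z *: D.
  by rewrite map_mxB mxatZ mxat_polyC hornerX map_scalar_mx /= /horner_eval hornerC.
(* [w - Phi] with its denominator cleared, so that vanishing to second order in [z] becomes
   divisibility by a square. *)
pose T w := \det D1 *: ((w%:P)%:M - map_mx polyC A) - 'X *: (map_mx polyC B *m \adj D1 *m map_mx polyC C).
have Tat w z : `|z| <= 1 -> (T w).@[z] = (b * (P`_m).[z]) *: (w%:M - transfer_fun A B C D z).
  move=> hz; rewrite /T map_mxB !mxatZ map_mxB map_scalar_mx !mxatM !mxat_polyC map_mx_adj.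
  have adjE : \adj (1%:M - z *: D) = (b * (P`_m).[z]) *: invmx (1%:M - z *: D).
    rewrite /invmx unitD // hpi scalerA mulfV ?scale1r // -hpi.
    by have := unitD z hz; rewrite unitmxE unitfE.
  rewrite -mxat_det D1at hornerX hpi adjE /= /horner_eval hornerC.
  rewrite -scalemxAr -scalemxAl scalerA [z * _]mulrC -(scalerA _ z) -scalerBr; congr (_ *: _).
  by rewrite /transfer_fun opprD addrA.
have TP w : (\det D1) ^+ m * P.[w%:P] = P`_m * \det (T w).
  apply: eq_on_disk => y hy; have l0 : (P`_m).[y] != 0 by rewrite leadP // ltW.
  rewrite !hornerM horner_exp -!mxat_det Tat ?ltW // detZ hchar // D1at hpi -horner_polyat.
  by field.
have pi0 : b * (P`_m).[z0] != 0 by rewrite mulf_neq0 ?leadP.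
have hchar0 w : (polyat P z0).[w] = (P`_m).[z0] * \det (w%:M - transfer_fun A B C D z0).
  have := congr1 (horner^~ z0) (TP w).
  rewrite !hornerM horner_exp -!mxat_det Tat // detZ D1at hpi -horner_polyat mulrCA.
  by move/(mulfI (expf_neq0 m pi0)).
have [U [d [Uu UF]]] := unitary_diagonalization (transfer_fun_unitary hU (unitD z0 hz1) hz0).
have Uwd w : U *m (w%:M - transfer_fun A B C D z0) = (w%:M - diag_mx d) *m U.
  by rewrite mulmxBr mulmxBl UF scalar_mxC.
have charE : polyat P z0 = (P`_m).[z0] *: \prod_i ('X - (d 0 i)%:P).
  apply: eq_on_circle => w _; rewrite hchar0 hornerZ horner_prod; congr (_ * _).
  have := congr1 determinant (Uwd w); rewrite !det_mulmx mulrC => /(mulIf _) ->.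
    have -> : w%:M - diag_mx d = diag_mx (\row_i (w - d 0 i)).
      by apply/matrixP => i j; rewrite !mxE mulrnBl.
    by rewrite det_diag; apply: eq_bigr => i _; rewrite mxE hornerXsubC.
  by rewrite -unitfE -unitmxE.
have /existsP[i /eqP di] : [exists i, d 0 i == w0].
  move/eqP: hw0; rewrite charE hornerZ mulf_eq0 (negPf (leadP z0 hz1)) horner_prod prodf_seq_eq0.
  by case/hasP => i _ /=; rewrite hornerXsubC subr_eq0 eq_sym => h; apply/existsP; exists i.
have /existsP[j /andP[ji /eqP dj]] : [exists j, (j != i) && (d 0 j == w0)].
  move/eqP: hw0'; rewrite charE derivZ hornerZ mulf_eq0 (negPf (leadP z0 hz1)) (bigD1 i) //=.
  rewrite derivM derivXsubC mul1r hornerD hornerM hornerXsubC di subrr mul0r addr0 horner_prod.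
  rewrite prodf_seq_eq0; case/hasP => j _ /andP[ji].
  by rewrite hornerXsubC subr_eq0 eq_sym => h; apply/existsP; exists j; rewrite ji.
(* The spectral theorem makes the double root a double eigenvalue with independent eigenvectors: in
   the basis [U] two rows of [T w0] vanish at [z0], and each contributes a factor [X - z0] to the
   determinant. *)
have row0 i' l : d 0 i' = w0 -> ((map_mx polyC U *m T w0) i' l).[z0] = 0.
  move=> dk; have := congr1 (fun M : 'M_m => M i' l) (mxatM (map_mx polyC U) (T w0) z0).
  rewrite mxE /horner_eval => ->; rewrite mxat_polyC Tat // -scalemxAr Uwd mulmxBl.
  by rewrite mul_scalar_mx mul_diag_mx !mxE dk subrr mulr0.
have dv : ('X - z0%:P) ^+ 2 %| \det (map_mx polyC U *m T w0).
  by apply: (@det_sqr_dvd _ _ i j); rewrite 1?eq_sym // => l; apply: row0.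
apply: sqr_dvd_deriv; move: dv; rewrite det_mulmx det_map_mx mul_polyC dvdpZr; last first.
  by rewrite -unitfE -unitmxE.
move=> dv; have : ('X - z0%:P) ^+ 2 %| (\det D1) ^+ m * P.[w0%:P] by rewrite TP dvdp_mull.
rewrite Gauss_dvdpr // coprimep_expl // coprimep_expr // coprimep_sym coprimep_XsubC /root.
by rewrite -mxat_det D1at hpi.
Qed.
End Existence.
End DeterminantalForm.

(** * Zeros of bivariate polynomials *)

Section BivariateZeros.
Variable K : numClosedFieldType.
Implicit Types (p q : {poly {poly K}}) (z w e : K).

Lemma horner2E p z w : p.[z, w] = (polyat p w).[z].
Proof. by rewrite horner_polyat. Qed.

Lemma polyat_swapXY p z : polyat (swapXY p) z = p.[z%:P].
Proof. by rewrite horner_polyC. Qed.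

Lemma pos_below2 (a b : K) : 0 < a -> 0 < b -> exists c : K, [/\ 0 < c, c < a & c < b].
Proof.
move=> a0 b0; have s0 : 0 < a + b by rewrite addr_gt0.
exists (a * b / (a + b)); split; first by rewrite divr_gt0 ?mulr_gt0.
  by rewrite -mulrA gtr_pMr // ltr_pdivrMr // mul1r ltrDr.
by rewrite mulrAC gtr_pMl // ltr_pdivrMr // mul1r ltrDl.
Qed.

Lemma nonroot_on_circle (q : {poly K}) y r : q != 0 -> 0 < r ->
  exists2 x : K, `|x - y| = r & q.[x] != 0.
Proof.
move=> q0 r0; have s2 : size (r *: 'X + y%:P) = 2.
  by rewrite size_polyDl ?size_scale ?gt_eqF // size_polyX // ltnS size_polyC leq_b1.
have [|u hu qu] := @circle_nonroot _ (q \Po (r *: 'X + y%:P)).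
  by rewrite comp_poly_eq0 ?s2.
exists (r * u + y); first by rewrite addrK normrM hu mulr1 gtr0_norm.
by move: qu; rewrite horner_comp !hornerE.
Qed.

Lemma nonroot_near (q : {poly K}) z e : q != 0 -> 0 < e -> `|z| <= 1 ->
  exists2 x : K, `|x - z| < e /\ `|x| < 1 & q.[x] != 0.
Proof.
move=> q0 e0 hz; have [c [c0 c1 ce]] := pos_below2 ltr01 e0.
have c4 : 0 < c / 4 by rewrite divr_gt0.
(* Moving the centre inward by the factor [1 - c / 2] keeps the circle of radius [c / 4] inside the
   disk and within [c] of [z]. *)
have [x xr qx] := nonroot_on_circle (z * (1 - c / 2)) q0 c4.
have h2 : 0 < c / 2 by rewrite divr_gt0.
have c2 : 0 <= 1 - c / 2.
  by rewrite subr_ge0 ler_pdivrMr // mul1r (le_trans (ltW c1)) // ler1n.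
exists x => //; split.
  apply: le_lt_trans ce; have -> : x - z = (x - z * (1 - c / 2)) - z * (c / 2) by ring.
  apply: le_trans (ler_normB _ _) _; rewrite xr normrM (gtr0_norm h2).
  apply: (@le_trans _ _ (c / 4 + c / 2)); first by rewrite lerD2l ler_piMl // ltW.
  have -> : c / 4 + c / 2 = c * (3 / 4) by field.
  by rewrite ler_piMr ?(ltW c0) // ler_pdivrMr // mul1r ler_nat.
rewrite -(subrK (z * (1 - c / 2)) x); apply: le_lt_trans (ler_normD _ _) _.
rewrite xr normrM (ger0_norm c2); apply: (@le_lt_trans _ _ (c / 4 + (1 - c / 2))).
  by rewrite lerD2l ler_piMl.
have -> : c / 4 + (1 - c / 2) = 1 - c / 4 by field.
by rewrite gtrDl oppr_lt0.
Qed.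

(** Roots stay at distance at least [e] from [z], so [|w - x| <= 2 |z - x|] for each of them. *)
Lemma disk_upper (q : {poly K}) N z w e : (size q <= N.+1)%N ->
  (forall y, `|y - z| < e -> q.[y] != 0) -> `|w - z| <= e -> `|q.[w]| <= 2 ^+ N * `|q.[z]|.
Proof.
move=> sq hq hw; have [->|q0] := eqVneq q 0.
  by rewrite !horner0 normr0 mulr0.
have [s es ss] := poly_prod_XsubC q0; rewrite ss ltnS in sq.
rewrite es !hornerZ !normrM mulrCA ler_wpM2l // !horner_prod !normr_prod.
apply: (@le_trans _ _ (2 ^+ size s * \prod_(x <- s) `|('X - x%:P).[z]|)); last first.
  by rewrite ler_wpM2r ?prodr_ge0 // ler_weXn2l // ler1n.
rewrite -prodr_const_seq -big_split big_seq [leRHS]big_seq ler_prod // => x hx.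
rewrite normr_ge0 !hornerXsubC /= mulr_natl mulr2n.
have -> : w - x = (w - z) + (z - x) by ring.
apply: le_trans (ler_normD _ _) _; rewrite lerD2r (le_trans hw) // real_leNgt ?normr_real //.
  rewrite distrC; apply/negP => /hq /negP[]; apply/eqP; exact: prod_XsubC_root0 es hx.
by apply: ger0_real; apply: le_trans hw.
Qed.

(* A zero can only disappear under a small perturbation of [z] if [p] takes
   values of comparable size at [w0] and at all neighbouring points. *)
Lemma zero_continuity p z0 w0 e : p.[z0%:P] != 0 -> p.[z0, w0] = 0 -> 0 < e ->
  exists2 d : K, 0 < d & forall z, `|z - z0| < d -> exists2 w, `|w - w0| < e & p.[z, w] = 0.
Proof.
move=> hz0 hw0 e0; have [w1 hw1 q1] := nonroot_on_circle w0 hz0 e0.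
pose b := `|z0| + 1 + (`|w0| + e).
have bz z : `|z - z0| <= 1 -> `|z| <= b.
  move=> h; rewrite -(subrK z0 z); apply: le_trans (ler_normD _ _) _.
  by rewrite addrC /b -addrA lerD2l (le_trans h) // lerDl addr_ge0 // ltW.
have bw w : `|w - w0| <= e -> `|w| <= b.
  move=> h; rewrite -(subrK w0 w); apply: le_trans (ler_normD _ _) _.
  by rewrite addrC /b; apply: (@le_trans _ _ (`|w0| + e)); rewrite ?lerD2l // lerDr addr_ge0.
have b0 : 0 <= b by rewrite !addr_ge0 // ltW.
have [k k0 L] := lipschitz_ball2 p b0; pose N := sizeY p.
have k1 : 0 <= k * (1 + 2 ^+ N) by rewrite mulr_ge0 // addr_ge0 ?exprn_ge0.
have n1 : 0 < `|p.[z0, w1]| by rewrite normr_gt0.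
have [d [d0 d1 kd]] := small_multiplier k1 n1.
exists d => // z hz; have [q0|q0] := eqVneq p.[z%:P] 0.
  by exists w0; rewrite ?subrr ?normr0 // q0 horner0.
have near w : `|w - w0| <= e -> `|p.[z, w] - p.[z0, w]| <= k * d.
  move=> hw; have hz1 : `|z - z0| <= 1 by apply: ltW (lt_trans hz d1).
  have hz00 : `|z0 - z0| <= 1 by rewrite subrr normr0 ler01.
  have [h _] := L w w z z0 (bw w hw) (bw w hw) (bz z hz1) (bz z0 hz00).
  rewrite !horner2E; apply: le_trans h _.
  by rewrite subrr normr0 add0r ler_wpM2l // ltW.
have [s es _] := poly_prod_XsubC q0.
have [/hasP[w ws hw]|/hasPn no] := boolP (has (fun x => `|x - w0| < e) s).
  by exists w => //; apply: prod_XsubC_root0 es ws.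
exfalso; have up : `|p.[z, w1]| <= 2 ^+ N * `|p.[z, w0]|.
  apply: (@disk_upper _ _ _ _ e); rewrite ?hw1 //.
    by rewrite leqW // max_size_evalC.
  move=> y hy; apply: contraL hy => qy; apply: no.
  move: qy; rewrite es hornerZ mulf_eq0 lead_coef_eq0 (negPf q0) /= => qy.
  by rewrite -root_prod_XsubC.
have := near w0; rewrite subrr normr0 hw0 subr0 => /(_ (ltW e0)) h0.
have := near w1; rewrite hw1 distrC => /(_ (lexx _)) h1.
suff /le_lt_trans/(_ kd) : `|p.[z0, w1]| <= k * (1 + 2 ^+ N) * d by rewrite ltxx.
rewrite -[p.[z0, w1]](subrK p.[z, w1]); apply: le_trans (ler_normD _ _) _.
rewrite mulrAC mulrDr mulr1 lerD // (le_trans up) // mulrC ler_wpM2r ?exprn_ge0 //.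
Qed.

Definition adherent_zero p z0 w0 := forall e, 0 < e -> exists z w,
  [/\ `|z| < 1, `|w| < 1, `|z - z0| < e, `|w - w0| < e & p.[z, w] = 0].

Definition exits_through_torus p := forall z0 w0, adherent_zero p z0 w0 ->
  `|z0| = 1 \/ `|w0| = 1 -> `|z0| = 1 /\ `|w0| = 1.

Definition bidegree_minimal p := forall q,
  (forall z w, `|z| < 1 -> `|w| < 1 -> q.[z, w] = 0 <-> p.[z, w] = 0) ->
  (size p <= size q)%N /\ (sizeY p <= sizeY q)%N.

Lemma exits_through_torus_swap p : exits_through_torus p -> exits_through_torus (swapXY p).
Proof.
move=> h z0 w0 hzw hc; suff: `|w0| = 1 /\ `|z0| = 1 by case.
apply: h; last by case: hc; [right | left].
move=> e e0; have [z [w [z1 w1 hz hw hp]]] := hzw e e0.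
by exists w, z; rewrite -horner2_swapXY.
Qed.

Lemma bidegree_minimal_swap p : bidegree_minimal p -> bidegree_minimal (swapXY p).
Proof.
move=> h q hq; have [|h1 h2] := h (swapXY q).
  by move=> z w hz hw; rewrite horner2_swapXY hq // horner2_swapXY.
by rewrite !sizeYE swapXYK -!sizeYE; move: h1 h2; rewrite !sizeYE swapXYK.
Qed.

Lemma disk_radial z e : `|z| = 1 -> 0 < e -> exists2 x : K, `|x| < 1 & `|x - z| < e.
Proof.
move=> hz e0; have [c [c0 c1 ce]] := pos_below2 ltr01 e0.
exists ((1 - c) * z).
  by rewrite normrM hz mulr1 ger0_norm ?subr_ge0 ?(ltW c1) // gtrDl oppr_lt0.
have -> : (1 - c) * z - z = - (c * z) by ring.
by rewrite normrN normrM hz mulr1 gtr0_norm.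
Qed.

(** Over a point of the disk the line would leave the bidisk off the torus; over any other point the
    factor has no zeros in the bidisk and could be dropped, against minimality. *)
Lemma no_vertical_line p z : p != 0 -> exits_through_torus p -> bidegree_minimal p ->
  p.[z%:P] != 0.
Proof.
move=> p0 hT hM; apply/eqP => pz.
have [z1|z1] := real_ltP (normr_real z) (rpred1 _).
  have [||h _] := hT z 1; [|by right; rewrite normr1|by rewrite h ltxx in z1].
  move=> e e0; have [x x1 xe] := disk_radial (normr1 K) e0.
  by exists z, x; rewrite subrr normr0 pz horner0.
have /factor_theorem[q hq] : root p z%:P by apply/rootP.
have q0 : q != 0 by apply: contraNneq p0 => q0; rewrite hq q0 mul0r.
have [|h _] := hM q.
  move=> x w x1 w1; rewrite hq hornerM hornerXsubC hornerM -polyCB hornerC.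
  split=> [->|/eqP]; first by rewrite mul0r.
  rewrite mulf_eq0 subr_eq0 => /orP[/eqP //|/eqP xz].
  by move: x1; rewrite xz real_ltNge ?rpred1 ?normr_real // z1.
by move: h; rewrite hq size_Mmonic ?monicXsubC // size_XsubC addn2 ltnn.
Qed.

Lemma no_zero_circle_disk p z w : p != 0 -> exits_through_torus p -> bidegree_minimal p ->
  `|z| = 1 -> `|w| < 1 -> p.[z, w] != 0.
Proof.
move=> p0 hT hM hz hw; apply/eqP => hp.
have [||_ h] := hT z w; [|by left|by rewrite h ltxx in hw].
move=> e e0; have w1 : 0 < 1 - `|w| by rewrite subr_gt0.
have [c [c0 ce c1]] := pos_below2 e0 w1.
have [d d0 hd] := zero_continuity (no_vertical_line z p0 hT hM) hp c0.
have [b [b0 be bd]] := pos_below2 e0 d0.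
have [x x1 xb] := disk_radial hz b0.
have [y yc hy] := hd x (lt_trans xb bd).
exists x, y; split=> //; [|exact: lt_trans be|exact: lt_trans ce].
rewrite -(subrK w y); apply: le_lt_trans (ler_normD _ _) _.
by rewrite -ltrBrDr (lt_trans yc).
Qed.

Lemma primitive_part q : q != 0 -> exists (c : {poly K}) (q' : {poly {poly K}}),
  [/\ c != 0, q = c *: q' & forall z, polyat q' z != 0].
Proof.
have [k] := ubnP (size (lead_coef q)); elim: k q => // k IH q sk q0.
have [h|/boolp.existsNP[z /negP/negPn/eqP hz]] := boolp.pselect (forall z, polyat q z != 0).
  by exists 1, q; rewrite oner_eq0 scale1r.
pose b := 'X - z%:P; pose r := map_poly (fun u => u %/ b) q.
have qr : q = b *: r.
  apply/polyP => i; rewrite coefZ coef_map_id0 ?div0p // mulrC divpK //.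
  rewrite dvdp_XsubCl; apply/rootP.
  by rewrite -coef_polyat hz coef0.
have b0 : b != 0 by rewrite polyXsubC_eq0.
have r0 : r != 0 by apply: contraNneq q0 => r0; rewrite qr r0 scaler0.
have [|c [q' [c0 rE hq']]] := IH r _ r0.
  rewrite -ltnS; apply: leq_trans sk; rewrite qr lead_coefZ size_mul ?lead_coef_eq0 //.
  by rewrite size_XsubC.
by exists (b * c), q'; rewrite mulf_neq0 // -scalerA -rE.
Qed.

Lemma zero_closed p z0 w0 : adherent_zero p z0 w0 -> p.[z0, w0] = 0.
Proof.
move=> h; apply/eqP; apply: contraT; rewrite -normr_gt0 => n0.
pose b := 1 + `|z0| + `|w0|; have b0 : 0 <= b by rewrite !addr_ge0.
have [k k0 L] := lipschitz_ball2 p b0; have k2 : 0 <= k * 2 by rewrite mulr_ge0.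
have [d [d0 d1 kd]] := small_multiplier k2 n0; have [z [w [z1 w1 hz hw hp]]] := h d d0.
have bz : `|z| <= b by rewrite (le_trans (ltW z1)) // /b -addrA lerDl addr_ge0.
have bw : `|w| <= b by rewrite (le_trans (ltW w1)) // /b -addrA lerDl addr_ge0.
have bz0 : `|z0| <= b by rewrite /b addrAC lerDr addr_ge0.
have bw0 : `|w0| <= b by rewrite /b lerDr addr_ge0.
have [hL _] := L w w0 z z0 bw bw0 bz bz0.
move: hL; rewrite -!horner2E hp sub0r normrN => hL.
have := le_lt_trans hL (le_lt_trans _ kd); rewrite ltxx; apply.
by rewrite -mulrA ler_wpM2l // mulr_natl mulr2n lerD // ltW.
Qed.

(** After removal of the content, neither polynomial has vertical lines. Each zero is then a limit
    of zeros over generic [z], where the two zero sets agree, and zero sets are closed; so they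
    agree on the whole bidisk. *)
Lemma generically_minimal_swap p : (forall z, p.[z%:P] != 0) -> bidegree_minimal p ->
  generically_minimal (swapXY p).
Proof.
move=> nz hM F e e0 F0 hF; have [c [F' [c0 FE nzF']]] := primitive_part F0.
pose g := e * c; have g0 : g != 0 by rewrite mulf_neq0.
have gen z w : `|z| < 1 -> `|w| < 1 -> g.[z] != 0 -> (swapXY F').[z, w] = 0 <-> p.[z, w] = 0.
  move=> hz hw; rewrite hornerM mulf_eq0 negb_or => /andP[ez cz].
  have := hF z hz ez w hw; rewrite FE polyatZ hornerZ polyat_swapXY.
  rewrite -horner2E horner2_swapXY => <-.
  split=> [->|/eqP]; first by rewrite mulr0.
  by rewrite mulf_eq0 (negPf cz) => /eqP.
have transfer q q' z w : (forall z, q.[z%:P] != 0) ->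
    (forall z w, `|z| < 1 -> `|w| < 1 -> g.[z] != 0 -> q.[z, w] = 0 -> q'.[z, w] = 0) ->
    `|z| < 1 -> `|w| < 1 -> q.[z, w] = 0 -> q'.[z, w] = 0.
  move=> nzq hqq hz hw hq; apply: zero_closed => eps eps0.
  have w1 : 0 < 1 - `|w| by rewrite subr_gt0.
  have [a [a0 ae a1]] := pos_below2 eps0 w1.
  have [d d0 hd] := zero_continuity (nzq z) hq a0.
  have [b [b0 be bd]] := pos_below2 eps0 d0.
  have [x [xb x1] gx] := nonroot_near g0 b0 (ltW hz).
  have [y ya hy] := hd x (lt_trans xb bd).
  have y1 : `|y| < 1.
    rewrite -(subrK w y); apply: le_lt_trans (ler_normD _ _) _.
    by rewrite -ltrBrDr (lt_trans ya).
  by exists x, y; split=> //; [exact: lt_trans be|exact: lt_trans ae|exact: hqq].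
have [|_] := hM (swapXY F').
  move=> z w hz hw; split.
    by apply: transfer => // [x|x y hx hy gx]; [rewrite -polyat_swapXY swapXYK | case: (gen x y hx hy gx)].
  by apply: transfer => // x y hx hy gx; case: (gen x y hx hy gx).
by rewrite !sizeYE swapXYK FE size_scale.
Qed.

End BivariateZeros.

(** * Distinguished varieties *)

Lemma real_expr_lt (R : archiRealFieldType) (r e : R) : 0 <= r -> r < 1 -> 0 < e ->
  exists M : nat, r ^+ M < e.
Proof.
rewrite le_eqVlt => /orP[/eqP <- _ e0|r0 r1 e0]; first by exists 1.
pose h := r^-1 - 1; have h0 : 0 < h by rewrite subr_gt0 invf_gt1.
have rh : r^-1 = 1 + h by rewrite addrC subrK.
have bern M : 1 + M%:R * h <= r^-1 ^+ M.
  elim: M => [|M IH]; first by rewrite mul0r addr0 expr0.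
  rewrite exprSr; apply: le_trans (_ : (1 + M%:R * h) * r^-1 <= _); last first.
    by rewrite ler_wpM2r // invr_ge0 ltW.
  rewrite rh -natr1 -subr_ge0 (_ : _ - _ = M%:R * (h * h)); last by ring.
  by rewrite !mulr_ge0 // ltW.
have eh : 0 <= (e * h)^-1 by rewrite invr_ge0 mulr_ge0 // ltW.
exists (Num.bound (e * h)^-1); set M := Num.bound _.
have hM : (e * h)^-1 < M%:R by apply: archi_boundP.
rewrite -[r]invrK exprVn invf_plt ?posrE ?exprn_gt0 ?invr_gt0 //.
apply: lt_le_trans (bern M); rewrite ltr_wpDl //.
by rewrite -ltr_pdivrMr // -invfM.
Qed.

Lemma complex_expr_lt (R : realType) (r e : R[i]) : 0 <= r -> r < 1 -> 0 < e ->
  exists M : nat, r ^+ M < e.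
Proof.
move=> r0 r1 e0; have er := RRe_real (ger0_real r0); have ee := RRe_real (gtr0_real e0).
have [|||M hM] := @real_expr_lt R (complex.Re r) (complex.Re e).
- by rewrite -lecR er.
- by rewrite -ltcR er.
- by rewrite -ltcR ee.
by exists M; rewrite -er -ee -rmorphXn ltcR.
Qed.

Lemma transfer_rational (K : numClosedFieldType) m n (A : 'M[K]_m) (B : 'M_(m, n))
    (C : 'M_(n, m)) (D : 'M_n) :
  (forall z : K, `|z| <= 1 -> 1%:M - z *: D \in unitmx) ->
  exists (q : {poly K}) (N : 'M[{poly K}]_m), forall z, `|z| <= 1 ->
    q.[z] != 0 /\ transfer_fun A B C D z = (q.[z])^-1 *: N.@[z].
Proof.
move=> hD; pose D1 : 'M[{poly K}]_n := 1%:M - 'X *: map_mx polyC D.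
have D1at z : D1.@[z] = 1%:M - z *: D.
  by rewrite map_mxB mxatZ mxat_polyC hornerX map_scalar_mx /= /horner_eval hornerC.
exists (\det D1), (\det D1 *: map_mx polyC A + 'X *: (map_mx polyC B *m \adj D1 *m map_mx polyC C)).
move=> z hz; have hu := hD z hz.
have d0 : (\det D1).[z] != 0 by rewrite -mxat_det D1at -unitfE -unitmxE.
split=> //; rewrite map_mxD !mxatZ !mxatM !mxat_polyC map_mx_adj D1at hornerX.
rewrite scalerDr scalerA mulVf // scale1r /transfer_fun; congr (_ + _).
rewrite scalerA mulrC -scalerA; congr (_ *: _).
by rewrite /invmx hu -mxat_det D1at -scalemxAr -scalemxAl.
Qed.

(** * From the topological definition to the algebraic hypotheses *)

Section FinalAssembly.
Variable R : realType.
Local Notation C2 := (R[i] * R[i])%type.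
Local Notation C2top := (R[i]^o * R[i]^o)%type.
Local Open Scope classical_set_scope.
Implicit Types (p : {poly {poly R[i]}}).

Lemma zero_set_closure p (z0 w0 : R[i]) : adherent_zero p z0 w0 ->
  closure (zero_set p : set C2top) (z0, w0).
Proof.
move=> h B [[U1 U2] /= [h1 h2] hB].
have /nbhs_ballP[e1 /= e10 b1] := h1; have /nbhs_ballP[e2 /= e20 b2] := h2.
have [e [e0 l1 l2]] := pos_below2 e10 e20.
have [z [w [z1 w1 hz hw hp]]] := h e e0.
exists (z, w); split; first by split.
apply: hB; split => /=.
- by apply: b1; rewrite -ball_normE /= distrC (lt_trans hz).
- by apply: b2; rewrite -ball_normE /= distrC (lt_trans hw).
Qed.

Lemma distinguished_exits p : distinguished_variety (zero_set p) -> exits_through_torus p.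
Proof.
case=> _ _ hcl z0 w0 /zero_set_closure hz hzw.
suff : (closure (zero_set p : set C2top) `&` (torus (R := R) : set C2top)) (z0, w0) by case=> _ [].
rewrite -hcl; split=> //; split.
  by apply: (closure_subset _ hz) => x [].
move=> /interior_subset [/= h1 h2].
by case: hzw => e; [rewrite e ltxx in h1 | rewrite e ltxx in h2].
Qed.

Lemma minimal_degree_bidegree p n m : minimal_degree (zero_set p) n m p -> bidegree_minimal p.
Proof.
case=> _ hm q hq; apply: hm; apply/seteqP; split=> -[z w] [[/= hz hw] /= h]; split=> //=.
  by rewrite -hq.
by rewrite hq.
Qed.

Lemma polyat_swap_horner p z w : (polyat (swapXY p) z).[w] = p.[z, w].
Proof. by rewrite polyat_swapXY. Qed.

Lemma smooth_of_no_singularities p : no_singularities_on_torus p -> smooth_on_torus (swapXY p).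
Proof.
move=> h z w hz hw h0 hdw hdz; apply: h; exists (z, w); first by split.
split=> /=; first by rewrite -polyat_swap_horner.
  by rewrite horner2E polyat_deriv -hdz horner_swapXY.
rewrite -hdw polyat_swapXY; congr (_.[w]).
rewrite (horner_coef_wide _ (size_poly _ _ : (size (map_poly (@deriv _) p) <= size p)%N)).
rewrite [in RHS]horner_coef raddf_sum; apply: eq_bigr => i _; rewrite coef_map_id0 ?deriv0 //=.
by rewrite -polyC_exp ![_ * _%:P]mulrC !mul_polyC derivZ.
Qed.

Definition monomial_sum m (Qz : 'M[{poly R[i]}]_m) : 'cV[{poly {poly R[i]}}]_m :=
  \col_i swapXY (\sum_(j < m) Qz i j *: 'X^j).

Lemma monomial_sum_eval m (Qz : 'M[{poly R[i]}]_m) z w :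
  mxeval2 (monomial_sum Qz) z w = mxeval Qz z *m monomials m w.
Proof.
apply/colP => i; rewrite !mxE -polyat_swap_horner swapXYK /polyat rmorph_sum horner_sum.
by apply: eq_bigr => j _; rewrite !mxE /= map_polyZ map_polyXn hornerZ hornerXn.
Qed.

Lemma monomial_sum_degree n m (Qz : 'M[{poly R[i]}]_m) : (0 < m)%N ->
  (forall i j, (size (Qz i j) <= n.+1)%N) ->
  forall i, degree_at_most n m.-1 (monomial_sum Qz i 0).
Proof.
move=> m0 sQ i; rewrite /degree_at_most mxE prednK // [sizeY _]sizeYE swapXYK -sizeYE; split.
  apply/bigmax_leqP => k _; rewrite coef_sum (leq_trans (size_sum _ _ _)) //.
  apply/bigmax_leqP => j _; rewrite coefZ coefXn; case: eqP => _; first by rewrite mulr1.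
  by rewrite mulr0 size_poly0.
rewrite (leq_trans (size_sum _ _ _)) //; apply/bigmax_leqP => j _.
by rewrite (leq_trans (size_scale_leq _ _)) // size_polyXn.
Qed.

Lemma monomials_neq0 m (w : R[i]) : (0 < m)%N -> monomials m w != 0.
Proof.
case: m => // m _; apply/negP => /eqP/colP/(_ 0); rewrite !mxE expr0 => /eqP.
by rewrite oner_eq0.
Qed.

Lemma eigenvalue_not_unimodular n (D : 'M[R[i]]_n) :
  (forall z : R[i], `|z| <= 1 -> 1%:M - z *: D \in unitmx) ->
  forall l : R[i], eigenvalue D l -> `|l| <> 1.
Proof.
move=> hD l /eigenvalueP[v hv v0] hl; apply/negP: v0; rewrite negbK.
have hu : `|l^*| <= 1 by rewrite norm_conjC hl.
rewrite -[v](mulmxK (hD _ hu)) mulmxBr mulmx1 -scalemxAr hv scalerA mulrC.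
by rewrite (conj_circle hl) mulfV ?circle_neq0 // scale1r subrr mul0mx.
Qed.

Lemma transfer_rational_inner m n (A : 'M[R[i]]_m) (B : 'M_(m, n)) (C : 'M_(n, m))
    (D : 'M_n) : block_mx A B C D \is unitarymx ->
  (forall z : R[i], `|z| <= 1 -> 1%:M - z *: D \in unitmx) ->
  rational_inner (transfer A B C D).
Proof.
move=> hU hD; split; first exact: transfer_rational hD.
by move=> z hz; apply: transfer_fun_unitary; rewrite ?hD ?hz.
Qed.

Theorem distinguished_representation n m p : (distinguished_variety (zero_set p)) ->
  minimal_degree (zero_set p) n m p ->
  exists (A : 'M[R[i]]_m) (B : 'M_(m, n)) (C : 'M_(n, m)) (D : 'M_n) (Qz : 'M[{poly R[i]}]_m),
  [/\ (0 < m)%N, determinantal_representation (zero_set p) p A B C D (monomial_sum Qz),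
      forall i j, (size (Qz i j) <= n.+1)%N, forall z, `|z| < 1 -> mxeval Qz z \in unitmx &
      no_singularities_on_torus p -> forall z, `|z| = 1 -> mxeval Qz z \in unitmx].
Proof.
move=> hV hm; have hT := distinguished_exits hV; have hM := minimal_degree_bidegree hm.
have [sp sY] := hm.1; have p0 : p != 0 by rewrite -size_poly_eq0 sp.
have p'0 : swapXY p != 0 by rewrite swapXY_eq0.
have hT' := exits_through_torus_swap hT; have hM' := bidegree_minimal_swap hM.
have sizeP : size (swapXY p) = m.+1 by rewrite -sizeYE.
have sizePY : sizeY (swapXY p) = n.+1 by rewrite sizeYE swapXYK.
(* If [m = 0] then [p] depends on [z] alone, and a point of the variety gives a vertical line. *)
have m0 : (0 < m)%N.
  rewrite lt0n; apply/eqP => m0; have [[[z w] [[/= hz hw] hp]] _ _] := hV.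
  have := no_vertical_line z p0 hT hM; rewrite -polyat_swapXY => /negP; apply.
  have s1 : (size (polyat (swapXY p) z) <= 1)%N by rewrite (leq_trans (size_poly _ _)) // sizeP m0.
  move: hp; rewrite -polyat_swap_horner (size1_polyC s1) hornerC => ->.
  by rewrite eqxx.
have max : exists j : nat, size ((swapXY p)`_j)%R = n.+1.
  have : (0 < #|'I_(size (swapXY p))|)%N by rewrite card_ord sizeP.
  move=> /(@bigop.eq_bigmax _ (fun i : 'I_(size (swapXY p)) => size ((swapXY p)`_i)%R)) [i hi].
  by exists i; rewrite -hi -sizePY.
have [A [B [C [D [Q [c [[hU sQ hD hp] [hdet hQ hrel hsm]]]]]]]] :=
  determinantal_form (complex_expr_lt (R := R)) m0 sizeP
   (fun j => leq_trans (max_size_coefXY _ _) (eq_leq sizePY)) max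
   (fun z => eq_ind_r (fun q => q != 0) (no_vertical_line z p0 hT hM) (polyat_swapXY p z))
   (fun z w hz hw => eq_ind_r (fun x => x != 0) (no_zero_circle_disk p0 hT hM hz hw)
     (polyat_swap_horner p z w))
   (fun z w hz hw => eq_ind_r (fun x => x != 0)
     (eq_ind_r (fun x => x != 0) (no_zero_circle_disk p'0 hT' hM' hw hz) (esym (horner2_swapXY p w z)))
     (polyat_swap_horner p z w))
   (generically_minimal_swap (fun z => no_vertical_line z p0 hT hM) hM).
have hQu z : `|z| < 1 -> mxeval Q z \in unitmx by move=> hz; rewrite unitmxE unitfE; apply: hQ.
exists A, B, C, D, Q; split=> //; last first.
  move=> /smooth_of_no_singularities/hsm h z hz; rewrite unitmxE unitfE; exact: h.
split; first by split=> //; apply: monomial_sum_degree.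
split; [exact: eigenvalue_not_unimodular| | |].
- by exists c => z w; rewrite -polyat_swap_horner hp.
- split=> //; first exact: transfer_rational_inner.
  apply/seteqP; split=> -[z w] [[/= hz hw] h]; split=> //.
    by apply/hdet => //; rewrite polyat_swap_horner.
  by rewrite /= -polyat_swap_horner; apply/(hdet _ _ hz).
split.
  (* The set is in fact empty: [Q] is invertible on the disk and the monomial vector starts with
     1. *)
  apply: (sub_finite_set _ (finite_set0 _)) => -[z w] [[[/= hz hw] _]].
  rewrite monomial_sum_eval => /(congr1 (mulmx (invmx (mxeval Q z)))).
  by rewrite mulKmx ?hQu // mulmx0 => /eqP; rewrite (negPf (monomials_neq0 _ m0)).
move=> [z w] [[/= hz hw] h]; rewrite !monomial_sum_eval.
by apply: hrel => //; rewrite polyat_swap_horner.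
Qed.

End FinalAssembly.

Local Open Scope classical_set_scope.

Theorem theorem2p19 (R : realType) (V : set (R[i] * R[i])) (n m : nat)
    (p : {poly {poly R[i]}})
    (hV : distinguished_variety V)
    (hVp : V = zero_set p)
    (hp : minimal_degree V n m p) :
  (exists (A : 'M[R[i]]_m) (B : 'M[R[i]]_(m, n)) (C : 'M[R[i]]_(n, m))
          (D : 'M[R[i]]_n) (Q : 'cV[{poly {poly R[i]}}]_m),
     determinantal_representation V p A B C D Q) /\
  (no_singularities_on_torus p ->
   exists (A : 'M[R[i]]_m) (B : 'M[R[i]]_(m, n)) (C : 'M[R[i]]_(n, m))
          (D : 'M[R[i]]_n) (Q : 'cV[{poly {poly R[i]}}]_m)
          (Qz : 'M[{poly R[i]}]_m),
     [/\ determinantal_representation V p A B C D Q,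
         forall i j, (size (Qz i j) <= n.+1)%N,
         forall z w : R[i], mxeval2 Q z w = mxeval Qz z *m monomials m w,
         forall z : R[i], `|z| <= 1 -> mxeval Qz z \in unitmx
       & forall z w : R[i], `|z| <= 1 -> `|w| <= 1 -> mxeval2 Q z w <> 0]).
Proof.
subst V; have [A [B [C [D [Q [m0 hrep sQ hdisk hcircle]]]]]] := distinguished_representation hV hp.
split; first by exists A, B, C, D, (monomial_sum Q).
move=> hs; have hQ z : `|z| <= 1 -> mxeval Q z \in unitmx.
  by rewrite le_eqVlt => /orP[/eqP|]; [apply: hcircle|apply: hdisk].
exists A, B, C, D, (monomial_sum Q), Q; split=> //; first exact: monomial_sum_eval.
move=> z w hz _; rewrite monomial_sum_eval => /(congr1 (mulmx (invmx (mxeval Q z)))).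
by rewrite mulKmx ?hQ // mulmx0 => /eqP; rewrite (negPf (monomials_neq0 _ m0)).
Qed.
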